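(* Let $d\ge 1$, $0\le\gamma\le 1$, $\beta>0$, $\lambda>1$. Then we have the decomposition $$\frac{|\nabla|^{\gamma}}{\log^{\beta}(\lambda+|\nabla|)}=C_\beta\int_0^{\gamma}\tau^{\beta-1}\,|\nabla|^{\gamma-\tau}\,d\tau+P,$$ where $P$ is a smooth Fourier multiplier which maps $L^p$ to $L^p$ for all $1\le p\le+\infty$. More precisely, for any function $f$, $$(Pf)(x)=(K*f)(x)=\int_{\mathbb R^d}K(x-y)f(y)\,dy,$$ and $\|K\|_{L^1_x}\le \mathrm{Const}$.
   Context: For a function $m$ on $[0,\infty)$, $m(|\nabla|)$ denotes the Fourier multiplier on $\mathbb R^d$ with symbol $m(|\xi|)$, i.e. $\widehat{m(|\nabla|)f}(\xi)=m(|\xi|)\hat f(\xi)$, where $\hat f(\xi)=\int_{\mathbb R^d}f(x)e^{-i\xi\cdot x}\,dx$; $\log^\beta(y)=(\log y)^\beta$. $C_\beta>0$ denotes a constant depending only on $\beta$, $K$ is the convolution kernel of $P$ on $\mathbb R^d$, $L^p=L^p(\mathbb R^d)$, and $\mathrm{Const}$ denotes a finite constant. The operator identity is equivalent to the corresponding identity of symbols (replace $|\nabla|$ by $|\xi|$ and $P$ by its symbol $P(\xi)$).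
   Formalization: ''Smooth Fourier multiplier'' is proved as: the symbol P(ξ) is infinitely differentiable for ξ ≠ 0; smoothness at ξ = 0 fails (P behaves like −c/log(1/|ξ|) there for γ > 0, and has a cusp like |ξ| for γ = 0). *)

(* Defs.v *)
From HB Require Import structures.
From mathcomp Require Import all_boot all_order all_algebra.
From mathcomp Require Import all_classical all_reals all_analysis.
From mathcomp Require Import complex.

Set Implicit Arguments.
Unset Strict Implicit.
Unset Printing Implicit Defensive.

Import Order.TTheory GRing.Theory Num.Theory.
Import numFieldNormedType.Exports.

Local Open Scope classical_set_scope.
Local Open Scope ring_scope.

(* The space R^n is 'rV[R]_n.  The library has no measurable structure on row
   vectors: the sigma-algebra below is the one generated by the coordinate maps
   (the same construction as for n.-tuple), that is the Borel sigma-algebra. *)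

Definition rV_display : measure_display -> measure_display.
Proof. exact. Qed.

Section measurable_rV.
Context {R : realType}.
Variable n : nat.

Let coors : 'I_n -> 'rV[R]_n -> measurableTypeR R := fun i x => x 0 i.

Let rV_set0 : g_sigma_preimage coors set0.
Proof. exact: sigma_algebra0. Qed.

Let rV_setC A : g_sigma_preimage coors A -> g_sigma_preimage coors (~` A).
Proof. exact: sigma_algebraC. Qed.

Let rV_bigcup (F : (set 'rV[R]_n)^nat) :
  (forall i, g_sigma_preimage coors (F i)) ->
  g_sigma_preimage coors (\bigcup_i (F i)).
Proof. exact: sigma_algebra_bigcup. Qed.

HB.instance Definition _ :=
  @isMeasurable.Build (rV_display default_measure_display)
    'rV[R]_n (g_sigma_preimage coors) rV_set0 rV_setC rV_bigcup.

End measurable_rV.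

Lemma measurable_coord_rV (R : realType) n (i : 'I_n) :
  measurable_fun [set: 'rV[R]_n] (fun x : 'rV[R]_n => x 0 i : measurableTypeR R).
Proof.
move=> _ Y mY; rewrite setTI; apply: sub_sigma_algebra => /=.
rewrite -bigcup_seq/=; exists i => /=; first by rewrite mem_index_enum.
by exists Y => //; rewrite setTI.
Qed.

Lemma measurable_fun_rVP d (T : measurableType d) (R : realType) n
    (f : T -> 'rV[R]_n) :
  (forall i, measurable_fun [set: T] (fun x => f x 0 i : measurableTypeR R)) ->
  measurable_fun [set: T] f.
Proof.
move=> mf.
suff H : g_sigma_preimage
    (fun i => (fun x : 'rV[R]_n => x 0 i : measurableTypeR R) \o f) `<=` measurable.
  move: H; rewrite g_sigma_preimage_comp => H _ A mA.
  by apply: H; exists A.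
apply: smallest_sub; first exact: sigma_algebra_measurable.
rewrite -bigcup_seq/=; apply: bigcup_sub => i _ A [B mB <-].
exact: mf.
Qed.

(* Lebesgue measure on R^n, by induction on n: R^n.+1 is identified with
   R * R^n, on which we take the product measure. *)

Definition cons_rV (R : realType) n (x : measurableTypeR R * 'rV[R]_n) :
  'rV[R]_n.+1 := \row_i oapp (x.2 0) x.1 (unlift ord0 i).

Definition uncons_rV (R : realType) n (x : 'rV[R]_n.+1) :
  measurableTypeR R * 'rV[R]_n := (x 0 ord0, \row_i x 0 (lift ord0 i)).

Lemma cons_rVK (R : realType) n : cancel (@cons_rV R n) (@uncons_rV R n).
Proof.
move=> [x v]; rewrite /cons_rV /uncons_rV/= mxE unlift_none/=; congr pair.
by apply/rowP => i; rewrite !mxE liftK.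
Qed.

Lemma uncons_rVK (R : realType) n : cancel (@uncons_rV R n) (@cons_rV R n).
Proof.
move=> v; apply/rowP => i; rewrite /cons_rV /uncons_rV/= mxE.
by case: unliftP => [j ->|->]//=; rewrite mxE.
Qed.

Lemma measurable_cons_rV (R : realType) n :
  measurable_fun [set: measurableTypeR R * 'rV[R]_n] (@cons_rV R n).
Proof.
apply: measurable_fun_rVP => i; under eq_fun do rewrite mxE.
case: unliftP => [j _|_] /=; last exact: measurable_fst.
have -> : (fun x : measurableTypeR R * 'rV[R]_n => x.2 0 j) =
    (fun v : 'rV[R]_n => v 0 j : measurableTypeR R) \o snd by [].
by apply: measurableT_comp => //; exact: measurable_coord_rV.
Qed.

Lemma measurable_uncons_rV (R : realType) n :
  measurable_fun [set: 'rV[R]_n.+1] (@uncons_rV R n).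
Proof.
apply/measurable_fun_pairP; split; first exact: measurable_coord_rV.
apply: measurable_fun_rVP => i.
rewrite (_ : (fun _ => _) =
  (fun v : 'rV[R]_n.+1 => v 0 (lift ord0 i) : measurableTypeR R)).
  exact: measurable_coord_rV.
by apply/funext => v/=; rewrite mxE.
Qed.

HB.instance Definition _ (R : realType) n := isMeasurableFun.Build _ _ _ _
  (@cons_rV R n) (@measurable_cons_rV R n).

Section lebesgue_rV_step.
Context (R : realType) (n : nat).
Variable mu : {sigma_finite_measure set 'rV[R]_n -> \bar R}.
Local Open Scope ereal_scope.

Definition lebesgue_rV_succ : set 'rV[R]_n.+1 -> \bar R :=
  pushforward (@lebesgue_measure R \x mu) (@cons_rV R n).

Let succ0 : lebesgue_rV_succ set0 = 0.
Proof. exact: measure0. Qed.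

Let succ_ge0 A : 0 <= lebesgue_rV_succ A.
Proof. exact: measure_ge0. Qed.

Let succ_sigma_additive : semi_sigma_additive lebesgue_rV_succ.
Proof. exact: measure_semi_sigma_additive. Qed.

HB.instance Definition _ := isMeasure.Build _ _ _ lebesgue_rV_succ
  succ0 succ_ge0 succ_sigma_additive.

Let succ_sigma_finite : sigma_finite setT lebesgue_rV_succ.
Proof.
have /sigma_finiteP[F [TF ndF Foo]] := sigma_finiteT (@lebesgue_measure R).
have /sigma_finiteP[G [TG ndG Goo]] := sigma_finiteT mu.
exists (fun k => @uncons_rV R n @^-1` (F k `*` G k)).
  rewrite -preimage_bigcup (_ : \bigcup_k _ = setT) ?preimage_setT//.
  apply/seteqP; split => // -[x v] _.
  have : [set: R] x by [].
  have : [set: 'rV[R]_n] v by [].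
  rewrite {1}TF {1}TG => -[l _ Gv] [k _ Fx]; exists (maxn k l) => //; split.
    by move: x Fx; exact/subsetPset/ndF/leq_maxl.
  by move: v Gv; exact/subsetPset/ndG/leq_maxr.
move=> k; have [mF Fk] := Foo k; have [mG Gk] := Goo k; split.
  rewrite -[X in measurable X]setTI; apply: measurable_uncons_rV => //.
  exact: measurableX.
rewrite /lebesgue_rV_succ /pushforward -comp_preimage.
rewrite (_ : _ \o _ = id) ?preimage_id; last first.
  by apply/funext => x/=; rewrite cons_rVK.
by rewrite product_measure1E// lte_mul_pinfty// ge0_fin_numE.
Qed.

HB.instance Definition _ := Measure_isSigmaFinite.Build _ _ _ lebesgue_rV_succ
  succ_sigma_finite.

End lebesgue_rV_step.

Fixpoint lebesgue_rV (R : realType) n :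
    {sigma_finite_measure set 'rV[R]_n -> \bar R} :=
  match n with
  | 0 => \d_(0 : 'rV[R]_0)
  | m.+1 => lebesgue_rV_succ (lebesgue_rV R m)
  end.

Section fourier_multipliers.
Context (R : realType) (d : nat).
Implicit Types (f g K : 'rV[R]_d -> R[i]) (x y xi : 'rV[R]_d) (p : \bar R).

Definition dotv x y : R := \sum_(i < d) x 0 i * y 0 i.

(* The library norm on 'rV[R]_d is the sup norm, hence this definition. *)
Definition enorm x : R := Num.sqrt (dotv x x).

Definition expi (t : R) : R[i] := (cos t +i* sin t)%C.

(* The library integral is for real-valued functions: complex-valued functions
   are integrated componentwise. *)
Definition cintegrable f : Prop :=
  (lebesgue_rV R d).-integrable [set: 'rV[R]_d] (fun x => (complex.Re (f x))%:E) /\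
  (lebesgue_rV R d).-integrable [set: 'rV[R]_d] (fun x => (complex.Im (f x))%:E).

Definition cintegral f : R[i] :=
  ((\int[lebesgue_rV R d]_x complex.Re (f x)) +i*
   (\int[lebesgue_rV R d]_x complex.Im (f x)))%C.

Definition fourier f xi : R[i] := cintegral (fun x => f x * expi (- dotv xi x)).

Definition convolution K f x : R[i] := cintegral (fun y => K (x - y) * f y).

Definition cLnorm p f : \bar R :=
  Lnorm (lebesgue_rV R d) p (fun x => (ComplexField.Normc.normc (f x))%:E).

Definition in_Lp p f : Prop :=
  [/\ measurable_fun [set: 'rV[R]_d] (fun x => complex.Re (f x)),
      measurable_fun [set: 'rV[R]_d] (fun x => complex.Im (f x)) &
      (cLnorm p f < +oo)%E].

(* T is the Fourier multiplier operator with (bounded) symbol m; L^1 is where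
   both Fourier transforms are given by the integral formula. *)
Definition is_fourier_multiplier (m : 'rV[R]_d -> R[i])
    (T : ('rV[R]_d -> R[i]) -> ('rV[R]_d -> R[i])) : Prop :=
  forall f, in_Lp 1%:E f ->
    in_Lp 1%:E (T f) /\ forall xi, fourier (T f) xi = m xi * fourier f xi.

Definition partial (i : 'I_d) (h : 'rV[R]_d -> R) : 'rV[R]_d -> R :=
  fun x => 'D_(delta_mx 0 i) h x.

Definition smooth_on (U : set 'rV[R]_d) (h : 'rV[R]_d -> R) : Prop :=
  forall (s : seq 'I_d) x, U x ->
    {for x, continuous (foldr partial h s)} /\
    forall i, derivable (foldr partial h s) x (delta_mx 0 i).

End fourier_multipliers.

(* Main.v *)
Require Import Defs.
From HB Require Import structures.
From mathcomp Require Import all_boot all_order all_algebra.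
From mathcomp Require Import all_classical all_reals all_analysis.
From mathcomp Require Import complex.
From mathcomp Require Import counting_measure measurable_realfun ess_sup_inf.
From mathcomp Require Import ring lra.
Import Order.TTheory GRing.Theory Num.Theory.
Import numFieldNormedType.Exports.
Local Open Scope classical_set_scope.
Local Open Scope ring_scope.


(** Put u = lambda / (lambda + |xi|), so that 1 - u = |xi| / (lambda + |xi|),
    and take C = 1 / Gamma(beta).  The Gamma integral gives
      ln(lambda + |xi|)^(- beta) =
        C * int_0^oo t^(beta - 1) (lambda + |xi|)^(- t) dt,
    so that the remainder symbol is
      P(xi) = C * int_0^oo t^(beta - 1) (lambda + |xi|)^(gamma - t)
                [(1 - u)^gamma - 1_(t <= gamma) (1 - u)^(gamma - t)] dt.
    Both powers of 1 - u have an exponent in [0, 1].  For such an exponent a,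
    the coefficients b_k(a) of the binomial series of (1 - u)^a satisfy
    sum_k |b_k(a)| <= 2 ([bcoef_series_le]), hence the bracket is a series
    sum_k c_k(t) u^k with sum_k |c_k(t)| <= 4, whose term k = 0 vanishes when
    t <= gamma.  Since (lambda + |xi|)^(gamma - t) u^k equals
    lambda^(gamma - t) u^(k + t - gamma), the symbol P is a superposition of
    the functions u^s, and the exponents s = k + t - gamma that occur with a
    nonzero weight are positive.  The total mass of the weight is at most
    4 C lambda^gamma int_0^oo t^(beta - 1) lambda^(- t) dt, which is finite
    because lambda > 1.  This is [mixture_symbol], where the superposition is
    an integral over nat * R for counting measure times Lebesgue measure.

    Each u^s with s > 0 is the Fourier transform of an even probability
    density ([bessel_family]): by a Gamma integral again, it is an average of
    the functions exp(- t |xi|), these are averages of Gaussians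
    exp(- s |xi|^2) by subordination ([integral_subord_exp]), and averages of
    densities are densities ([density_family_mix]).  Averaging the densities
    against the weight above gives an even integrable kernel K whose
    transform is P, by Fubini ([mixture_test]).

    Convolution with an integrable kernel multiplies the Fourier transforms
    and maps every L^p with 1 <= p <= +oo to itself ([convolution_Lp]).
    Finally, away from the origin P is built from powers of |xi| and of
    ln(lambda + |xi|) and from the integral
    int_0^gamma t^(b - 1) exp(- t y) dt at y = ln |xi|; functions of this type,
    together with the coordinates, form a class closed under partial
    derivatives ([smooth_sym_step]), so P is smooth there. *)

(** * Mixtures of functions against a signed weight *)

Lemma integrable_mul_le1 {R : realType} {d} {T : measurableType d}
    (mu : {measure set T -> \bar R}) (f e : T -> R) :
  mu.-integrable setT (EFin \o f) -> measurable_fun setT e -> (forall x, `|e x| <= 1) ->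
  mu.-integrable setT (EFin \o (fun x => f x * e x)).
Proof.
move=> intf me e1.
have mf : measurable_fun setT f by apply/measurable_EFinP; exact: (measurable_int mu intf).
apply: le_integrable intf => //.
  by apply/measurable_EFinP; exact: measurable_funM.
by move=> x _; rewrite lee_fin normrM ler_piMr.
Qed.

Section product_integrals.
Context {R : realType} {d1 d2 : measure_display}.
Context {Y : measurableType d1} {X : measurableType d2}.
Variable nu : {sigma_finite_measure set Y -> \bar R}.
Variable mu : {sigma_finite_measure set X -> \bar R}.

(** The parameterized integral is a difference of two Tonelli integrals, those of its
    positive and of its negative part. *)
Lemma measurable_fun_Rintegral2 (h : Y * X -> R) : measurable_fun setT h ->
  measurable_fun setT (fun x => \int[nu]_y h (y, x)).
Proof.
move=> mh; apply: measurableT_comp => //.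
have mh' : measurable_fun setT (EFin \o h) by exact/measurable_EFinP.
rewrite (_ : (fun x => _) = (fun x => \int[nu]_y (EFin \o h)^\+ (y, x) -
                   \int[nu]_y (EFin \o h)^\- (y, x))%E); last first.
  by apply/funext => x; rewrite integralE; congr (_ - _)%E; apply: eq_integral => y _; rewrite ?funeposE ?funenegE.
apply: emeasurable_funB.
- apply: measurable_fun_fubini_tonelli_G => //; exact: measurable_funepos.
- apply: measurable_fun_fubini_tonelli_G => //; exact: measurable_funeneg.
Qed.

Lemma measurable_pair_slice (q : Y * X -> R) y :
  measurable_fun setT q -> measurable_fun setT (fun x => q (y, x)).
Proof. by move=> mq; apply: measurableT_comp mq _; exact: pair1_measurable. Qed.

Lemma measurable_pair_slice2 (q : Y * X -> R) x :
  measurable_fun setT q -> measurable_fun setT (fun y => q (y, x)).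
Proof. by move=> mq; apply: measurableT_comp mq _; exact: pair2_measurable. Qed.

Variables (w : Y -> R) (q : Y * X -> R) (A : R).
Hypothesis A0 : 0 <= A.
Hypothesis iw : nu.-integrable setT (EFin \o w).
Hypothesis mq : measurable_fun setT q.
Hypothesis qA : forall y, w y != 0 -> (\int[mu]_x `|q (y, x)|%:E <= A%:E)%E.

(** For a fixed weight w, the superposition of the functions q (y, _).  The sign
    of w is arbitrary; the bound on the L^1 norm of q (y, _) is only asked for
    those y that carry weight. *)
Definition mixture (x : X) : R := \int[nu]_y (w y * q (y, x)).

Let mw : measurable_fun setT w.
Proof. by apply/measurable_EFinP; exact: (measurable_int nu iw). Qed.

Let mwq : measurable_fun setT (fun z : Y * X => w z.1 * q z).
Proof.
by apply: measurable_funM => //; apply: measurableT_comp => //; exact: measurable_fst.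
Qed.

(* The whole section rests on this bound, which makes Fubini available for
   w (y) * q (y, x) on the product. *)
Let mixture_tonelli : (\int[nu]_y \int[mu]_x `|w y * q (y, x)|%:E <=
  A%:E * \int[nu]_y `|w y|%:E)%E.
Proof.
have mwn : measurable_fun setT (fun y => `|w y|%:E).
  by apply/measurable_EFinP; apply: measurableT_comp.
have mqn y : measurable_fun setT (fun x => `|q (y, x)|%:E).
  by apply/measurable_EFinP; apply: measurableT_comp => //; exact: measurable_pair_slice.
rewrite -ge0_integralZl//.
apply: ge0_le_integral => //.
- by move=> y _; apply: integral_ge0 => x _; rewrite lee_fin.
- apply: (@measurable_fun_fubini_tonelli_F _ _ _ _ _ mu (fun z => `|w z.1 * q z|%:E)).
  + by apply/measurable_EFinP; apply: measurableT_comp.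
  + by move=> z; rewrite lee_fin.
- exact: emeasurable_funM.
move=> y _.
under eq_integral do rewrite normrM EFinM.
rewrite ge0_integralZl//.
have [->|wy] := eqVneq (w y) 0; first by rewrite normr0 !(mul0e, mule0).
by rewrite muleC; apply: lee_pmul => //; [apply: integral_ge0 => x _; rewrite lee_fin|exact: qA].
Qed.

Let mixture_prod_integrable :
  (nu \x mu)%E.-integrable setT (EFin \o (fun z : Y * X => w z.1 * q z)).
Proof.
apply/integrable12ltyP; first exact/measurable_EFinP.
apply: le_lt_trans mixture_tonelli _.
by have /integrableP[_ H] := iw; rewrite lte_mul_pinfty.
Qed.

Lemma measurable_mixture : measurable_fun setT mixture.
Proof. exact: (@measurable_fun_Rintegral2 (fun z => w z.1 * q z)). Qed.

Lemma mixture_integrable_ae :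
  {ae mu, forall x, nu.-integrable setT (fun y => (w y * q (y, x))%:E)}.
Proof. exact: (ae_integrable2 mixture_prod_integrable). Qed.

Lemma mixture_norm_le :
  (\int[mu]_x `|mixture x|%:E <= A%:E * \int[nu]_y `|w y|%:E)%E.
Proof.
have mn : measurable_fun setT (fun z : Y * X => `|w z.1 * q z|%:E).
  by apply/measurable_EFinP; apply: measurableT_comp.
apply: le_trans mixture_tonelli.
rewrite (@fubini_tonelli _ _ _ _ _ nu mu (fun z => `|w z.1 * q z|%:E))//.
apply: ge0_le_integral => //.
- apply/measurable_EFinP; apply: measurableT_comp => //; exact: measurable_mixture.
- exact: (@measurable_fun_fubini_tonelli_G _ _ _ _ _ nu (fun z => `|w z.1 * q z|%:E)).
move=> x _; rewrite /mixture /Rintegral.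
apply: (@le_trans _ _ (`|\int[nu]_y (w y * q (y, x))%:E|)%E).
  by case: (integral nu _ _) => [r| |]; rewrite ?lexx//; exact: leey.
apply: le_abse_integral => //; apply/measurable_EFinP.
apply: measurable_funM => //; exact: measurable_pair_slice2.
Qed.

Lemma mixture_integrable : mu.-integrable setT (EFin \o mixture).
Proof.
apply/integrableP; split; first exact/measurable_EFinP/measurable_mixture.
apply: le_lt_trans mixture_norm_le _.
by have /integrableP[_ H] := iw; rewrite lte_mul_pinfty.
Qed.

(** Fubini.  With e a cosine, the transform of a mixture is the mixture of the
    transforms. *)
Lemma mixture_test (e : X -> R) : measurable_fun setT e -> (forall x, `|e x| <= 1) ->
  \int[mu]_x (mixture x * e x) = \int[nu]_y (w y * \int[mu]_x (q (y, x) * e x)).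
Proof.
move=> me e1.
pose H (z : Y * X) := w z.1 * q z * e z.2.
have mH : measurable_fun setT H.
  by apply: measurable_funM => //; apply: measurableT_comp => //; exact: measurable_snd.
have iH : (nu \x mu)%E.-integrable setT (EFin \o H).
  apply: le_integrable mixture_prod_integrable => //; first exact/measurable_EFinP.
  by move=> z _ /=; rewrite lee_fin !normrM ler_piMr.
transitivity (fine (\int[mu]_x \int[nu]_y (H (y, x))%:E)).
  rewrite /Rintegral; congr fine.
  (* Only for almost every x is the slice integrable, so that the factor e x can
     be taken out of the inner integral. *)
  apply: ae_eq_integral => //.
  - apply/measurable_EFinP; apply: measurable_funM => //; exact: measurable_mixture.
  - exact: (measurable_fubini_G iH).
  move: mixture_integrable_ae; apply: filterS => x ix _.
  rewrite /H /= [in RHS](eq_integral (fun y => ((w y * q (y, x))%:E * (e x)%:E))%E)//.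
  rewrite integralZr// /mixture /Rintegral EFinM fineK//.
  exact: integrable_fin_num.
rewrite -(Fubini iH) /Rintegral; congr fine; apply: eq_integral => y _.
have [wy|wy] := eqVneq (w y) 0.
  rewrite wy mul0r (eq_integral (fun=> 0%E)) ?integral0// => x _.
  by rewrite /H/= wy !mul0r.
have iq : mu.-integrable setT (fun x => (q (y, x) * e x)%:E).
  apply/integrableP; split.
    apply/measurable_EFinP; apply: measurable_funM => //; exact: measurable_pair_slice.
  apply: (@le_lt_trans _ _ (\int[mu]_x `|q (y, x)|%:E)%E); last first.
    exact: (le_lt_trans (qA _ wy) (ltry _)).
  apply: ge0_le_integral => //.
  - do 2 apply: measurableT_comp => //.
    apply: measurable_funM => //; exact: measurable_pair_slice.
  - do 2 apply: measurableT_comp => //; exact: measurable_pair_slice.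
  - by move=> x _; rewrite lee_fin normrM ler_piMr.
rewrite /H /= (eq_integral (fun x => ((w y)%:E * (q (y, x) * e x)%:E)%E)); last first.
  by move=> x _; rewrite -EFinM mulrA.
by rewrite integralZl// EFinM fineK//; exact: integrable_fin_num.
Qed.

End product_integrals.

(** * Affine changes of variables in Lebesgue integrals *)

Section affine_change.
Context {R : realType}.

Definition affine_map (c b : R) (x : measurableTypeR R) : measurableTypeR R := c * x + b.

Lemma measurable_affine_map c b : measurable_fun setT (affine_map c b).
Proof.
have : measurable_fun setT (fun x : R => c * x + b).
  by apply: measurable_funD => //; exact: measurable_funM.
by [].
Qed.

Definition pushforward_affine c b : {measure set (measurableTypeR R) -> \bar R} :=
  measure_function_pushforward__canonical__measure_function_Measure
    (@lebesgue_measure R) (measurable_affine_map c b).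

(** Both sides are measures in A; by uniqueness of Lebesgue measure it is
    enough to compare them on half-open intervals.  The preimage is again
    half-open, on the other side if c < 0. *)
Lemma lebesgue_measure_affine (c b : R) (A : set (measurableTypeR R)) : c != 0 ->
  measurable A ->
  (lebesgue_measure A = `|c|%:E * lebesgue_measure (affine_map c b @^-1` A))%E.
Proof.
move=> c0 mA.
have c0' : 0 < `|c| by rewrite normr_gt0.
pose nu : {measure set (measurableTypeR R) -> \bar R} :=
  mscale (NngNum (ltW c0')) (pushforward_affine c b).
transitivity (nu A); last by [].
apply: lebesgue_measure_unique => // X [[x y] xy <-]/=.
transitivity (`|c|%:E * lebesgue_measure (affine_map c b @^-1` `]x, y]))%E; last by [].
have [cp|cn] := ltP 0 c.
  have -> : affine_map c b @^-1` `]x, y] = `](x - b) / c, (y - b) / c]%classic.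
    apply/seteqP; split => z /=; rewrite !in_itv/= /affine_map.
      by rewrite ltr_pdivrMr// ler_pdivlMr// ltrBlDr lerBrDr ![z * c]mulrC.
    by rewrite ltr_pdivrMr// ler_pdivlMr// ltrBlDr lerBrDr ![z * c]mulrC.
  rewrite !lebesgue_measure_itv/= !lte_fin ltr_pM2r ?invr_gt0// ltrD2r.
  case: ifPn => _; last by rewrite mule0.
  by rewrite -!EFinB -EFinM; congr EFin; rewrite gtr0_norm//; field.
have {}cn : c < 0 by rewrite lt_neqAle c0.
have -> : affine_map c b @^-1` `]x, y] = `[(y - b) / c, (x - b) / c[%classic.
  apply/seteqP; split => z /=; rewrite !in_itv/= /affine_map.
    by rewrite ltr_ndivlMr// ler_ndivrMr// ltrBlDr lerBrDr ![z * c]mulrC andbC.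
  by rewrite ltr_ndivlMr// ler_ndivrMr// ltrBlDr lerBrDr ![z * c]mulrC andbC.
rewrite !lebesgue_measure_itv/= !lte_fin ltr_nM2r ?invr_lt0// ltrD2r.
case: ifPn => _; last by rewrite mule0.
by rewrite -!EFinB -EFinM; congr EFin; rewrite ltr0_norm//; field.
Qed.

Lemma ge0_integral_affine (c b : R) (f : R -> \bar R) : c != 0 ->
  measurable_fun setT f -> (forall x, 0 <= f x)%E ->
  (\int[lebesgue_measure]_x f x = `|c|%:E * \int[lebesgue_measure]_x f (c * x + b)%R)%E.
Proof.
move=> c0 mf f0.
have c0' : 0 < `|c| by rewrite normr_gt0.
pose nu : {measure set (measurableTypeR R) -> \bar R} :=
  mscale (NngNum (ltW c0')) (pushforward_affine c b).
transitivity (\int[nu]_x f x)%E.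
  by apply: eq_measure_integral => A mA _; exact: lebesgue_measure_affine.
rewrite ge0_integral_mscale//=; congr (_ * _)%E.
by rewrite ge0_integral_pushforward//; exact: measurable_affine_map.
Qed.

End affine_change.

Section lebesgue_rV_theory.
Context {R : realType}.

Lemma ge0_integral_rV_succ n (f : 'rV[R]_n.+1 -> \bar R) :
  measurable_fun setT f -> (forall x, 0 <= f x)%E ->
  (\int[lebesgue_rV R n.+1]_x f x =
   \int[lebesgue_measure]_t \int[lebesgue_rV R n]_v f (cons_rV (t, v)))%E.
Proof.
move=> mf f0 /=.
rewrite /lebesgue_rV_succ ge0_integral_pushforward//.
rewrite preimage_setT fubini_tonelli1//=.
by apply: measurableT_comp => //; exact: measurable_cons_rV.
Qed.

Lemma integral_rV0 (f : 'rV[R]_0 -> \bar R) : measurable_fun setT f ->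
  (\int[lebesgue_rV R 0]_x f x = f 0%R)%E.
Proof. by move=> mf; rewrite /= integral_dirac// diracT mul1e. Qed.

Lemma affine_cons_rV n (t : R) (v : 'rV[R]_n) s (x : 'rV[R]_n.+1) :
  s *: cons_rV (t, v) + x = cons_rV (s * t + x 0 ord0, s *: v + \row_i x 0 (lift ord0 i)).
Proof.
apply/rowP => i; rewrite !mxE /=; case: unliftP => [j ->|->] //=.
by rewrite !mxE.
Qed.

Lemma measurable_affine_rV n (s : R) (x : 'rV[R]_n) :
  measurable_fun setT (fun v : 'rV[R]_n => s *: v + x).
Proof.
apply: measurable_fun_rVP => i.
rewrite (_ : (fun _ => _) = affine_map s (x 0 i) \o (fun v : 'rV[R]_n => v 0 i : measurableTypeR R)).
  apply: measurableT_comp; [exact: measurable_affine_map|exact: measurable_coord_rV].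
by apply/funext => v; rewrite !mxE.
Qed.

(** The case |s| = 1 of an affine change of variables covers the translations
    and the reflections through a point, which is what convolutions need.  By
    induction on n, one coordinate at a time. *)
Lemma ge0_integral_rV_isometry n (s : R) (x : 'rV[R]_n) (f : 'rV[R]_n -> \bar R) :
  `|s| = 1 -> measurable_fun setT f -> (forall x, 0 <= f x)%E ->
  (\int[lebesgue_rV R n]_v f (s *: v + x)%R = \int[lebesgue_rV R n]_v f v)%E.
Proof.
move=> s1; elim: n x f => [|n ih] x f mf f0.
  by congr integral; apply/funext => v; congr f; apply/rowP => -[].
have s0 : s != 0 by rewrite -normr_gt0 s1.
have mfx : measurable_fun setT (fun v : 'rV[R]_n.+1 => f (s *: v + x)).
  exact: measurableT_comp mf (measurable_affine_rV _ s x).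
rewrite (ge0_integral_rV_succ _ _ mf f0) (ge0_integral_rV_succ _ (fun v => f (s *: v + x)) mfx (fun v => f0 _)).
under eq_integral.
  move=> t _; under eq_integral do rewrite affine_cons_rV.
  rewrite (ih _ (fun v => f (cons_rV (s * t + x 0 ord0, v))))//; last first.
    apply: measurableT_comp => //.
    apply: measurableT_comp; [exact: measurable_cons_rV|exact: pair1_measurable].
  over.
rewrite [RHS](@ge0_integral_affine _ s (x 0 ord0))//.
- by rewrite s1 mul1e.
- apply: (@measurable_fun_fubini_tonelli_F _ _ _ _ _ (lebesgue_rV R n) (fun z => f (cons_rV z))) => //.
  by apply: measurableT_comp => //; exact: measurable_cons_rV.
- by move=> t; exact: integral_ge0.
Qed.

Lemma integral_rV_isometry n (s : R) (x : 'rV[R]_n) (f : 'rV[R]_n -> \bar R) :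
  `|s| = 1 -> measurable_fun setT f ->
  (\int[lebesgue_rV R n]_v f (s *: v + x)%R = \int[lebesgue_rV R n]_v f v)%E.
Proof.
move=> s1 mf; rewrite [LHS]integralE [RHS]integralE; congr (_ - _)%E.
- rewrite -[RHS](@ge0_integral_rV_isometry _ s x)//; last exact: measurable_funepos.
  by apply: eq_integral => v _; rewrite !funeposE.
- rewrite -[RHS](@ge0_integral_rV_isometry _ s x)//; last exact: measurable_funeneg.
  by apply: eq_integral => v _; rewrite !funenegE.
Qed.

End lebesgue_rV_theory.

(** * Improper integrals by antiderivatives *)

(** The set D is the increasing union of the compact intervals [a n, b n], and
    the antiderivative F has limits along both sequences of end points. *)
Section improper_FTC.
Context {R : realType}.
Let mu := @lebesgue_measure R.
Variables (f F : R -> R) (a b : nat -> R) (D : set R) (la lb : R).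
Hypothesis ab : forall n, a n < b n.
Hypothesis a_noninc : forall m n, (m <= n)%N -> a n <= a m.
Hypothesis b_nondec : forall m n, (m <= n)%N -> b m <= b n.
Hypothesis DE : D = \bigcup_n `[a n, b n]%classic.
Hypothesis dF : forall x, D x -> is_derive x 1 F (f x).
Hypothesis cf : forall x, D x -> {for x, continuous f}.
Hypothesis Fa : F (a n) @[n --> \oo] --> la.
Hypothesis Fb : F (b n) @[n --> \oo] --> lb.

Let subD n x : x \in `[a n, b n] -> D x.
Proof. by move=> xn; rewrite DE; exists n. Qed.

Let mD : measurable D.
Proof. by rewrite DE; apply: bigcupT_measurable => n; exact: measurable_itv. Qed.

Let cfn n : {within `[a n, b n], continuous f}.
Proof. by apply: continuous_in_subspaceT => x /set_mem /= /subD; exact: cf. Qed.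

Let FTCn n : (\int[mu]_(x in `[a n, b n]) (f x)%:E = (F (b n))%:E - (F (a n))%:E)%E.
Proof.
have cF x : x \in `[a n, b n] -> {for x, continuous F}.
  move=> /subD Dx; apply: differentiable_continuous; apply/derivable1_diffP.
  by case: (dF _ Dx).
have anI : a n \in `[a n, b n] by rewrite in_itv/= lexx ltW.
have bnI : b n \in `[a n, b n] by rewrite in_itv/= lexx ltW.
apply: continuous_FTC2 => //.
- split.
  + by move=> x /subset_itv_oo_cc /subD Dx; case: (dF _ Dx).
  + by apply: cvg_at_right_filter; exact: cF.
  + by apply: cvg_at_left_filter; exact: cF.
- by move=> x /subset_itv_oo_cc /subD Dx; rewrite derive1E; case: (dF _ Dx).
Qed.

Let nndI : nondecreasing_seq (fun n => `[a n, b n]%classic).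
Proof.
move=> m n mn; apply/subsetPset => x /=; rewrite !in_itv/= => /andP[ax xb].
by rewrite (le_trans (a_noninc _ _ mn) ax) (le_trans xb (b_nondec _ _ mn)).
Qed.

Let mf : measurable_fun D f.
Proof.
rewrite DE; apply/measurable_fun_bigcup => [n|n]; first exact: measurable_itv.
by apply: subspace_continuous_measurable_fun => //; exact: measurable_itv.
Qed.

Let cvgFTC : (\int[mu]_(x in `[a n, b n]) (f x)%:E)%E @[n --> \oo] --> (lb - la)%:E.
Proof.
under eq_fun do rewrite FTCn.
by rewrite EFinB; apply: cvgeB => //; apply: cvg_EFin => //; exact: nearW.
Qed.

Lemma ge0_improper_FTC : (forall x, D x -> 0 <= f x) ->
  (\int[mu]_(x in D) (f x)%:E = (lb - la)%:E)%E.
Proof.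
move=> f0.
rewrite -(cvg_lim _ cvgFTC)//; apply/esym/cvg_lim => //.
rewrite [X in _ --> (\int[mu]_(x in X) _)%E]DE.
apply: ge0_nondecreasing_set_cvg_integral => //.
- move=> n; apply/measurable_EFinP; apply: measurable_funS mf => //.
  by move=> x /= /subD.
- by move=> n x /= /subD Dx; rewrite lee_fin f0.
Qed.

Lemma integrable_improper_FTC : mu.-integrable D (EFin \o f) ->
  \int[mu]_(x in D) f x = lb - la.
Proof.
move=> intf; rewrite /Rintegral.
suff -> : (\int[mu]_(x in D) (f x)%:E = (lb - la)%:E)%E by [].
rewrite -(cvg_lim _ cvgFTC)//; apply/esym/cvg_lim => //.
under eq_fun.
  move=> n; rewrite integral_mkcond.
  rewrite -[X in integral _ _ X]/((EFin \o f) \_ _).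
  over.
rewrite integral_mkcond.
apply: (@dominated_cvg _ _ _ mu setT _ _ _ (abse \o ((EFin \o f) \_ D))).
- by [].
- move=> n; apply/(measurable_restrictT _ _).1 => //.
  apply/measurable_EFinP; apply: measurable_funS mf => //.
  by move=> x /= /subD.
- move=> x _; apply: cvg_near_cst.
  have [Dx|nDx] := pselect (D x).
    have : D x by []. rewrite {1}DE => -[N _ Nx].
    exists N => // n /= Nn; rewrite !patchE !mem_set//.
    by have /subsetPset := nndI _ _ Nn; apply.
  apply: nearW => n; rewrite !patchE !memNset//.
  by move=> /subD.
- by move=> x _ /=; rewrite patchE; case: ifP.
- by apply: integrable_abse; have [H _] := @integrable_mkcond _ _ _ mu D (EFin \o f) mD; exact: H.
- move=> n x _ /=; rewrite !patchE; case: ifPn => [/set_mem /= /subD Dx|_].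
    by rewrite mem_set.
  by rewrite -[point]/(0%E) abse0 abse_ge0.
Qed.

End improper_FTC.

(** * Gaussian densities on the line *)

(** Dominated differentiation under the integral sign, for a parameter in a
    neighbourhood of a, in the form of an [is_derive] statement. *)
Section derive_under_integral.
Context {R : realType} {d : measure_display} {Y : measurableType d}.
Variables (mu : {measure set Y -> \bar R}) (B : set Y).
Variables (f df : R -> Y -> R) (G : Y -> R) (a e : R).
Hypothesis mB : measurable B.
Hypothesis e0 : 0 < e.
Hypothesis intf : forall x, `|x - a| < e -> mu.-integrable B (EFin \o f x).
Hypothesis derf : forall x y, `|x - a| < e -> B y -> is_derive x 1 (f^~ y) (df x y).
Hypothesis intG : mu.-integrable B (EFin \o G).
Hypothesis df_le : forall x y, `|x - a| < e -> B y -> `|df x y| <= G y.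

Lemma is_derive_Rintegral :
  is_derive a 1 (fun x => \int[mu]_(y in B) f x y) (\int[mu]_(y in B) df a y).
Proof.
have Ie x : `](a - e), (a + e)[%classic x -> `|x - a| < e.
  by rewrite /= in_itv/= ltr_distl.
have Ia : `](a - e), (a + e)[%classic a.
  by rewrite /= in_itv/= ltrBlDr ltrDl e0.
have pE x y : `|x - a| < e -> B y -> partial1of2 f x y = df x y.
  by move=> xe By; rewrite partial1of2E; case: (derf _ _ xe By).
have H := @cvg_differentiation_under_integral R d Y mu f B mB a (a - e) (a + e) Ia
  (fun x Ix => intf _ (Ie _ Ix))
  (fun x y Ix By => @ex_derive _ _ _ _ _ _ _ (derf _ _ (Ie _ Ix) By))
  (fun y => `|G y|) (fun y => normr_ge0 _) (integrable_norm intG).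
have {}H := H (fun x y Ix By => le_trans (eq_ind_r (fun z => `|z| <= G y) (df_le _ _ (Ie _ Ix) By) (pE _ _ (Ie _ Ix) By)) (ler_norm _)).
have E : \int[mu]_(y in B) partial1of2 f a y = \int[mu]_(y in B) df a y.
  by apply: eq_Rintegral => y /set_mem By; rewrite pE// subrr normr0.
rewrite {}E in H.
have dH : h^-1 *: (((fun x => \int[mu]_(y in B) f x y) \o shift a) (h *: (1 : R)) - \int[mu]_(y in B) f a y) @[h --> 0^']
   --> \int[mu]_(y in B) df a y.
  move: H; apply: cvg_trans; apply: near_eq_cvg; apply: nearW => h.
  by rewrite /= /GRing.scale /= mulr1.
by apply: DeriveDef; [apply/cvg_ex; exists (\int[mu]_(y in B) df a y); exact: dH|exact: (cvg_lim _ dH)].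
Qed.

End derive_under_integral.

(** The inverse is a measurable function on the whole line, because
    x^-1 = x * (x^2)^(-1), the power being measurable. *)
Lemma measurable_funVr {R : realType} {d : measure_display} {T : measurableType d}
  (f : T -> R) : measurable_fun setT f -> measurable_fun setT (fun x => (f x)^-1).
Proof.
move=> mf; rewrite (_ : (fun x => _) = fun x => f x * (f x ^+ 2) `^ (-1)).
  apply: measurable_funM => //; apply: (@measurableT_comp _ _ _ _ _ _ (fun y : R => y `^ (-1))) => //.
  exact: measurable_funX.
apply/funext => x; have [->|fx0] := eqVneq (f x) 0; first by rewrite invr0 mul0r.
rewrite powR_inv1 ?sqr_ge0//; field.
exact: fx0.
Qed.

Section gaussian_line.
Context {R : realType}.
Let mu := @lebesgue_measure R.

(** The heat kernel at time s, that is the centered normal density of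
    variance 2 s. *)
Definition gauss1 (s x : R) : R := (4 * pi * s) `^ (- 2^-1) * expR (- x ^+ 2 / (4 * s)).

Lemma gauss1_ge0 s x : 0 <= gauss1 s x.
Proof. by rewrite /gauss1 mulr_ge0// ?expR_ge0// powR_ge0. Qed.

Lemma gauss1_normal s : 0 < s -> gauss1 s = normal_pdf 0 (Num.sqrt (2 * s)).
Proof.
move=> s0; have s20 : 0 <= 2 * s by rewrite mulr_ge0// ltW.
have sn0 : Num.sqrt (2 * s) != 0 by rewrite gt_eqF// sqrtr_gt0 mulr_gt0.
apply/funext => x; rewrite normal_pdfE// /gauss1 /normal_peak /normal_fun subr0.
rewrite sqr_sqrtr// powRN powR12_sqrt; last by rewrite !mulr_ge0// ?pi_ge0// ltW.
by congr ((Num.sqrt _)^-1 * expR (_ / _)); ring.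
Qed.

Lemma integral_gauss1 s : 0 < s -> (\int[mu]_x (gauss1 s x)%:E = 1)%E.
Proof. by move=> s0; rewrite gauss1_normal// integral_normal_pdf. Qed.

Lemma integrable_gauss1 s : 0 < s -> mu.-integrable setT (EFin \o gauss1 s).
Proof. by move=> s0; rewrite gauss1_normal//; exact: integrable_normal_pdf. Qed.

Lemma measurable_gauss1 : measurable_fun setT (fun z : R * R => gauss1 z.1 z.2).
Proof.
apply: measurable_funM.
  apply: (@measurableT_comp _ _ _ _ _ _ (fun y : R => y `^ (- 2^-1))) => //.
  by apply: measurable_funM => //; exact: measurable_fst.
apply: measurableT_comp => //; apply: measurable_funM.
  by apply: measurableT_comp => //; apply: measurable_funX; exact: measurable_snd.
apply: measurable_funVr; apply: measurable_funM => //; exact: measurable_fst.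
Qed.

Lemma is_derive_gauss1 (s x : R) : 0 < s ->
  is_derive x 1 (gauss1 s) (- (x / (2 * s)) * gauss1 s x).
Proof.
move=> s0; rewrite /gauss1.
have H : is_derive x (1:R) (fun x : R => - x ^+ 2 / (4 * s)) (- (x / (2 * s))).
  rewrite (_ : (fun x => _) = (- (4 * s)^-1) *: ((@id R) ^+ 2)); last first.
    by apply/funext => y; rewrite !fctE /GRing.scale/=; ring.
  apply: is_derive_eq; rewrite ?fctE /GRing.scale/=; field.
  by rewrite gt_eqF.
apply: is_derive_eq; rewrite ?fctE /GRing.scale/=; ring.
Qed.

(** A linear factor is absorbed by doubling the time: |x| exp(- x^2 / (8 s)) is
    bounded. *)
Lemma normr_gauss1_le (s : R) : 0 < s ->
  exists C : R, forall x, `|x| * gauss1 s x <= C * gauss1 (2 * s) x.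
Proof.
move=> s0; have p0 : 0 < (4 * pi * (2 * s)) `^ (- 2^-1) :> R.
  by rewrite powR_gt0// !mulr_gt0// pi_gt0.
(* From 2 |x| <= 1 + x^2 and 1 + y <= exp y with y = x^2 / (8 s). *)
exists ((1 + 8 * s) * (4 * pi * s) `^ (- 2^-1) / (4 * pi * (2 * s)) `^ (- 2^-1)) => x.
rewrite /gauss1 [leRHS](_ : _ = (4 * pi * s) `^ (- 2^-1) * ((1 + 8 * s) *
    expR (- x ^+ 2 / (4 * (2 * s))))); last by field; rewrite gt_eqF.
rewrite mulrCA ler_wpM2l ?powR_ge0//.
have -> : - x ^+ 2 / (4 * s) = - x ^+ 2 / (4 * (2 * s)) + - x ^+ 2 / (4 * (2 * s)).
  by field; rewrite gt_eqF.
rewrite expRD [leLHS]mulrA ler_wpM2r ?expR_ge0//.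
rewrite mulNr expRN ler_pdivrMr ?expR_gt0//.
have s8 : 0 < 1 + 8 * s by rewrite addr_gt0// mulr_gt0.
apply: (@le_trans _ _ ((1 + 8 * s) * (1 + x ^+ 2 / (4 * (2 * s))))); last first.
  by rewrite ler_wpM2l ?expR_ge1Dx// ltW.
have -> : (1 + 8 * s) * (1 + x ^+ 2 / (4 * (2 * s))) =
   1 + 8 * s + x ^+ 2 + x ^+ 2 / (8 * s) by field; rewrite gt_eqF.
have : 0 <= x ^+ 2 / (8 * s) by rewrite mulr_ge0 ?sqr_ge0// invr_ge0 mulr_ge0// ltW.
have := sqr_ge0 x; have := sqr_ge0 (`|x| - 1).
by rewrite sqrrB real_normK ?num_real//; lra.
Qed.

Lemma continuous_gauss1 (s : R) : 0 < s -> continuous (gauss1 s).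
Proof.
move=> s0 x; apply: differentiable_continuous; apply/derivable1_diffP.
by case: (is_derive_gauss1 s x s0).
Qed.

Lemma gauss1N (s x : R) : gauss1 s (- x) = gauss1 s x.
Proof. by rewrite /gauss1 sqrrN. Qed.

Lemma cvg_gauss1 (s : R) : 0 < s -> gauss1 s n.+1%:R @[n --> \oo] --> 0.
Proof.
move=> s0; have [C HC] := normr_gauss1_le _ s0.
pose M := C * (4 * pi * (2 * s)) `^ (- 2^-1).
have C0 : 0 <= C.
  have := HC 1; rewrite normr1 mul1r => /(le_trans (gauss1_ge0 s 1)).
  rewrite pmulr_lge0// /gauss1 mulr_gt0 ?expR_gt0// powR_gt0//.
  by rewrite !mulr_gt0// pi_gt0.
have h0 : M * harmonic n @[n --> \oo] --> (0 : R).
  by rewrite -[X in _ --> X](mulr0 M); apply: cvgMr; exact: cvg_harmonic.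
apply: (squeeze_cvgr _ (cvg_cst 0) h0); apply: nearW => n; rewrite gauss1_ge0/=.
rewrite /harmonic ler_pdivlMr ?ltr0n// mulrC.
rewrite -[X in X * _](ger0_norm (ler0n _ _)) (le_trans (HC _))// /M ler_wpM2l//.
rewrite /gauss1 ler_piMr ?powR_ge0// -expR0 ler_expR mulNr oppr_le0.
by rewrite mulr_ge0 ?sqr_ge0// invr_ge0 !mulr_ge0// ltW.
Qed.

Lemma integrable_bounded_gauss1 (s : R) (h : R -> R) : 0 < s ->
  measurable_fun setT h -> (forall x, `|h x| <= 1) ->
  mu.-integrable setT (fun x => (gauss1 s x * h x)%:E).
Proof.
by move=> s0; exact: integrable_mul_le1 (integrable_gauss1 _ s0).
Qed.

Lemma integrable_id_gauss1 (s : R) (h : R -> R) : 0 < s ->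
  measurable_fun setT h -> (forall x, `|h x| <= 1) ->
  mu.-integrable setT (fun x => (x * gauss1 s x * h x)%:E).
Proof.
move=> s0 mh h1; have [C Cs] := normr_gauss1_le _ s0.
have s20 : 0 < 2 * s by rewrite mulr_gt0.
apply: le_integrable (integrableZl _ C (integrable_gauss1 _ s20)) => //.
  apply/measurable_EFinP; apply: measurable_funM => //; apply: measurable_funM => //.
  exact: continuous_measurable_fun (continuous_gauss1 _ s0).
move=> x _ /=; rewrite lee_fin [leRHS]ger0_norm; last first.
  by apply: le_trans (Cs x); rewrite mulr_ge0// gauss1_ge0.
by rewrite normrM (le_trans _ (Cs x))// normrM (ger0_norm (gauss1_ge0 _ _)) ler_piMr// mulr_ge0// gauss1_ge0.
Qed.

(** Let F be the left-hand side as a function of xi.  Differentiation under the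
    integral sign followed by an integration by parts gives
    F' = - 2 s xi F, and F 0 = 1, so F(xi) exp(s xi^2) is the constant 1. *)
Lemma integral_gauss1_cos (s xi : R) : 0 < s ->
  \int[mu]_x (gauss1 s x * cos (xi * x)) = expR (- (s * xi ^+ 2)).
Proof.
move=> s0.
have mc (t : R) : measurable_fun setT (fun x : R => cos (t * x)).
  apply: continuous_measurable_fun => x; apply: continuous_comp; last exact: continuous_cos.
  exact: mulrl_continuous.
have ms (t : R) : measurable_fun setT (fun x : R => sin (t * x)).
  apply: continuous_measurable_fun => x; apply: continuous_comp; last exact: continuous_sin.
  exact: mulrl_continuous.
have ds (t x : R) : is_derive x (1:R) (fun x : R => sin (t * x)) (t * cos (t * x)).
  by apply: is_derive_eq; rewrite ?fctE /GRing.scale/=; ring.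
have dc (t x : R) : is_derive t (1:R) (fun t : R => cos (t * x)) (- x * sin (t * x)).
  by apply: is_derive_eq; rewrite ?fctE /GRing.scale/=; ring.
pose F t := \int[mu]_x (gauss1 s x * cos (t * x)).
pose S t := \int[mu]_x (x * gauss1 s x * sin (t * x)).
have dF t : is_derive t (1:R) F (- S t).
  have -> : - S t = \int[mu]_x (- (x * gauss1 s x * sin (t * x))).
    rewrite -mulN1r -RintegralZl//; last by apply: integrable_id_gauss1 => // x; exact: sin_max.
    by apply: eq_Rintegral => x _; rewrite mulN1r.
  apply: (@is_derive_Rintegral _ _ _ mu setT (fun t x => gauss1 s x * cos (t * x))
     (fun t x => - (x * gauss1 s x * sin (t * x))) (fun x => `|x * gauss1 s x|) t 1) => //.
  - by move=> x _; apply: integrable_bounded_gauss1 => // y; exact: cos_max.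
  - move=> u x _ _; apply: is_derive_eq; rewrite ?fctE /GRing.scale/=; ring.
  - apply: integrable_norm.
    have c1 (x : R) : `|(cst 1 : R -> R) x| <= 1 by rewrite normr1.
    have := @integrable_id_gauss1 s (cst 1) s0 (measurable_cst _) c1.
    by apply: eq_integrable => // x _ /=; rewrite mulr1.
  - by move=> u x _ _; rewrite normrN normrM ler_piMr// sin_max.
(* Integration by parts: the function g below is the derivative of
   gauss1 s x * sin (t * x), which vanishes at both ends. *)
have SF t : S t = 2 * s * t * F t.
  pose g (x : R) := - (x / (2 * s)) * gauss1 s x * sin (t * x) + t * (gauss1 s x * cos (t * x)).
  have ig1 : mu.-integrable setT (fun x => (- (2 * s)^-1 * (x * gauss1 s x * sin (t * x)))%:E).
    apply: (@integrableZl _ _ _ mu setT measurableT (- (2 * s)^-1) (fun x => (x * gauss1 s x * sin (t * x))%:E)).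
    by apply: integrable_id_gauss1 => // x; exact: sin_max.
  have ig2 : mu.-integrable setT (fun x => (t * (gauss1 s x * cos (t * x)))%:E).
    apply: (@integrableZl _ _ _ mu setT measurableT t (fun x => (gauss1 s x * cos (t * x))%:E)).
    by apply: integrable_bounded_gauss1 => // x; exact: cos_max.
  have gE x : g x = - (2 * s)^-1 * (x * gauss1 s x * sin (t * x)) + t * (gauss1 s x * cos (t * x)).
    by rewrite /g; ring.
  have : \int[mu]_(x in setT) g x = 0 - 0.
    apply: (@integrable_improper_FTC _ g (fun x => gauss1 s x * sin (t * x)) (fun n => - n.+1%:R) (fun n => n.+1%:R)).
    - by move=> n; rewrite (@lt_trans _ _ 0)// ?oppr_lt0 ltr0n.
    - by move=> m n mn; rewrite lerN2 ler_nat.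
    - by move=> m n mn; rewrite ler_nat.
    - apply/esym/seteqP; split => // x _; exists (Num.bound `|x|) => //.
      rewrite /= in_itv/= -ler_norml; apply/ltW/(lt_le_trans (archi_boundP (normr_ge0 x))).
      by rewrite ler_nat.
    - move=> x _; have dg := is_derive_gauss1 _ x s0; apply: is_derive_eq.
      by rewrite /g /GRing.scale/=; ring.
    - move=> x _; have cg := continuous_gauss1 _ s0.
      have csin : {for x, continuous (fun x : R => sin (t * x))}.
        by apply: differentiable_continuous; apply/derivable1_diffP; case: (ds t x).
      have ccos : {for x, continuous (fun x : R => cos (t * x))}.
        by apply: continuous_comp; [exact: mulrl_continuous|exact: continuous_cos].
      apply: cvgD; [apply: cvgM; [apply: cvgM; [apply: cvgN; apply: cvgM; [exact: cvg_id|exact: cvg_cst]|exact: cg]|exact: csin]|].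
      by apply: cvgM; [exact: cvg_cst|apply: cvgM; [exact: cg|exact: ccos]].
    - apply: (squeeze_cvgr (f := fun n => - gauss1 s n.+1%:R) (h := fun n => gauss1 s n.+1%:R)).
      + by apply: nearW => n; rewrite -ler_norml normrM gauss1N ger0_norm ?gauss1_ge0// ler_piMr ?gauss1_ge0// sin_max.
      + by rewrite -oppr0; apply: cvgN; exact: cvg_gauss1.
      + exact: cvg_gauss1.
    - apply: (squeeze_cvgr (f := fun n => - gauss1 s n.+1%:R) (h := fun n => gauss1 s n.+1%:R)).
      + by apply: nearW => n; rewrite -ler_norml normrM ger0_norm ?gauss1_ge0// ler_piMr ?gauss1_ge0// sin_max.
      + by rewrite -oppr0; apply: cvgN; exact: cvg_gauss1.
      + exact: cvg_gauss1.
    - have : mu.-integrable setT (EFin \o g); last by [].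
      rewrite (_ : EFin \o g = (fun x => (- (2 * s)^-1 * (x * gauss1 s x * sin (t * x)))%:E) \+
         (fun x => (t * (gauss1 s x * cos (t * x)))%:E))%E; first exact: integrableD.
      by apply/funext => x /=; rewrite gE.
  rewrite subrr; under eq_Rintegral do rewrite gE.
  rewrite (@RintegralD _ _ _ mu setT (fun x => - (2 * s)^-1 * (x * gauss1 s x * sin (t * x))))//.
  rewrite (@RintegralZl _ _ _ mu setT (fun x => x * gauss1 s x * sin (t * x)))//; last first.
    by apply: integrable_id_gauss1 => // x; exact: sin_max.
  rewrite (@RintegralZl _ _ _ mu setT (fun x => gauss1 s x * cos (t * x)))//; last first.
    by apply: integrable_bounded_gauss1 => // x; exact: cos_max.
  rewrite -/(S t) -/(F t) => /eqP; rewrite mulNr addrC subr_eq0 => /eqP E.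
  have -> : S t = 2 * s * ((2 * s)^-1 * S t) by field; rewrite gt_eqF.
  by rewrite -E; ring.
have dH t : is_derive t (1:R) (fun t => F t * expR (s * t ^+ 2)) 0.
  have dFt := dF t.
  have de : is_derive t (1:R) (fun t : R => expR (s * t ^+ 2)) (2 * s * t * expR (s * t ^+ 2)).
    have -> : (fun t : R => expR (s * t ^+ 2)) = expR \o (s *: (@id R ^+ 2)) by [].
    by apply: is_derive_eq; rewrite ?fctE /GRing.scale/=; ring.
  by apply: is_derive_eq; rewrite /GRing.scale/= SF; ring.
have := is_derive_0_is_cst xi 0 dH; rewrite expr0n/= mulr0 expR0 mulr1.
have -> : F 0 = 1.
  rewrite /F; under eq_Rintegral do rewrite mul0r cos0 mulr1.
  by rewrite /Rintegral integral_gauss1.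
have e0 : expR (s * xi ^+ 2) != 0 by rewrite gt_eqF// expR_gt0.
by move=> E; apply: (mulIf e0); rewrite expRN mulVf.
Qed.

End gaussian_line.

(** * Gaussian densities on Euclidean space *)

Section euclidean_integrals.
Context {R : realType}.

Lemma dotvNr n (xi x : 'rV[R]_n) : dotv xi (- x) = - dotv xi x.
Proof. by rewrite /dotv -sumrN; apply: eq_bigr => i _; rewrite mxE mulrN. Qed.

Lemma dotvDr n (xi x y : 'rV[R]_n) : dotv xi (x + y) = dotv xi x + dotv xi y.
Proof. by rewrite /dotv -big_split; apply: eq_bigr => i _; rewrite mxE mulrDr. Qed.

Lemma dotv_cons n (xi : 'rV[R]_n.+1) t v :
  dotv xi (cons_rV (t, v)) = xi 0 ord0 * t + dotv (\row_i xi 0 (lift ord0 i)) v.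
Proof.
rewrite /dotv big_ord_recl /cons_rV !mxE unlift_none/=; congr (_ + _).
by apply: eq_bigr => i _; rewrite !mxE liftK.
Qed.

Lemma measurable_dotv n (xi : 'rV[R]_n) : measurable_fun setT (dotv xi).
Proof.
apply: measurable_sum => i; apply: measurable_funM => //.
exact: measurable_coord_rV.
Qed.

Lemma measurable_cos_dotv n (xi : 'rV[R]_n) : measurable_fun setT (fun x => cos (dotv xi x)).
Proof.
apply: (@measurableT_comp _ _ _ _ _ _ (@cos R)); last exact: measurable_dotv.
by apply: continuous_measurable_fun; exact: continuous_cos.
Qed.

Lemma measurable_sin_dotv n (xi : 'rV[R]_n) : measurable_fun setT (fun x => sin (dotv xi x)).
Proof.
apply: (@measurableT_comp _ _ _ _ _ _ (@sin R)); last exact: measurable_dotv.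
by apply: continuous_measurable_fun; exact: continuous_sin.
Qed.

Lemma Rintegral_rV_isometry n (s : R) (x : 'rV[R]_n) (f : 'rV[R]_n -> R) :
  `|s| = 1 -> measurable_fun setT f ->
  \int[lebesgue_rV R n]_v f (s *: v + x) = \int[lebesgue_rV R n]_v f v.
Proof.
move=> s1 mf; rewrite /Rintegral; congr fine.
by apply: (integral_rV_isometry _ s x (EFin \o f)) => //; exact/measurable_EFinP.
Qed.

Lemma even_integral_sin n (k : 'rV[R]_n -> R) xi :
  (lebesgue_rV R n).-integrable setT (EFin \o k) -> (forall x, k (- x) = k x) ->
  \int[lebesgue_rV R n]_x (k x * sin (dotv xi x)) = 0.
Proof.
move=> ik ke; have mk : measurable_fun setT k.
  by apply/measurable_EFinP; exact: (measurable_int _ ik).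
have mks : measurable_fun setT (fun x => k x * sin (dotv xi x)).
  by apply: measurable_funM => //; exact: measurable_sin_dotv.
have iks : (lebesgue_rV R n).-integrable setT (EFin \o (fun x => k x * sin (dotv xi x))).
  apply: integrable_mul_le1 => // [|x]; [exact: measurable_sin_dotv|exact: sin_max].
have := @Rintegral_rV_isometry n (-1) 0 _ (normrN1 _) mks.
under eq_Rintegral do rewrite scaleN1r addr0 ke dotvNr sinN mulrN -mulN1r.
by rewrite RintegralZl// => E; lra.
Qed.

Lemma integrable_rV_succ n (f : 'rV[R]_n.+1 -> R) :
  (lebesgue_rV R n.+1).-integrable setT (EFin \o f) ->
  (@lebesgue_measure R \x lebesgue_rV R n)%E.-integrable setT (fun z => (f (cons_rV z))%:E).
Proof.
move=> /integrableP[/measurable_EFinP mf foo].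
have mfc : measurable_fun setT (fun z => f (cons_rV z)).
  by apply: measurableT_comp => //; exact: measurable_cons_rV.
apply/integrable12ltyP; first exact/measurable_EFinP.
rewrite -(@ge0_integral_rV_succ _ n (fun v => `|f v|%:E))//.
by apply/measurable_EFinP; apply: measurableT_comp.
Qed.

(** Fubini along the first coordinate.  The right-hand side is an iterated
    extended-real integral, since a slice of an integrable function need not be
    integrable. *)
Lemma Rintegral_rV_succ n (f : 'rV[R]_n.+1 -> R) :
  (lebesgue_rV R n.+1).-integrable setT (EFin \o f) ->
  \int[lebesgue_rV R n.+1]_x f x =
  fine (\int[lebesgue_measure]_t \int[lebesgue_rV R n]_v (f (cons_rV (t, v)))%:E)%E.
Proof.
move=> intf; have ip := integrable_rV_succ _ _ intf.
have mf := measurable_int _ intf.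
rewrite /Rintegral; congr fine.
rewrite (integral12_prod_meas1 ip) /= /lebesgue_rV_succ.
by rewrite integral_pushforward.
Qed.

End euclidean_integrals.

Lemma EFin_Rintegral {R : realType} {d : measure_display} {T : measurableType d}
  (mu : {measure set T -> \bar R}) (D : set T) (f : T -> R) : measurable D ->
  mu.-integrable D (EFin \o f) ->
  (\int[mu]_(x in D) (f x)%:E)%E = (\int[mu]_(x in D) f x)%:E.
Proof. by move=> mD intf; rewrite /Rintegral fineK//; exact: integrable_fin_num. Qed.

Section gaussian_space.
Context {R : realType}.

Definition gaussn n (s : R) (v : 'rV[R]_n) : R := \prod_(i < n) gauss1 s (v 0 i).

Lemma gaussn_ge0 n s (v : 'rV[R]_n) : 0 <= gaussn n s v.
Proof. by apply: prodr_ge0 => i _; exact: gauss1_ge0. Qed.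

Lemma gaussnN n s (v : 'rV[R]_n) : gaussn n s (- v) = gaussn n s v.
Proof. by apply: eq_bigr => i _; rewrite mxE gauss1N. Qed.

Lemma gaussn_cons n s t (v : 'rV[R]_n) :
  gaussn n.+1 s (cons_rV (t, v)) = gauss1 s t * gaussn n s v.
Proof.
rewrite /gaussn big_ord_recl /cons_rV !mxE unlift_none/=; congr (_ * _).
by apply: eq_bigr => i _; rewrite !mxE liftK.
Qed.

Lemma measurable_gaussn n :
  measurable_fun setT (fun z : measurableTypeR R * 'rV[R]_n => gaussn n z.1 z.2).
Proof.
apply: measurable_prod => i _.
apply: (@measurableT_comp _ _ _ _ _ _ (fun z : R * R => gauss1 z.1 z.2) _
  (fun z : measurableTypeR R * 'rV[R]_n => (z.1 : R, z.2 0 i : R))).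
  exact: measurable_gauss1.
apply/measurable_fun_pairP; split; first exact: measurable_fst.
apply: (@measurableT_comp _ _ _ _ _ _ (fun v : 'rV[R]_n => v 0 i : measurableTypeR R)).
  exact: measurable_coord_rV.
exact: measurable_snd.
Qed.

Lemma measurable_gaussn2 n s : measurable_fun setT (gaussn n s).
Proof. exact: (measurable_pair_slice _ s (measurable_gaussn n)). Qed.

Lemma integral_gaussn n s : 0 < s ->
  (\int[lebesgue_rV R n]_v (gaussn n s v)%:E = 1)%E.
Proof.
move=> s0; elim: n => [|n ih].
  rewrite integral_rV0; last by apply/measurable_EFinP; exact: measurable_gaussn2.
  by rewrite /gaussn big_ord0.
rewrite ge0_integral_rV_succ; last 2 first.
- by apply/measurable_EFinP; exact: measurable_gaussn2.
- by move=> x; rewrite lee_fin gaussn_ge0.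
under eq_integral.
  move=> t _; under eq_integral do rewrite gaussn_cons EFinM.
  rewrite ge0_integralZl//; last 3 first.
  - by apply/measurable_EFinP; exact: measurable_gaussn2.
  - by move=> x _; rewrite lee_fin gaussn_ge0.
  - by rewrite lee_fin gauss1_ge0.
  rewrite ih mule1; over.
exact: integral_gauss1.
Qed.

Lemma integrable_gaussn n s : 0 < s ->
  (lebesgue_rV R n).-integrable setT (EFin \o gaussn n s).
Proof.
move=> s0; apply/integrableP; split; first by apply/measurable_EFinP; exact: measurable_gaussn2.
under eq_integral do rewrite /= ger0_norm ?gaussn_ge0//.
by rewrite integral_gaussn// ltry.
Qed.

Lemma integrable_gaussnM n s (h : 'rV[R]_n -> R) : 0 < s -> measurable_fun setT h ->
  (forall x, `|h x| <= 1) ->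
  (lebesgue_rV R n).-integrable setT (fun v => (gaussn n s v * h v)%:E).
Proof.
by move=> s0; exact: integrable_mul_le1 (integrable_gaussn n s s0).
Qed.

(** By induction on the dimension: cos (a + b) = cos a cos b - sin a sin b, and
    the sine part of a Gaussian integral vanishes by symmetry. *)
Lemma integral_gaussn_cos n s xi : 0 < s ->
  \int[lebesgue_rV R n]_v (gaussn n s v * cos (dotv xi v)) = expR (- (s * dotv xi xi)).
Proof.
move=> s0; elim: n xi => [|n ih] xi.
  rewrite /Rintegral integral_rV0; last first.
    apply/measurable_EFinP/measurable_funM; first exact: measurable_gaussn2.
    exact: measurable_cos_dotv.
  by rewrite /= /gaussn /dotv !big_ord0 cos0 mulr0 oppr0 expR0 mulr1.
rewrite Rintegral_rV_succ; last first.
  by apply: integrable_gaussnM => //; [exact: measurable_cos_dotv|move=> x; exact: cos_max].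
pose xi' := \row_i xi 0 (lift ord0 i) : 'rV[R]_n.
have ic : (lebesgue_rV R n).-integrable setT (fun v => (gaussn n s v * cos (dotv xi' v))%:E).
  by apply: integrable_gaussnM => //; [exact: measurable_cos_dotv|move=> x; exact: cos_max].
have is' : (lebesgue_rV R n).-integrable setT (fun v => (gaussn n s v * sin (dotv xi' v))%:E).
  by apply: integrable_gaussnM => //; [exact: measurable_sin_dotv|move=> x; exact: sin_max].
transitivity (\int[lebesgue_measure]_t (gauss1 s t * cos (xi 0 ord0 * t) * expR (- (s * dotv xi' xi')))).
  rewrite /Rintegral; congr fine; apply: eq_integral => t _.
  rewrite EFin_Rintegral//; last first.
    apply: (@eq_integrable _ _ _ _ _ measurableT (fun v => ((gauss1 s t)%:E *
        (gaussn n s v * cos (xi 0 ord0 * t + dotv xi' v))%:E)%E)).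
      by move=> v _; rewrite -EFinM/= gaussn_cons dotv_cons mulrA.
    apply: integrableZl => //; apply: integrable_gaussnM => //; last by move=> x; exact: cos_max.
    apply: (@measurableT_comp _ _ _ _ _ _ (@cos R)).
      by apply: continuous_measurable_fun; exact: continuous_cos.
    by apply: measurable_funD => //; exact: measurable_dotv.
  congr EFin; rewrite -(ih xi').
  under eq_Rintegral.
    move=> v _; rewrite gaussn_cons dotv_cons cosD -/xi'.
    rewrite (_ : _ * _ = gauss1 s t * cos (xi 0 ord0 * t) * (gaussn n s v * cos (dotv xi' v)) -
      gauss1 s t * sin (xi 0 ord0 * t) * (gaussn n s v * sin (dotv xi' v))); last by ring.
    over.
  rewrite RintegralB//; last 2 first.
  - exact: (@integrableZl _ _ _ (lebesgue_rV R n) setT measurableT (gauss1 s t * cos (xi 0 ord0 * t)) _ ic).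
  - exact: (@integrableZl _ _ _ (lebesgue_rV R n) setT measurableT (gauss1 s t * sin (xi 0 ord0 * t)) _ is').
  rewrite !RintegralZl// even_integral_sin ?mulr0 ?subr0//; first exact: integrable_gaussn.
  by move=> x; exact: gaussnN.
rewrite RintegralZr//; last first.
  apply: integrable_bounded_gauss1 => // [|x]; last exact: cos_max.
  apply: continuous_measurable_fun => x; apply: continuous_comp; last exact: continuous_cos.
  exact: mulrl_continuous.
rewrite integral_gauss1_cos// -expRD -opprD -mulrDr; congr (expR (- (s * _))).
rewrite [RHS]/dotv big_ord_recl expr2; congr (_ + _).
by apply: eq_bigr => i _; rewrite !mxE.
Qed.

End gaussian_space.

(** * Families of even probability densities with a known transform *)

Section density_families.
Context {R : realType} {n : nat}.
Let L := lebesgue_rV R n.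

(** q (y, _) is an even probability density for each y in D, and m y is its
    Fourier transform, given by a cosine integral because of the symmetry.
    Joint measurability in (y, x) is what allows parameters to be averaged. *)
Definition density_family {d} {Y : measurableType d} (D : set Y)
    (q : Y * 'rV[R]_n -> R) (m : Y -> 'rV[R]_n -> R) : Prop :=
  measurable_fun setT q /\ forall y, D y ->
  [/\ forall x, 0 <= q (y, x), forall x, q (y, - x) = q (y, x),
      (\int[L]_x (q (y, x))%:E = 1)%E &
      forall xi, \int[L]_x (q (y, x) * cos (dotv xi x)) = m y xi].

Lemma gaussian_family : density_family [set s : measurableTypeR R | 0 < s]
  (fun z => gaussn n z.1 z.2) (fun s xi => expR (- (s * dotv xi xi))).
Proof.
split; first exact: measurable_gaussn.
move=> s /= s0; split => [x|x||xi].
- exact: gaussn_ge0.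
- exact: gaussnN.
- exact: integral_gaussn.
- exact: integral_gaussn_cos.
Qed.

Lemma density_family_comp {d1 d2} {Y : measurableType d1} {Z : measurableType d2}
    (D : set Y) (E : set Z) q m (phi : Z -> Y) :
  density_family D q m -> measurable_fun setT phi -> (forall z, E z -> D (phi z)) ->
  density_family E (fun p => q (phi p.1, p.2)) (fun z => m (phi z)).
Proof.
move=> [mq Hq] mphi ED; split; last by move=> z Ez; exact: Hq _ (ED _ Ez).
apply: (measurableT_comp mq); apply/measurable_fun_pairP; split => /=.
  exact: (measurableT_comp mphi measurable_fst).
exact: measurable_snd.
Qed.

Section mix.
Context {d1 : measure_display} {Y : measurableType d1}.
Variables (nu : {sigma_finite_measure set Y -> \bar R}) (D : set Y).
Variables (q : Y * 'rV[R]_n -> R) (m : Y -> 'rV[R]_n -> R).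
Hypothesis qm : density_family D q m.

Let qA (w : Y -> R) : (forall y, w y != 0 -> D y) ->
  forall y, w y != 0 -> (\int[L]_x `|q (y, x)|%:E <= 1%:E)%E.
Proof.
move=> wD y /wD /(qm.2) [q0 _ q1 _].
under eq_integral do rewrite ger0_norm//.
by rewrite q1.
Qed.

Section signed.
Variable w : Y -> R.
Hypothesis iw : nu.-integrable setT (EFin \o w).
Hypothesis wD : forall y, w y != 0 -> D y.

Lemma family_mixture_integrable : L.-integrable setT (EFin \o mixture nu w q).
Proof. exact: (mixture_integrable nu L w q 1 ler01 iw qm.1 (qA _ wD)). Qed.

Lemma family_mixture_even x : mixture nu w q (- x) = mixture nu w q x.
Proof.
apply: eq_Rintegral => y _; have [->|wy] := eqVneq (w y) 0; first by rewrite !mul0r.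
by have [_ -> _ _] := qm.2 _ (wD _ wy).
Qed.

Lemma family_mixture_cos xi :
  \int[L]_x (mixture nu w q x * cos (dotv xi x)) = \int[nu]_y (w y * m y xi).
Proof.
rewrite (mixture_test nu L w q 1 ler01 iw qm.1 (qA _ wD)) //; last 2 first.
- exact: measurable_cos_dotv.
- by move=> x; exact: cos_max.
apply: eq_Rintegral => y _; have [->|wy] := eqVneq (w y) 0; first by rewrite !mul0r.
by have [_ _ _ ->] := qm.2 _ (wD _ wy).
Qed.

End signed.

(** A weight which is itself a probability density in y, with a parameter z,
    yields a new family indexed by z.  Used twice: Gaussians are mixed into
    Poisson kernels, and these into the densities with transform
    (l / (l + |xi|))^s. *)
Lemma density_family_mix {d2} {Z : measurableType d2} (E : set Z) (w : Z * Y -> R) :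
  measurable_fun setT w ->
  (forall z, E z -> [/\ forall y, 0 <= w (z, y), forall y, w (z, y) != 0 -> D y &
      (\int[nu]_y (w (z, y))%:E = 1)%E]) ->
  density_family E (fun p => mixture nu (fun y => w (p.1, y)) q p.2)
    (fun z xi => \int[nu]_y (w (z, y) * m y xi)).
Proof.
move=> mw Hw; split.
  apply: (@measurable_fun_Rintegral2 _ _ _ _ _ nu (fun a : Y * (Z * 'rV[R]_n) =>
     w (a.2.1, a.1) * q (a.1, a.2.2))).
  apply: measurable_funM.
    apply: (measurableT_comp mw); apply/measurable_fun_pairP; split => /=.
      exact: (measurableT_comp measurable_fst measurable_snd).
    exact: measurable_fst.
  apply: (measurableT_comp qm.1); apply/measurable_fun_pairP; split => /=.
    exact: measurable_fst.
  exact: (measurableT_comp measurable_snd measurable_snd).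
move=> z Ez; have [w0 wD w1] := Hw _ Ez.
have iw : nu.-integrable setT (EFin \o (fun y => w (z, y))).
  apply/integrableP; split; first by apply/measurable_EFinP; exact: measurable_pair_slice.
  by under eq_integral do rewrite /= ger0_norm//; rewrite w1 ltry.
have qge0 x : 0 <= mixture nu (fun y => w (z, y)) q x.
  apply: Rintegral_ge0 => y _; have [->|wy] := eqVneq (w (z, y)) 0; first by rewrite mul0r.
  by rewrite mulr_ge0//; have [q0 _ _ _] := qm.2 _ (wD _ wy).
split => //=.
- exact: family_mixture_even.
- rewrite EFin_Rintegral//; last exact: family_mixture_integrable.
  have := mixture_test nu L (fun y => w (z, y)) q 1 ler01 iw qm.1 (qA _ wD) (cst 1)
    (measurable_cst _) (fun=> eq_ind_r (fun z => z <= 1) (lexx 1) (normr1 _)).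
  under eq_Rintegral do rewrite mulr1.
  move=> ->; rewrite -[RHS]w1 [RHS]EFin_Rintegral//; congr EFin.
  apply: eq_Rintegral => y _; have [->|wy] := eqVneq (w (z, y)) 0; first by rewrite !mul0r.
  have [_ _ q1 _] := qm.2 _ (wD _ wy).
  under eq_Rintegral do rewrite mulr1.
  by rewrite {1}/Rintegral q1 mulr1.
- by move=> xi; exact: family_mixture_cos.
Qed.

End mix.
End density_families.

(** * The distribution function of a Gaussian *)

(** The time 1/4 is chosen so that the density is pi^(-1/2) exp(- x^2); the
    distribution function provides the antiderivative of the subordination
    integral. *)
Section gaussian_distribution_function.
Context {R : realType}.
Let mu := @lebesgue_measure R.

Let g : R -> R := gauss1 4^-1.

Let q0 : 0 < 4^-1 :> R. Proof. by rewrite invr_gt0. Qed.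

Definition gaussPhi (x : R) : R := \int[mu]_(t in `]-oo, x]) g t.

Let ig (A : set R) : measurable A -> mu.-integrable A (EFin \o g).
Proof. by move=> mA; apply: integrableS (integrable_gauss1 _ q0). Qed.

Lemma is_derive_gaussPhi x : is_derive x (1 : R) gaussPhi (g x).
Proof.
have cg : {for x, continuous g} by exact: continuous_gauss1.
have x1 : x < x + 1 by rewrite ltrDl.
have [|d e] := @continuous_FTC1 R g -oo%O x (x + 1) x1 (ig _ (measurable_itv _)) _ cg.
  exact: ltNyr.
by apply: DeriveDef; [exact: d|rewrite -derive1E; exact: e].
Qed.

Let moment : R := \int[mu]_t `|t * g t|.

Let imom (A : set R) : measurable A -> mu.-integrable A (EFin \o (fun t => `|t * g t|)).
Proof.
move=> mA; apply: (integrableS measurableT) => //; apply: integrable_norm.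
have c1 (x : R) : `|(cst 1 : R -> R) x| <= 1 by rewrite normr1.
have := @integrable_id_gauss1 R 4^-1 (cst 1) q0 (measurable_cst _) c1.
by apply: eq_integrable => // x _ /=; rewrite mulr1.
Qed.

(* Markov inequality for the first absolute moment. *)
Let tail (A : set R) (x : R) : measurable A -> 0 < x -> (forall t, A t -> x <= `|t|) ->
  \int[mu]_(t in A) g t <= moment / x.
Proof.
move=> mA x0 Ax; rewrite ler_pdivlMr// mulrC -RintegralZl//; last exact: ig.
apply: (@le_trans _ _ (\int[mu]_(t in A) `|t * g t|)).
  apply: le_Rintegral => //.
  - exact: (@integrableZl _ _ _ mu A mA x (EFin \o g) (ig _ mA)).
  - exact: imom.
  move=> t At; rewrite normrM (ger0_norm (gauss1_ge0 _ _)) ler_wpM2r ?gauss1_ge0//.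
  exact: Ax.
rewrite /moment /Rintegral fine_le//.
- by apply: integrable_fin_num => //; exact: imom.
- by apply: integrable_fin_num => //; exact: imom.
apply: ge0_subset_integral => //.
by have /integrableP[] := imom _ measurableT.
Qed.

Lemma gaussPhi_ge0 x : 0 <= gaussPhi x.
Proof. by apply: Rintegral_ge0 => t _; exact: gauss1_ge0. Qed.

Lemma gaussPhi_compl x : gaussPhi x + \int[mu]_(t in `]x, +oo[) g t = 1.
Proof.
rewrite /gaussPhi -Rintegral_setU//.
- rewrite (_ : _ `|` _ = setT); first by rewrite /Rintegral integral_gauss1.
  by rewrite -setCitvl setUv.
- exact: ig (measurableU _ _ _ _).
- by rewrite -setCitvl; apply/disj_setPCl; rewrite ?setCK.
Qed.

Lemma cvg_gaussPhiNy : gaussPhi x @[x --> -oo] --> 0.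
Proof.
apply/cvgNy_compNP.
have h : moment / x @[x --> +oo] --> (0 : R).
  by rewrite -(mulr0 moment); apply: cvgMr; apply/gtr0_cvgV0; [exact: nbhs_pinfty_gt|exact: cvg_id].
apply: (squeeze_cvgr _ (cvg_cst 0) h); near=> x => /=.
rewrite gaussPhi_ge0/=; apply: tail => // t /=.
rewrite in_itv/= => tx; rewrite ler_normr; apply/orP; right.
by rewrite lerNr.
Unshelve. all: by end_near. Qed.

Lemma cvg_gaussPhiy : gaussPhi x @[x --> +oo] --> (1 : R).
Proof.
have h : 1 - moment / x @[x --> +oo] --> (1 : R).
  rewrite -[X in _ --> X]subr0; apply: cvgB; first exact: cvg_cst.
  by rewrite -(mulr0 moment); apply: cvgMr; apply/gtr0_cvgV0; [exact: nbhs_pinfty_gt|exact: cvg_id].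
apply: (squeeze_cvgr _ h (cvg_cst (1 : R))); near=> x => /=.
have tg0 : 0 <= \int[mu]_(t in `]x, +oo[) g t.
  by apply: Rintegral_ge0 => t _; exact: gauss1_ge0.
have tg : \int[mu]_(t in `]x, +oo[) g t <= moment / x.
  apply: tail => // t /=.
  by rewrite in_itv/= andbT => /ltW tx; rewrite ler_normr tx.
by rewrite -(gaussPhi_compl x) lerBlDr lerD2l tg lerDl tg0.
Unshelve. all: by end_near. Qed.

(** By symmetry, the derivative of Phi(x) + Phi(-x) is zero; the value of this
    constant is its limit 1 + 0 at infinity. *)
Lemma gaussPhi0 : gaussPhi 0 = 2^-1.
Proof.
have d x : is_derive x (1 : R) (fun x => gaussPhi x + gaussPhi (- x)) 0.
  have d1 := is_derive_gaussPhi x; have d2 := is_derive_gaussPhi (- x).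
  have d3 : is_derive x (1 : R) (fun x => gaussPhi (- x)) (- g x).
    have -> : - g x = g (- x) * -1 by rewrite mulrN1 /g gauss1N.
    by apply: (@is_derive1_comp _ gaussPhi -%R).
  by apply: is_derive_eq; rewrite subrr.
have E x : gaussPhi x + gaussPhi (- x) = 2 * gaussPhi 0.
  by rewrite (is_derive_0_is_cst x 0 d) oppr0; ring.
suff : 2 * gaussPhi 0 = 1 + 0 by move=> ?; lra.
have c1 : (gaussPhi x + gaussPhi (- x)) @[x --> +oo] --> (1 + 0 : R).
  by apply: cvgD; [exact: cvg_gaussPhiy|by have /cvgNy_compNP := cvg_gaussPhiNy].
rewrite -(cvg_lim _ c1)//; apply/esym/cvg_lim => //.
by under eq_fun do rewrite E; exact: cvg_cst.
Qed.

End gaussian_distribution_function.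

(** * Subordination of the Poisson kernel to the heat kernel *)

Section positive_axis.
Context {R : realType}.
Let mu := @lebesgue_measure R.

Lemma integral_pos_support (f : R -> R) :
  (\int[mu]_x (if 0 < x then f x else 0)%:E = \int[mu]_(x in `]0%R, +oo[) (f x)%:E)%E.
Proof.
rewrite [RHS]integral_mkcond; apply: eq_integral => x _; rewrite patchE.
have -> : (x \in `]0%R, +oo[%classic) = (0 < x).
  by apply/idP/idP; rewrite inE/= in_itv/= andbT.
by case: ifP.
Qed.

(** The exhausting intervals of the half-line are [(n + 2)^-2, (n + 1)^2];
    squares make the square roots at the end points explicit. *)
Lemma ge0_FTC_pos (f F : R -> R) (la lb : R) :
  (forall x, 0 < x -> 0 <= f x) ->
  (forall x, 0 < x -> {for x, continuous f}) ->
  (forall x : R, 0 < x -> is_derive x (1 : R) F (f x)) ->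
  F ((n.+2%:R ^+ 2)^-1) @[n --> \oo] --> la ->
  F (n.+1%:R ^+ 2) @[n --> \oo] --> lb ->
  (\int[mu]_x (if 0 < x then f x else 0)%:E = (lb - la)%:E)%E.
Proof.
move=> f0 cf dF Fa Fb; rewrite integral_pos_support.
have pos x : `]0, +oo[%classic x -> 0 < x by rewrite /= in_itv/= andbT.
apply: (ge0_improper_FTC f F (fun n => (n.+2%:R ^+ 2)^-1) (fun n => n.+1%:R ^+ 2)) => //.
- move=> n; apply: (@lt_le_trans _ _ 1).
    by rewrite invf_lt1 ?exprn_gt0// exprn_egt1// ltr1n.
  by rewrite exprn_ege1// ler1n.
- move=> m n mn; rewrite lef_pV2 ?posrE ?exprn_gt0//.
  by rewrite lerXn2r ?nnegrE// ler_nat !ltnS.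
- by move=> m n mn; rewrite lerXn2r ?nnegrE// ler_nat ltnS.
- apply/seteqP; split => x /=; last first.
    move=> [n _]; rewrite /= !in_itv/= andbT => /andP[+ _].
    by apply: lt_le_trans; rewrite invr_gt0 exprn_gt0.
  rewrite in_itv/= andbT => x0.
  pose n := maxn (Num.bound x) (Num.bound x^-1).
  exists n => //; rewrite /= in_itv/=.
  have xn : x <= n.+1%:R.
    apply/ltW/(lt_le_trans (archi_boundP (ltW x0))).
    by rewrite ler_nat (leq_trans (leq_maxl _ _) (leqnSn _)).
  have Vxn : x^-1 <= n.+2%:R.
    have /ltW Vx0 : 0 < x^-1 by rewrite invr_gt0.
    apply/ltW/(lt_le_trans (archi_boundP Vx0)).
    by rewrite ler_nat; exact: leq_trans (leq_maxr _ _) (leq_trans (leqnSn _) (leqnSn _)).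
  apply/andP; split.
    rewrite -[leRHS]invrK lef_pV2 ?posrE ?exprn_gt0 ?invr_gt0//.
    by rewrite (le_trans Vxn)// ler_eXnr// ler1n.
  by rewrite (le_trans xn)// ler_eXnr// ler1n.
- by move=> x /pos; exact: dF.
- by move=> x /pos; exact: cf.
- by move=> x /pos; exact: f0.
Qed.

End positive_axis.

Section subordination.
Context {R : realType}.
Let mu := @lebesgue_measure R.

(** The density t / (2 sqrt pi) s^(-3/2) exp(- t^2 / (4 s)) of a Levy
    distribution, written with the Gaussian density at t / (2 sqrt s). *)
Definition subord (t s : R) : R :=
  if 0 < s then t / 2 * s `^ (- 2^-1 - 1) * gauss1 4^-1 (t / 2 * s `^ (- 2^-1)) else 0.

Lemma measurable_subord : measurable_fun setT (fun z : measurableTypeR R * measurableTypeR R =>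
  subord z.1 z.2).
Proof.
apply: measurable_fun_ifT => //.
  apply: (measurable_fun_ltr (measurable_cst _)); exact: measurable_snd.
have m1 : measurable_fun setT (fun z : measurableTypeR R * measurableTypeR R => z.1 / 2 : R).
  by apply: measurable_funM => //; exact: measurable_fst.
have mp (a : R) : measurable_fun setT (fun z : measurableTypeR R * measurableTypeR R => (z.2 : R) `^ a : R).
  apply: (@measurableT_comp _ _ _ _ _ _ (fun s : R => s `^ a)) => //; exact: measurable_snd.
apply: measurable_funM; first exact: measurable_funM.
apply: (@measurableT_comp _ _ _ _ _ _ (fun y => gauss1 4^-1 y)).
  by apply: continuous_measurable_fun; apply: continuous_gauss1; rewrite invr_gt0.
exact: measurable_funM.
Qed.

Lemma subord_ge0 t s : 0 <= t -> 0 <= subord t s.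
Proof.
by move=> t0; rewrite /subord; case: ifP => // s0; rewrite !mulr_ge0 ?powR_ge0 ?gauss1_ge0.
Qed.

Lemma cvg_affine_nat (c b : R) : 0 < c -> (c * n.+1%:R + b) @[n --> \oo] --> +oo.
Proof.
move=> c0; apply/cvgryPge => A; near=> n.
rewrite -lerBlDr mulrC -ler_pdivrMr// (@le_trans _ _ n%:R)// ?ler_nat//.
by near: n; exact: nbhs_infty_ger.
Unshelve. all: by end_near. Qed.

(** With a = r sqrt s and b = t / (2 sqrt s), the integrand has the explicit
    antiderivative
      exp(- t r) Phi(a - b) + exp(t r) Phi(- a - b)
    because (a -+ b)^2 = r^2 s + t^2 / (4 s) -+ t r.  It vanishes at 0 and tends
    to exp(- t r) at infinity; for r = 0 both terms tend to Phi(0) = 1/2. *)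
Lemma integral_subord_exp t r : 0 < t -> 0 <= r ->
  (\int[mu]_s (subord t s * expR (- (s * r ^+ 2)))%:E = (expR (- (t * r)))%:E)%E.
Proof.
move=> t0 r0; have q0 : 0 < 4^-1 :> R by rewrite invr_gt0.
pose f s : R := t / 2 * s `^ (- 2^-1 - 1) * gauss1 4^-1 (t / 2 * s `^ (- 2^-1)) * expR (- (s * r ^+ 2)).
pose A s : R := r * s `^ 2^-1 - t / 2 * s `^ (- 2^-1).
pose B s : R := - (r * s `^ 2^-1 + t / 2 * s `^ (- 2^-1)).
pose F s : R := expR (- (t * r)) * gaussPhi (A s) + expR (t * r) * gaussPhi (B s).
have p1 (s : R) : 0 < s -> s `^ 2^-1 * s `^ (- 2^-1) = 1.
  by move=> s0; rewrite -powRD ?addrN ?powRr0//; apply/implyP => _; rewrite gt_eqF.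
have p2 (s : R) : 0 < s -> s `^ 2^-1 * s `^ 2^-1 = s.
  move=> s0; rewrite -powRD; first by rewrite -div1r -splitr powRr1// ltW.
  by apply/implyP => _; rewrite gt_eqF.
have p3 (s : R) : 0 < s -> s * s `^ (- 2^-1 - 1) = s `^ (- 2^-1).
  move=> s0; rewrite powRB; last by apply/implyP => _; rewrite gt_eqF.
  by rewrite powRr1 ?ltW//; field; rewrite gt_eqF.
rewrite (_ : expR (- (t * r)) = (expR (- (t * r)) - 0)); last by rewrite subr0.
under eq_integral.
  move=> s _; rewrite (_ : _ * _ = if 0 < s then f s else 0); last first.
    by rewrite /subord; case: ifP => // _; rewrite mul0r.
  over.
apply: (ge0_FTC_pos f F).
- by move=> s s0; rewrite /f !mulr_ge0 ?powR_ge0 ?gauss1_ge0 ?expR_ge0// ltW.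
- move=> s s0; have cp (a : R) : {for s, continuous (fun s : R => s `^ a)}.
    apply: differentiable_continuous; apply/derivable1_diffP.
    by case: (is_derive1_powR a s0).
  apply: cvgM; [apply: cvgM; [apply: cvgM; [exact: cvg_cst|exact: cp]|]|].
    apply: (@continuous_comp _ _ _ (fun s : R => t / 2 * s `^ (- 2^-1)) (gauss1 4^-1)).
      by apply: cvgM; [exact: cvg_cst|exact: cp].
    exact: continuous_gauss1.
  apply: (@continuous_comp _ _ _ (fun s : R => - (s * r ^+ 2)) expR).
    by apply: cvgN; apply: cvgM; [exact: cvg_id|exact: cvg_cst].
  exact: continuous_expR.
- move=> s s0.
  have d1 := is_derive1_powR 2^-1 s0; have d2 := is_derive1_powR (- 2^-1) s0.
  have dA : is_derive s (1 : R) A (r * (2^-1 * s `^ (2^-1 - 1)) - t / 2 * (- 2^-1 * s `^ (- 2^-1 - 1))).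
    by apply: is_derive_eq; rewrite /GRing.scale/=; ring.
  have dB : is_derive s (1 : R) B (- (r * (2^-1 * s `^ (2^-1 - 1)) + t / 2 * (- 2^-1 * s `^ (- 2^-1 - 1)))).
    by apply: is_derive_eq; rewrite /GRing.scale/=; ring.
  set DA := (X in is_derive s _ A X) in dA; set DB := (X in is_derive s _ B X) in dB.
  have dPA := @is_derive1_comp _ _ _ _ _ _ (is_derive_gaussPhi (A s)) dA.
  have dPB := @is_derive1_comp _ _ _ _ _ _ (is_derive_gaussPhi (B s)) dB.
  have -> : F = expR (- (t * r)) *: (gaussPhi \o A) + expR (t * r) *: (gaussPhi \o B) by [].
  have E1 : expR (- (t * r)) * gauss1 4^-1 (A s) =
      gauss1 4^-1 (t / 2 * s `^ (- 2^-1)) * expR (- (s * r ^+ 2)).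
    rewrite /gauss1 mulrCA -[RHS]mulrA -!expRD; congr (_ * expR _).
    have -> : s * r ^+ 2 = s `^ 2^-1 * s `^ 2^-1 * r ^+ 2 by rewrite p2.
    rewrite /A divff// !divr1.
    have := p1 s s0; move: (s `^ 2^-1) (s `^ (- 2^-1)) => p q pq.
    have -> : t * r = t * r * (p * q) by rewrite pq mulr1.
    by field.
  have E2 : expR (t * r) * gauss1 4^-1 (B s) =
      gauss1 4^-1 (t / 2 * s `^ (- 2^-1)) * expR (- (s * r ^+ 2)).
    rewrite /gauss1 mulrCA -[RHS]mulrA -!expRD; congr (_ * expR _).
    have -> : s * r ^+ 2 = s `^ 2^-1 * s `^ 2^-1 * r ^+ 2 by rewrite p2.
    rewrite /B divff// !divr1.
    have := p1 s s0; move: (s `^ 2^-1) (s `^ (- 2^-1)) => p q pq.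
    have -> : t * r = t * r * (p * q) by rewrite pq mulr1.
    by field.
  have dF := is_deriveD (is_deriveZ (expR (- (t * r))) dPA) (is_deriveZ (expR (t * r)) dPB).
  have <- : expR (- (t * r)) *: (gauss1 4^-1 (A s) * DA) + expR (t * r) *: (gauss1 4^-1 (B s) * DB) = f s.
    rewrite /GRing.scale/= [X in X + _]mulrA [X in _ + X]mulrA E1 E2 /f /DA /DB.
    by field.
  exact: dF.
- have pn n : ((n.+2%:R ^+ 2)^-1 : R) `^ 2^-1 = n.+2%:R^-1.
    by rewrite powR12_sqrt ?invr_ge0 ?exprn_ge0// -exprVn sqrtr_sqr ger0_norm// invr_ge0.
  have n1 n : n.+2%:R^-1 <= 1 :> R by rewrite invf_le1// ler1n.
  have cA : A ((n.+2%:R ^+ 2)^-1) @[n --> \oo] --> -oo.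
    apply/cvgNry; apply: (ger_cvgy _ (cvg_affine_nat (t / 2) (- r) _)); last by rewrite divr_gt0.
    apply: nearW => n; rewrite fctE /A powRN pn invrK opprB.
    rewrite lerB// ?ler_piMr//.
    by rewrite ler_wpM2l ?ler_nat// divr_ge0// ltW.
  have cB : B ((n.+2%:R ^+ 2)^-1) @[n --> \oo] --> -oo.
    apply/cvgNry; apply: (ger_cvgy _ (cvg_affine_nat (t / 2) 0 _)); last by rewrite divr_gt0.
    apply: nearW => n; rewrite fctE /B powRN pn invrK opprK addr0.
    rewrite ler_wpDl// ?mulr_ge0//.
    by rewrite ler_wpM2l ?ler_nat// divr_ge0// ltW.
  rewrite -[X in _ --> X](_ : expR (- (t * r)) * 0 + expR (t * r) * 0 = 0); last by rewrite !mulr0 addr0.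
  apply: cvgD; apply: cvgMr.
    exact: (cvg_comp _ _ cA cvg_gaussPhiNy).
  exact: (cvg_comp _ _ cB cvg_gaussPhiNy).
- have pn n : (n.+1%:R ^+ 2 : R) `^ 2^-1 = n.+1%:R.
    by rewrite powR12_sqrt ?exprn_ge0// sqrtr_sqr ger0_norm.
  have n1 n : n.+1%:R^-1 <= 1 :> R by rewrite invf_le1// ler1n.
  have [r00|rn0] := eqVneq r 0.
    rewrite r00 mulr0 oppr0 expR0.
    have cA : (- (t / 2) * n.+1%:R^-1) @[n --> \oo] --> (0 : R).
      by rewrite -(mulr0 (- (t / 2))); apply: cvgMr; exact: cvg_harmonic.
    have cP : gaussPhi (- (t / 2) * n.+1%:R^-1) @[n --> \oo] --> gaussPhi (0 : R).
      apply: (cvg_comp _ _ cA); apply: differentiable_continuous; apply/derivable1_diffP.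
      by case: (is_derive_gaussPhi (0 : R)).
    have -> : (fun n => F (n.+1%:R ^+ 2)) =
       (fun n => gaussPhi (- (t / 2) * n.+1%:R^-1) + gaussPhi (- (t / 2) * n.+1%:R^-1)).
      apply/funext => n; rewrite /F /A /B r00 mulr0 oppr0 expR0 !mul1r !mul0r powRN pn.
      by rewrite sub0r add0r mulNr.
    rewrite [X in _ --> X](_ : _ = gaussPhi (0 : R) + gaussPhi 0); last first.
      by rewrite gaussPhi0; field.
    exact: cvgD.
  have rp : 0 < r by rewrite lt_neqAle eq_sym rn0.
  have cA : A (n.+1%:R ^+ 2) @[n --> \oo] --> +oo.
    apply: (ger_cvgy _ (cvg_affine_nat r (- (t / 2)) rp)).
    apply: nearW => n; rewrite /A powRN pn lerD2l lerN2 ler_piMr//.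
    by rewrite divr_ge0// ltW.
  have cB : B (n.+1%:R ^+ 2) @[n --> \oo] --> -oo.
    apply/cvgNry; apply: (ger_cvgy _ (cvg_affine_nat r 0 rp)).
    apply: nearW => n; rewrite fctE /B powRN pn opprK addr0 lerDl.
    by rewrite mulr_ge0// ?invr_ge0// divr_ge0// ltW.
  rewrite -[X in _ --> X](_ : expR (- (t * r)) * 1 + expR (t * r) * 0 = expR (- (t * r))); last first.
    by rewrite mulr0 addr0 mulr1.
  apply: cvgD; apply: cvgMr.
    exact: (cvg_comp _ _ cA cvg_gaussPhiy).
  exact: (cvg_comp _ _ cB cvg_gaussPhiNy).
Qed.

End subordination.

(** * Gamma integrals *)

Section gamma_integrals.
Context {R : realType}.
Let mu := @lebesgue_measure R.
Implicit Types b c t x : R.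

(** The function t^(b - 1) exp(- c t) on the positive half-line; in
    exponential form it is visibly measurable in (b, c, t) jointly. *)
Definition gamma_weight b c t : R := if 0 < t then expR ((b - 1) * ln t - c * t) else 0.

Lemma gamma_weight_ge0 b c t : 0 <= gamma_weight b c t.
Proof. by rewrite /gamma_weight; case: ifP => // _; exact: expR_ge0. Qed.

Lemma powR_expR_ln b t : 0 < t -> t `^ b = expR (b * ln t).
Proof. by move=> t0; rewrite /powR gt_eqF. Qed.

Lemma measurable_gamma_weight d (T : measurableType d) (f g h : T -> R) :
  measurable_fun setT f -> measurable_fun setT g -> measurable_fun setT h ->
  measurable_fun setT (fun z => gamma_weight (f z) (g z) (h z)).
Proof.
move=> mf mg mh; apply: measurable_fun_ifT => //; first exact: measurable_fun_ltr.
apply: measurableT_comp => //; apply: measurable_funB; apply: measurable_funM => //.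
  exact: measurable_funB.
exact: measurableT_comp.
Qed.

Let cvg_an : ((n.+2%:R ^+ 2)^-1 : R) @[n --> \oo] --> (0 : R).
Proof.
apply: (squeeze_cvgr _ (cvg_cst 0) (@cvg_harmonic R)); apply: nearW => n.
rewrite invr_ge0 exprn_ge0//= lef_pV2 ?posrE ?exprn_gt0//.
by rewrite expr2 (@le_trans _ _ n.+2%:R) ?ler_nat// ler_peMr// ler1n.
Qed.

Let cvg_Vbn : (n.+1%:R ^+ 2 : R)^-1 @[n --> \oo] --> (0 : R).
Proof.
apply: (squeeze_cvgr _ (cvg_cst 0) (@cvg_harmonic R)); apply: nearW => n.
rewrite invr_ge0 exprn_ge0//= lef_pV2 ?posrE ?exprn_gt0//.
by rewrite expr2 ler_peMr// ler1n.
Qed.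

(* The dominating function is the derivative of (x / (1 + x))^b. *)
Let integral_dom b : 0 < b ->
  (\int[mu]_x (if (0 < x)%R then b * x `^ (b - 1) * (1 + x) `^ (- b - 1) else 0)%:E < +oo)%E.
Proof.
move=> b0; pose F x : R := x `^ b * (1 + x) `^ (- b).
rewrite (_ : (\int[mu]_x _)%E = (1 - 0)%:E) ?ltry//.
apply: (ge0_FTC_pos (fun x => b * x `^ (b - 1) * (1 + x) `^ (- b - 1)) F 0 1).
- by move=> x x0; rewrite !mulr_ge0 ?powR_ge0// ltW.
- move=> x x0; have x10 : 0 < 1 + x by rewrite addr_gt0.
  have cp (a y : R) : 0 < y -> {for y, continuous (fun s : R => s `^ a)}.
    move=> y0; apply: differentiable_continuous; apply/derivable1_diffP.
    by case: (is_derive1_powR a y0).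
  apply: cvgM; [apply: cvgM; [exact: cvg_cst|exact: cp]|].
  apply: (@continuous_comp _ _ _ (fun x : R => 1 + x) (fun s => s `^ (- b - 1))).
    by apply: cvgD; [exact: cvg_cst|exact: cvg_id].
  exact: cp.
- move=> x x0; have x10 : 0 < 1 + x by rewrite addr_gt0.
  have d1 := is_derive1_powR b x0.
  have d3 : is_derive x (1 : R) (fun x : R => 1 + x) 1.
    have -> : (fun x : R => 1 + x) = cst 1 + id by [].
    by apply: is_derive_eq; rewrite add0r.
  have d2 := @is_derive1_comp _ (fun y => y `^ (- b)) _ _ _ _ (is_derive1_powR (- b) x10) d3.
  have -> : F = (fun x => x `^ b) * ((fun y => y `^ (- b)) \o (fun x => 1 + x)) by [].
  apply: is_derive_eq; rewrite /GRing.scale/=.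
  have -> : x `^ b = x * x `^ (b - 1).
    by rewrite mulr_powRB1// ltW.
  have -> : (1 + x) `^ (- b) = (1 + x) * (1 + x) `^ (- b - 1).
    rewrite powRB; last by apply/implyP => _; rewrite gt_eqF.
    by rewrite powRr1 ?ltW//; field; rewrite gt_eqF.
  by ring.
- have h : ((n.+2%:R ^+ 2)^-1 : R) `^ b @[n --> \oo] --> 0.
    have /cvg_at_rightP H := powR_cvg0 b0; apply: (H (fun n => (n.+2%:R ^+ 2)^-1)); split => //.
  apply: (squeeze_cvgr _ (cvg_cst 0) h); apply: nearW => n.
  rewrite /F mulr_ge0 ?powR_ge0//= ler_piMr ?powR_ge0//.
  rewrite powRN invf_le1 ?powR_gt0 ?addr_gt0 ?invr_gt0 ?exprn_gt0//.
  rewrite -[leLHS](powRr0 (1 + (n.+2%:R ^+ 2)^-1)); apply: ler_powR; last exact: ltW.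
  by rewrite lerDl invr_ge0 exprn_ge0.
- have -> : (fun n => F (n.+1%:R ^+ 2)) = (fun n => (1 + (n.+1%:R ^+ 2 : R)^-1) `^ (- b)).
    apply/funext => n; rewrite /F.
    have x0 : 0 < n.+1%:R ^+ 2 :> R by rewrite exprn_gt0.
    move: (n.+1%:R ^+ 2 : R) x0 => x x0.
    have -> : 1 + x = x * (1 + x^-1) by field; rewrite gt_eqF.
    rewrite powRM ?addr_ge0 ?invr_ge0 ?ltW// mulrA -powRD ?addrN ?powRr0 ?mul1r//.
    by apply/implyP => _; rewrite gt_eqF.
  have h : (1 + (n.+1%:R ^+ 2 : R)^-1) @[n --> \oo] --> (1 + 0 : R).
    by apply: cvgD; [exact: cvg_cst|exact: cvg_Vbn].
  rewrite addr0 in h.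
  rewrite -[X in _ --> X](_ : 1 `^ (- b) = 1); last by rewrite powR1.
  have hc : {for (1 : R), continuous (fun y : R => y `^ (- b))}.
    apply: differentiable_continuous; apply/derivable1_diffP.
    by case: (is_derive1_powR (- b) (@ltr01 R)).
  exact: (continuous_cvg _ hc h).
Qed.

(** Integrability at 0 comes from b > 0, at infinity from the factor exp(- t),
    which is at most a constant times (1 + t)^(- b - 1). *)
Lemma gamma_weight_integral_lty b : 0 < b -> (\int[mu]_t (gamma_weight b 1 t)%:E < +oo)%E.
Proof.
move=> b0; pose m := Num.bound b.
pose C : R := (m.+1)`!%:R * expR 1 / b.
have C0 : 0 < C by rewrite divr_gt0// mulr_gt0 ?expR_gt0// ltr0n fact_gt0.
apply: (@le_lt_trans _ _ (C%:E *
 \int[mu]_x (if (0 < x)%R then b * x `^ (b - 1) * (1 + x) `^ (- b - 1) else 0)%:E)%E); last first.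
  by rewrite lte_mul_pinfty ?integral_dom// lee_fin ltW.
have mdom : measurable_fun setT (fun x : R => if (0 < x)%R then b * x `^ (b - 1) * (1 + x) `^ (- b - 1) else 0).
  apply: measurable_fun_ifT => //; first exact: measurable_fun_ltr.
  apply: measurable_funM; first exact: measurable_funM.
  apply: (@measurableT_comp _ _ _ _ _ _ (fun s : R => s `^ (- b - 1))) => //.
  exact: measurable_funD.
rewrite -ge0_integralZl//; last 3 first.
- exact/measurable_EFinP.
- move=> x _; rewrite lee_fin; case: ifP => // x0; rewrite !mulr_ge0 ?powR_ge0//; exact: ltW.
- by rewrite lee_fin ltW.
apply: ge0_le_integral => //.
- by move=> x _; rewrite lee_fin gamma_weight_ge0.
- by apply/measurable_EFinP; exact: measurable_gamma_weight.
- by apply: emeasurable_funM => //; exact/measurable_EFinP.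
move=> t _; rewrite -EFinM lee_fin /gamma_weight; case: ifP => [t0|_]; last by rewrite mulr0.
have t10 : 0 < 1 + t by rewrite addr_gt0.
rewrite mul1r expRD -powR_expR_ln//.
rewrite [leRHS](_ : _ = t `^ (b - 1) * ((m.+1)`!%:R * expR 1 * (1 + t) `^ (- b - 1))); last first.
  by rewrite /C; field; rewrite gt_eqF.
rewrite ler_wpM2l ?powR_ge0// -opprD powRN ler_pdivlMr ?powR_gt0//.
rewrite expRN mulrC ler_pdivrMr ?expR_gt0// -mulrA -expRD.
apply: (@le_trans _ _ ((1 + t) ^+ m.+1)).
  rewrite -[leRHS]powR_mulrn; last exact: ltW.
  apply: ler_powR; first by rewrite lerDl ltW.
  by rewrite -natr1 lerD2r; exact/ltW/archi_boundP/ltW.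
(* (1 + t)^(m + 1) / (m + 1)! is a term of the series of exp(1 + t). *)
have := expR_ge1Dxn m (ltW t10).
rewrite -lerBrDl => h; rewrite mulrC -ler_pdivrMr ?ltr0n ?fact_gt0//.
by apply: (le_trans h); rewrite gerBl.
Qed.

Definition gamma_integral b : R := \int[mu]_t gamma_weight b 1 t.

Lemma integral_gamma_weight b c : 0 < b -> 0 < c ->
  (\int[mu]_t (gamma_weight b c t)%:E = (gamma_integral b * c `^ (- b))%:E)%E.
Proof.
move=> b0 c0.
have E1 : (\int[mu]_t (gamma_weight b 1 t)%:E = (gamma_integral b)%:E)%E.
  rewrite /gamma_integral /Rintegral fineK// ge0_fin_numE ?gamma_weight_integral_lty//.
  by apply: integral_ge0 => t _; rewrite lee_fin gamma_weight_ge0.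
have mg (c' : R) : measurable_fun setT (fun t => (gamma_weight b c' t)%:E).
  by apply/measurable_EFinP; exact: measurable_gamma_weight.
move: E1; rewrite (@ge0_integral_affine _ c 0)//; last 2 first.
- by rewrite gt_eqF.
- by move=> x; rewrite lee_fin gamma_weight_ge0.
have cg t : gamma_weight b 1 (c * t + 0) = c `^ (b - 1) * gamma_weight b c t.
  rewrite /gamma_weight addr0 pmulr_rgt0//; case: ifP => t0; last by rewrite mulr0.
  rewrite (powR_expR_ln _ _ c0) -expRD lnM ?posrE//; congr expR; ring.
under eq_integral do rewrite cg EFinM.
rewrite ge0_integralZl//; last 2 first.
- by move=> x _; rewrite lee_fin gamma_weight_ge0.
- by rewrite lee_fin powR_ge0.
rewrite muleA -EFinM gtr0_norm// mulr_powRB1 ?ltW// => E.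
rewrite EFinM -E [RHS]muleAC -EFinM powRN mulfV ?mul1e//.
  by rewrite gt_eqF// powR_gt0.
exact: mg.
Qed.

(** The integrand is at least exp(- 2) / 2 on [1, 2]. *)
Lemma gamma_integral_gt0 b : 0 < b -> 0 < gamma_integral b.
Proof.
move=> b0; pose k : R := expR (- 2) / 2.
have k0 : 0 < k by rewrite divr_gt0// expR_gt0.
have := integral_gamma_weight b 1 b0 ltr01; rewrite powR1 mulr1 => E.
apply: (lt_le_trans k0); rewrite -lee_fin -E.
have -> : k%:E = (\int[mu]_x (k * \1_`[1, 2] x)%:E)%E.
  under eq_integral do rewrite EFinM.
  rewrite ge0_integralZl//; last 2 first.
  - exact/measurable_EFinP.
  - by rewrite lee_fin ltW.
  rewrite integral_indic//= setIT lebesgue_measure_itv/= lte_fin ltr1n.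
  by rewrite -EFinB -EFinM; congr EFin; ring.
apply: ge0_le_integral => //.
- by move=> x _; rewrite lee_fin mulr_ge0// ltW.
- by apply/measurable_EFinP; exact: measurable_funM.
- by apply/measurable_EFinP; exact: measurable_gamma_weight.
move=> x _; rewrite lee_fin indicE; case: (boolP (x \in _)) => [|_]; last first.
  by rewrite mulr0 gamma_weight_ge0.
rewrite inE/= in_itv/= mulr1 => /andP[x1 x2].
have x0 : 0 < x by apply: lt_le_trans x1.
rewrite /gamma_weight x0 expRD -powR_expR_ln// mulrC mul1r /k.
apply: ler_pM => //; rewrite ?expR_ge0 ?ler_expR ?lerN2//.
apply: (@le_trans _ _ (x `^ (-1))).
  by rewrite powR_inv1 ?(ltW x0)// lef_pV2 ?posrE.
by apply: ler_powR => //; rewrite -[leLHS]add0r lerD2r ltW.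
Qed.

(** The Gamma density with shape z.1 and rate l, at the point z.2. *)
Definition gamma_density (l : R) (z : R * R) : R := l `^ z.1 / gamma_integral z.1 * gamma_weight z.1 l z.2.

Lemma measurable_gamma_integral : measurable_fun setT (gamma_integral : R -> R).
Proof.
apply: (@measurable_fun_Rintegral2 _ _ _ _ _ mu (fun z : measurableTypeR R * R => gamma_weight z.2 1 z.1)).
by apply: measurable_gamma_weight.
Qed.

Lemma integral_gamma_density_exp (l s r : R) : 0 < l -> 0 < s -> 0 <= r ->
  (\int[mu]_t (gamma_density l (s, t) * expR (- (t * r)))%:E = ((l / (l + r)) `^ s)%:E)%E.
Proof.
move=> l0 s0 r0; have lr : 0 < l + r by rewrite ltr_wpDr.
under eq_integral.
  move=> t _; rewrite (_ : _ * _ = l `^ s / gamma_integral s * gamma_weight s (l + r) t); last first.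
    rewrite /gamma_density /gamma_weight/=; case: ifP => _; last by rewrite !mulr0 mul0r.
    by rewrite -[LHS]mulrA -expRD; congr (_ * expR _); ring.
  rewrite EFinM; over.
rewrite ge0_integralZl//; last 3 first.
- by apply/measurable_EFinP; exact: measurable_gamma_weight.
- by move=> x _; rewrite lee_fin gamma_weight_ge0.
- by rewrite lee_fin divr_ge0 ?powR_ge0// ltW// gamma_integral_gt0.
rewrite integral_gamma_weight// -EFinM; congr EFin.
rewrite powRM ?invr_ge0 ?ltW// -[(l + r)^-1]powR_inv1 ?(ltW lr)// -powRrM mulN1r.
by field; rewrite gt_eqF// gamma_integral_gt0.
Qed.

End gamma_integrals.

(** * Poisson and Bessel-type densities *)

Section bessel_family.
Context {R : realType} {n : nat}.
Let mu := @lebesgue_measure R.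

Lemma dotvv_ge0 (x : 'rV[R]_n) : 0 <= dotv x x.
Proof. by apply: sumr_ge0 => i _; rewrite -expr2 sqr_ge0. Qed.

Lemma enorm_ge0 (x : 'rV[R]_n) : 0 <= enorm x.
Proof. exact: sqrtr_ge0. Qed.

Lemma sqr_enorm (x : 'rV[R]_n) : enorm x ^+ 2 = dotv x x.
Proof. by rewrite /enorm sqr_sqrtr// dotvv_ge0. Qed.

Lemma density_family_ext {d} {Y : measurableType d} (D : set Y) q
    (m m' : Y -> 'rV[R]_n -> R) :
  (forall y, D y -> m y =1 m' y) -> density_family D q m -> density_family D q m'.
Proof.
move=> mm [mq H]; split => // y Dy; have [h1 h2 h3 h4] := H _ Dy; split => // xi.
by rewrite h4 mm.
Qed.

(** The Poisson kernel of the half-space at height z.1, as a mixture of heat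
    kernels. *)
Definition poisson (z : measurableTypeR R * 'rV[R]_n) : R :=
  mixture mu (subord z.1) (fun z => gaussn n z.1 z.2) z.2.

Lemma poisson_family : density_family [set t : measurableTypeR R | 0 < t]
  poisson (fun t xi => expR (- (t * enorm xi))).
Proof.
apply: (@density_family_ext _ _ _ _
  (fun t xi => \int[mu]_s (subord t s * expR (- (s * dotv xi xi))))).
  move=> t /= t0 xi; rewrite /Rintegral -sqr_enorm.
  by rewrite (integral_subord_exp t _ t0 (enorm_ge0 xi)).
apply: (density_family_mix mu [set s : measurableTypeR R | 0 < s] _ _ gaussian_family
  _ (fun z => subord z.1 z.2) measurable_subord).
move=> t /= t0; split => [s|s|].
- by apply: subord_ge0; exact: ltW.
- by rewrite /subord; case: ifP => //; rewrite eqxx.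
- have := integral_subord_exp t 0 t0 (lexx 0).
  rewrite mulr0 oppr0 expR0 => <-; apply: eq_integral => s _.
  by rewrite expr0n/= mulr0 oppr0 expR0 mulr1.
Qed.

(** A Gamma mixture of Poisson kernels, the analogue for |xi| of the Bessel
    potential densities. *)
Definition bessel (l : R) (z : measurableTypeR R * 'rV[R]_n) : R :=
  mixture mu (fun t => gamma_density l (z.1, t)) poisson z.2.

Lemma bessel_family (l : R) : 0 < l -> density_family [set s : measurableTypeR R | 0 < s]
  (bessel l) (fun s xi => (l / (l + enorm xi)) `^ s).
Proof.
move=> l0; apply: (@density_family_ext _ _ _ _
  (fun s xi => \int[mu]_t (gamma_density l (s, t) * expR (- (t * enorm xi))))).
  move=> s /= s0 xi; rewrite /Rintegral.
  by rewrite (integral_gamma_density_exp _ _ _ l0 s0 (enorm_ge0 xi)).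
apply: (density_family_mix mu [set s : measurableTypeR R | 0 < s] _ _ poisson_family
  _ (gamma_density l)).
  apply: measurable_funM.
    apply: measurable_funM.
      apply: (@measurableT_comp _ _ _ _ _ _ (fun s : R => l `^ s)) => //.
        exact: measurable_powRr.
    apply: measurable_funVr; apply: (@measurableT_comp _ _ _ _ _ _ (fun s : R => gamma_integral s)) => //.
    exact: measurable_gamma_integral.
  by apply: measurable_gamma_weight.
move=> s /= s0; split => [t|t|].
- by rewrite /gamma_density/= mulr_ge0 ?gamma_weight_ge0// divr_ge0 ?powR_ge0// ltW// gamma_integral_gt0.
- by rewrite /gamma_density/= /gamma_weight; case: ifP => // _; rewrite mulr0 eqxx.
- have := integral_gamma_density_exp _ _ _ l0 s0 (lexx 0).
  rewrite addr0 mulfV ?gt_eqF// powR1 => <-; apply: eq_integral => t _.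
  by rewrite mulr0 oppr0 expR0 mulr1.
Qed.

End bessel_family.

(** * The binomial series *)

Section binomial_series.
Context {R : realType}.
Implicit Types (a u x : R) (k n : nat).

(** The coefficient of x^k in (1 - x)^a, that is (-1)^k times the binomial
    coefficient of a over k. *)
Fixpoint bcoef k a : R :=
  if k is k'.+1 then bcoef k' a * (k'%:R - a) / k'.+1%:R else 1.

Lemma bcoefE k a : bcoef k.+1 a = bcoef k a * ((k%:R - a) / k.+1%:R).
Proof. by rewrite /= mulrA. Qed.

Definition bsum n a x : R := \sum_(k < n.+1) bcoef k a * x ^+ k.

Lemma bsumS n a x : bsum n.+1 a x = bsum n a x + bcoef n.+1 a * x ^+ n.+1.
Proof. by rewrite /bsum big_ord_recr. Qed.

Lemma bcoefS k a : k.+1%:R * bcoef k.+1 a = (k%:R - a) * bcoef k a.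
Proof. by rewrite /= mulrC divfK ?pnatr_eq0// mulrC. Qed.

Definition dbsum n a x : R := \sum_(k < n.+1) bcoef k a * (k%:R * x ^+ k.-1).

Lemma dbsumS n a x : dbsum n.+1 a x = dbsum n a x + bcoef n.+1 a * (n.+1%:R * x ^+ n).
Proof. by rewrite /dbsum big_ord_recr. Qed.

Lemma bsum_recl n a x : bsum n a x = 1 + \sum_(i < n) bcoef i.+1 a * x ^+ i.+1.
Proof. by rewrite /bsum big_ord_recl expr0 mulr1. Qed.

Lemma is_derive_bsum n a x : is_derive x (1 : R) (bsum n a) (dbsum n a x).
Proof.
elim: n => [|n ih].
  rewrite (_ : bsum 0 a = cst 1); last first.
    by apply/funext => y; rewrite /bsum big_ord1 /= expr0 mulr1.
  rewrite (_ : dbsum 0 a x = 0); first exact: is_derive_cst.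
  by rewrite /dbsum big_ord1 /= mul0r mulr0.
rewrite (_ : bsum n.+1 a = bsum n a + bcoef n.+1 a *: (@id R ^+ n.+1)); last first.
  by apply/funext => y; rewrite bsumS !fctE.
have dX : is_derive x (1 : R) (@id R ^+ n.+1) (n.+1%:R * x ^+ n).
  by apply: is_derive_eq; rewrite /GRing.scale/= mulr1 mulr_natl.
have := is_deriveD ih (is_deriveZ (bcoef n.+1 a) dX).
by rewrite dbsumS.
Qed.

(** The function y = (1 - x)^a solves (1 - x) y' + a y = 0; for its Taylor
    polynomials one monomial remains. *)
Lemma bsum_ode n a x :
  (1 - x) * dbsum n a x + a * bsum n a x = - (n.+1%:R * bcoef n.+1 a * x ^+ n).
Proof.
elim: n => [|n ih].
  by rewrite bcoefS /dbsum /bsum !big_ord1/=; ring.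
rewrite bsumS dbsumS bcoefS.
rewrite (_ : _ + _ = (1 - x) * dbsum n a x + a * bsum n a x + (1 - x) * (bcoef n.+1 a * (n.+1%:R * x ^+ n)) +
  a * (bcoef n.+1 a * x ^+ n.+1)); last by ring.
rewrite ih exprS; ring.
Qed.

Lemma bcoef_le0 k a : 0 <= a <= 1 -> bcoef k.+1 a <= 0.
Proof.
move=> /andP[a0 a1]; elim: k => [|k ih].
  by rewrite /= mul1r sub0r divr1 oppr_le0.
rewrite bcoefE mulr_le0_ge0//.
by rewrite divr_ge0// subr_ge0 (le_trans a1)// ler1n.
Qed.

Lemma bcoef_bound k a : 0 <= a <= 1 -> 0 <= - (k.+1%:R * bcoef k.+1 a) <= a.
Proof.
move=> a01; have /andP[a0 a1] := a01.
rewrite oppr_ge0 mulr_ge0_le0 ?bcoef_le0//=.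
elim: k => [|k ih]; first by rewrite /= mul1r sub0r divr1 mul1r opprK.
apply: le_trans ih; rewrite [in leLHS]bcoefS lerN2.
by apply: ler_wnM2r; [exact: bcoef_le0|rewrite gerBl].
Qed.

(** At x = 1 the differential equation of the Taylor polynomials evaluates
    them in closed form: a times the partial sum is - (n + 1) b_(n + 1). *)
Lemma bsum1_ge0 n a : 0 <= a <= 1 -> 0 <= bsum n a 1.
Proof.
move=> a01; have /andP[a0 a1] := a01.
have := bsum_ode n a 1; rewrite subrr mul0r add0r expr1n mulr1 => E.
have [a00|an0] := eqVneq a 0.
  rewrite bsum_recl big1 ?addr0// => i _.
  suff -> : bcoef i.+1 a = 0 by rewrite mul0r.
  elim: (i : nat) => [|k ih].
    by rewrite /= a00 subrr mulr0 mul0r.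
  by rewrite bcoefE ih !mul0r.
have ap : 0 < a by rewrite lt_neqAle eq_sym an0.
by rewrite -(pmulr_rge0 _ ap) E; have /andP[] := bcoef_bound n a a01.
Qed.

(** All coefficients but the first are nonpositive, and the partial sums at 1
    are nonnegative, so that the absolute values of the former sum to at most
    1.  The bound is uniform in a. *)
Lemma bcoef_abs_sum n a : 0 <= a <= 1 -> \sum_(k < n.+1) `|bcoef k a| <= 2.
Proof.
move=> a01; have := bsum1_ge0 n a a01; rewrite bsum_recl big_ord_recl normr1.
rewrite (eq_bigr (fun i : 'I_n => bcoef i.+1 a)); last by move=> i _; rewrite expr1n mulr1.
rewrite [in X in _ -> X](eq_bigr (fun i : 'I_n => - bcoef i.+1 a)); last first.
  by move=> i _; rewrite ler0_norm// bcoef_le0.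
rewrite sumrN; lra.
Qed.

(** The quotient H_n of the Taylor polynomial by (1 - x)^a has, by the
    differential equation, a derivative of size x^n; the mean value theorem on
    [0, u] bounds H_n(u) - H_n(0) = H_n(u) - 1. *)
Lemma cvg_bsum_lt1 a u : 0 <= a <= 1 -> 0 <= u < 1 -> bsum n a u @[n --> \oo] --> (1 - u) `^ a.
Proof.
move=> a01 /andP[u0 u1]; have /andP[a0 a1] := a01.
have [->|un0] := eqVneq u 0.
  rewrite subr0 powR1; apply: cvg_near_cst; apply: nearW => n.
  rewrite bsum_recl big1 ?addr0// => i _.
  by rewrite expr0n mulr0.
have up : 0 < u by rewrite lt_neqAle eq_sym un0.
have v0 : 0 < 1 - u by rewrite subr_gt0.
pose H n x := bsum n a x * (1 - x) `^ (- a).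
pose dH n x := - (n.+1%:R * bcoef n.+1 a * x ^+ n) * (1 - x) `^ (- a - 1).
have dHE n x : x < 1 -> is_derive x (1 : R) (H n) (dH n x).
  move=> x1; have v : 0 < 1 - x by rewrite subr_gt0.
  have d1 := is_derive_bsum n a x.
  have d3 : is_derive x (1 : R) (fun x : R => 1 - x) (-1).
    have -> : (fun x : R => 1 - x) = cst 1 - id by [].
    by apply: is_derive_eq; rewrite add0r.
  have d2 := @is_derive1_comp _ (fun y => y `^ (- a)) (fun x => 1 - x) _ _ _ (is_derive1_powR (- a) v) d3.
  have -> : H n = bsum n a * ((fun y => y `^ (- a)) \o (fun x => 1 - x)) by [].
  apply: is_derive_eq; rewrite /GRing.scale/= /dH -bsum_ode.
  have -> : (1 - x) `^ (- a) = (1 - x) * (1 - x) `^ (- a - 1).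
    rewrite powRB; last by apply/implyP => _; rewrite gt_eqF.
    by rewrite powRr1 ?ltW//; field; rewrite gt_eqF.
  by ring.
have HE n : 0 <= H n u - 1 <= u ^+ n * (1 - u) `^ (-2).
  have [||] := @MVT _ (H n) (dH n) _ _ up.
  - by move=> x; rewrite in_itv/= => /andP[x0 xu]; apply: dHE; exact: lt_trans xu u1.
  - apply: derivable_within_continuous => x; rewrite in_itv/= => /andP[x0 xu].
    by case: (dHE n x (le_lt_trans xu u1)).
  move=> x; rewrite in_itv/= => /andP[x0 xu].
  have -> : H n 0 = 1.
    rewrite /H subr0 powR1 mulr1 bsum_recl big1 ?addr0// => i _.
    by rewrite expr0n mulr0.
  move=> ->; have v : 0 < 1 - x by rewrite subr_gt0 (lt_trans xu).
  have /andP[c0 ca] := bcoef_bound n a a01.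
  rewrite /dH -mulNr subr0; apply/andP; split.
    by rewrite !mulr_ge0 ?powR_ge0 ?exprn_ge0// ltW.
  apply: (@le_trans _ _ (u ^+ n * (1 - u) `^ (-2) * 1)); last by rewrite mulr1.
  apply: ler_pM; [|exact: u0| |exact: ltW].
    by rewrite !mulr_ge0 ?powR_ge0 ?exprn_ge0// ltW.
  apply: ler_pM; rewrite ?powR_ge0//.
  + by rewrite mulr_ge0// exprn_ge0// ltW.
  + rewrite -[leRHS]mul1r; apply: ler_pM => //; [by rewrite exprn_ge0// ltW|exact: le_trans a1|].
    by rewrite lerXn2r ?nnegrE// ltW.
  + rewrite -opprD !powRN lef_pV2 ?posrE ?powR_gt0//.
    apply: (@le_trans _ _ ((1 - u) `^ (a + 1))).
      apply: ger_powR; first by rewrite v0/= gerBl.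
      by rewrite -[leRHS]/(1 + 1) lerD2r.
    apply: ge0_ler_powR; rewrite ?nnegrE ?(ltW v0) ?(ltW v)//; first by rewrite addr_ge0.
    by rewrite lerD2l lerN2 ltW.
have cH : H n u @[n --> \oo] --> (1 : R).
  have h0 : u ^+ n * (1 - u) `^ (-2) @[n --> \oo] --> (0 : R).
    rewrite -(mul0r ((1 - u) `^ (-2))); apply: cvgM; last exact: cvg_cst.
    by apply: cvg_expr; rewrite ger0_norm.
  rewrite -[X in _ --> X](subrK 1); rewrite -(_ : (fun n => H n u - 1 + 1) = (fun n => H n u)); last first.
    by apply/funext => n; rewrite subrK.
  apply: cvgD; last exact: cvg_cst.
  rewrite subrr; apply: (squeeze_cvgr _ (cvg_cst 0) h0); exact: nearW.
rewrite (_ : (fun n => bsum n a u) = (fun n => H n u * (1 - u) `^ a)); last first.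
  apply/funext => n; rewrite /H powRN mulfVK// gt_eqF// powR_gt0//.
rewrite -[X in _ --> X]mul1r; apply: cvgM => //; exact: cvg_cst.
Qed.

Lemma bsum_le n a u : 0 <= a <= 1 -> 0 <= u <= 1 -> bsum n a 1 <= bsum n a u.
Proof.
move=> a01 /andP[u0 u1]; rewrite !bsum_recl lerD2l.
apply: ler_sum => i _; rewrite expr1n mulr1.
by rewrite -[leLHS]mulr1 ler_wnM2l ?bcoef_le0// exprn_ile1.
Qed.

(** At the end point u = 1, where r = 0 in the application: the partial sums are
    nonincreasing in u, so that those at 1 lie between 0 and those at 1 - w,
    whose limit w^a is small. *)
Lemma cvg_bsum a u : 0 <= a <= 1 -> 0 <= u <= 1 -> bsum n a u @[n --> \oo] --> (1 - u) `^ a.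
Proof.
move=> a01 /andP[u0 u1]; have /andP[a0 a1] := a01.
have [un1|] := eqVneq u 1; last first.
  by move=> un1; apply: cvg_bsum_lt1 => //; rewrite u0 lt_neqAle un1.
rewrite un1 subrr.
have [a00|an0] := eqVneq a 0.
  rewrite a00 powRr0; apply: cvg_near_cst; apply: nearW => n.
  rewrite bsum_recl big1 ?addr0// => i _.
  suff -> : bcoef i.+1 0 = 0 by rewrite mul0r.
  elim: (i : nat) => [|k ih].
    by rewrite /= subrr mulr0 mul0r.
  by rewrite bcoefE ih !mul0r.
have ap : 0 < a by rewrite lt_neqAle eq_sym an0.
rewrite powR0//; apply/cvgr0Pnorm_lt => e e0.
pose w : R := Num.min 1 ((e / 2) `^ a^-1).
have w0 : 0 < w by rewrite lt_min ltr01 powR_gt0// divr_gt0.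
have w1 : w <= 1 by rewrite ge_min lexx.
have wa : w `^ a <= e / 2.
  apply: (@le_trans _ _ (((e / 2) `^ a^-1) `^ a)).
    by apply: ge0_ler_powR; rewrite ?nnegrE ?powR_ge0 ?(ltW w0)// ge_min lexx orbT.
  by rewrite -powRrM mulVf// powRr1// divr_ge0// ltW.
have v01 : 0 <= 1 - w < 1 by rewrite subr_ge0 w1 gtrBl w0.
have := cvg_bsum_lt1 a (1 - w) a01 v01; rewrite opprB addrCA subrr addr0.
move=> /cvgrPdist_lt /(_ (e / 2)) h.
have e20 : 0 < e / 2 by rewrite divr_gt0.
near=> n.
have hn : `|w `^ a - bsum n a (1 - w)| < e / 2 by near: n; exact: h.
rewrite ger0_norm ?bsum1_ge0//.
apply: (le_lt_trans (bsum_le n a (1 - w) a01 _)).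
  by have /andP[-> /ltW ->] := v01.
rewrite -(subrKC (w `^ a) (bsum n a (1 - w))) [e]splitr.
apply: ler_ltD => //; apply: le_lt_trans hn; rewrite distrC ler_norm.
Unshelve. all: by end_near. Qed.

Lemma bcoef_series_le a : 0 <= a <= 1 -> (\sum_(k <oo) `|bcoef k a|%:E <= 2%:E)%E.
Proof.
move=> a01; apply: lime_le; first by apply: is_cvg_nneseries => n _ _; rewrite lee_fin.
apply: nearW => -[|n]; first by rewrite big_geq// lee_fin.
by rewrite big_mkord sumEFin lee_fin bcoef_abs_sum.
Qed.

End binomial_series.

Section nat_line_measure.
Context {R : realType}.

(** Named copies of the counting measure on nat and of its product with
    Lebesgue measure, which carry the sigma-finite structure required by the
    Fubini theorems. *)
Definition natcount : set nat -> \bar R := counting.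
HB.instance Definition _ := Measure.copy natcount (@counting nat R).
HB.instance Definition _ := Measure_isSigmaFinite.Build _ _ _ natcount
  (sigma_finite_counting R).

Definition nat_line : set (nat * measurableTypeR R) -> \bar R :=
  product_measure1 natcount (@lebesgue_measure R).
HB.instance Definition _ := Measure.copy nat_line
  (product_measure1 natcount (@lebesgue_measure R)).

Let sigma_finite_nat_line : sigma_finite setT nat_line.
Proof.
have /sigma_finiteP[F [TF ndF Foo]] := sigma_finiteT natcount.
have /sigma_finiteP[G [TG ndG Goo]] := sigma_finiteT (@lebesgue_measure R).
exists (fun n => F n `*` G n).
  apply/seteqP; split => // -[x y] _.
  have [m _ Fx] : (\bigcup_i F i) x by rewrite -TF.
  have [k _ Gy] : (\bigcup_i G i) y by rewrite -TG.
  exists (maxn m k) => //; split => /=.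
    by have /subsetPset := ndF _ _ (leq_maxl m k); apply.
  by have /subsetPset := ndG _ _ (leq_maxr m k); apply.
move=> k; have [? ?] := Foo k; have [? ?] := Goo k.
split; first exact: measurableX.
by rewrite /nat_line product_measure1E// lte_mul_pinfty// ge0_fin_numE.
Qed.

HB.instance Definition _ := Measure_isSigmaFinite.Build _ _ _ nat_line
  sigma_finite_nat_line.

End nat_line_measure.

Section binomial_count.
Context {R : realType}.
Implicit Types (a u : R).

Lemma natcount_integralE (f : nat -> R) : (\sum_(k <oo) `|f k|%:E < +oo)%E ->
  (@natcount R).-integrable setT (EFin \o f) /\
  (\int[@natcount R]_k (f k)%:E = \sum_(k <oo) (f k)%:E)%E.
Proof.
move=> foo; split.
  apply/integrableP; split => //.
  have -> : (\int[@natcount R]_k `|(EFin \o f) k| = \sum_(k <oo) `|f k|%:E)%E; last by [].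
  by apply: (@ge0_integral_count R (fun k => `|f k|%:E)) => k; rewrite lee_fin.
apply: (@integral_count R (fun k => (f k)%:E)).
by rewrite /summable -nneseries_esumT.
Qed.

Lemma bcoef_pow_summable a u : 0 <= a <= 1 -> 0 <= u <= 1 ->
  (\sum_(k <oo) `|bcoef k a * u ^+ k|%:E < +oo)%E.
Proof.
move=> a01 /andP[u0 u1]; apply: (@le_lt_trans _ _ (\sum_(k <oo) `|bcoef k a|%:E)%E).
  apply: lee_nneseries => k _; first by move=> _; rewrite lee_fin.
  rewrite lee_fin normrM ler_piMr//.
  by rewrite normrX exprn_ile1// ger0_norm.
by apply: le_lt_trans (bcoef_series_le _ a01) _; rewrite ltry.
Qed.

Lemma integrable_bcoef a u : 0 <= a <= 1 -> 0 <= u <= 1 ->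
  (@natcount R).-integrable setT (fun k => (bcoef k a * u ^+ k)%:E).
Proof. by move=> a01 u01; have [] := natcount_integralE _ (bcoef_pow_summable _ _ a01 u01). Qed.

Lemma integral_bcoef a u : 0 <= a <= 1 -> 0 <= u <= 1 ->
  \int[@natcount R]_k (bcoef k a * u ^+ k) = (1 - u) `^ a.
Proof.
move=> a01 u01; rewrite /Rintegral.
have [_ ->] := natcount_integralE _ (bcoef_pow_summable _ _ a01 u01).
suff -> : (\sum_(k <oo) (bcoef k a * u ^+ k)%:E = ((1 - u) `^ a)%:E)%E by [].
apply/cvg_lim => //; rewrite -cvg_shiftS.
under eq_fun do rewrite /= big_mkord sumEFin.
by apply: cvg_EFin; [exact: nearW|exact: cvg_bsum].
Qed.

End binomial_count.

(** * The remainder symbol as a mixture *)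

Lemma measurable_fun_nat_pair {d1 d2} {T : measurableType d1} {U : measurableType d2}
    (f : nat * T -> U) : (forall k, measurable_fun setT (fun t => f (k, t))) ->
  measurable_fun setT f.
Proof.
move=> mf _ B mB; rewrite setTI.
rewrite (_ : f @^-1` B = \bigcup_k ([set k] `*` ((fun t => f (k, t)) @^-1` B))).
  apply: bigcupT_measurable => k; apply: measurableX => //.
  by rewrite -[X in measurable X]setTI; exact: mf.
apply/seteqP; split => [[k t]/= Bf|[k t]/= [_ _ [/= -> //]]].
by exists k.
Qed.

Section symbol_mixture.
Context {R : realType}.
Variables (beta gam l : R).
Hypothesis beta0 : 0 < beta.
Hypothesis gam01 : 0 <= gam <= 1.
Hypothesis l1 : 1 < l.
Let mu := @lebesgue_measure R.
Let Y := (nat * measurableTypeR R)%type.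

Let l0 : 0 < l. Proof. exact: lt_trans l1. Qed.
Let ln_l0 : 0 < ln l. Proof. exact: ln_gt0. Qed.

(** The coefficient of u^k in (1 - u)^gam - 1_(t <= gam) (1 - u)^(gam - t). *)
Definition bcoef_diff k (t : R) : R := bcoef k gam - (if t <= gam then bcoef k (gam - t) else 0).

(** For y = (k, t), the remainder symbol is the superposition of the powers
    u^(k + t - gam), u = l / (l + r), with these weights. *)
Definition mix_weight (y : Y) : R :=
  (gamma_integral beta)^-1 * l `^ gam * gamma_weight beta (ln l) y.2 * bcoef_diff y.1 y.2.

Definition mix_exponent (y : Y) : R := y.1%:R + y.2 - gam.

(** For k > 0 because gam <= 1; for k = 0 because the weight vanishes unless
    t > gam. *)
Lemma mix_exponent_gt0 y : mix_weight y != 0 -> 0 < mix_exponent y.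
Proof.
case: y => k t; rewrite /mix_weight /mix_exponent/= mulf_eq0 negb_or => /andP[+ B0].
rewrite mulf_eq0 negb_or => /andP[_]; rewrite /gamma_weight; case: ifPn; last by rewrite eqxx.
move=> t0 _; have /andP[g0 g1] := gam01.
case: k B0 => [|k _]; last first.
  by have : 0 <= k%:R :> R by []; rewrite -natr1; lra.
rewrite /bcoef_diff/=; case: (leP t gam) => [_|tg _]; first by rewrite subrr eqxx.
by rewrite add0r subr_gt0.
Qed.

Lemma measurable_bcoef k : measurable_fun setT (bcoef k : R -> R).
Proof.
elim: k => [|k ih]; first exact: measurable_cst.
rewrite (_ : bcoef k.+1 = fun a => bcoef k a * ((k%:R - a) / k.+1%:R)).
  by apply: measurable_funM => //; apply: measurable_funM => //; exact: measurable_funB.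
by apply/funext => a; rewrite bcoefE.
Qed.

Lemma measurable_bcoef_diff k : measurable_fun setT (bcoef_diff k).
Proof.
apply: measurable_funB => //; apply: measurable_fun_ifT => //.
  exact: measurable_fun_ler.
apply: (measurableT_comp (measurable_bcoef k)); exact: measurable_funB.
Qed.

Lemma measurable_mix_weight : measurable_fun setT mix_weight.
Proof.
apply: measurable_fun_nat_pair => k.
have : measurable_fun setT (fun t : R => (gamma_integral beta)^-1 * l `^ gam * gamma_weight beta (ln l) t * bcoef_diff k t).
  apply: measurable_funM; last exact: measurable_bcoef_diff.
  by apply: measurable_funM => //; apply: measurable_gamma_weight.
by [].
Qed.

Lemma measurable_mix_exponent : measurable_fun setT (mix_exponent : Y -> measurableTypeR R).
Proof.
apply: measurable_fun_nat_pair => k.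
have : measurable_fun setT (fun t : R => k%:R + t - gam).
  by apply: measurable_funB => //; exact: measurable_funD.
by [].
Qed.

Let gsub t : 0 < t -> t <= gam -> 0 <= gam - t <= 1.
Proof.
by move=> t0 tg; have /andP[g0 g1] := gam01; rewrite subr_ge0 tg/= lerBlDr (le_trans g1)// lerDl ltW.
Qed.

Let bcoef_diff_series t : 0 < t -> (\sum_(k <oo) `|bcoef_diff k t|%:E <= 4%:E)%E.
Proof.
move=> t0.
apply: (@le_trans _ _ (\sum_(k <oo) (`|bcoef k gam|%:E + `|if t <= gam then bcoef k (gam - t) else 0|%:E))%E).
  apply: lee_nneseries => k _; first by move=> _; rewrite lee_fin.
  by rewrite -EFinD lee_fin /bcoef_diff ler_normB.
rewrite nneseriesD; [|by move=> k _; rewrite lee_fin..].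
rewrite (_ : 4%:E = 2%:E + 2%:E)%E; last by rewrite -EFinD; congr EFin; ring.
apply: leeD; first exact: bcoef_series_le.
case: (leP t gam) => tg; first by apply: bcoef_series_le; exact: gsub.
by rewrite eseries0// => k _ _; rewrite normr0.
Qed.

Let pref t : R := (gamma_integral beta)^-1 * l `^ gam * gamma_weight beta (ln l) t.

Let pref_ge0 t : 0 <= pref t.
Proof.
by rewrite /pref mulr_ge0 ?gamma_weight_ge0// mulr_ge0 ?powR_ge0// invr_ge0 ltW// gamma_integral_gt0.
Qed.

Let pref0 t : t <= 0 -> pref t = 0.
Proof. by move=> t0; rewrite /pref /gamma_weight ltNge t0 mulr0. Qed.

Let mpref : measurable_fun setT pref.
Proof. by apply: measurable_funM => //; apply: measurable_gamma_weight. Qed.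

Let integral_pref_lty : (\int[mu]_t (4 * pref t)%:E < +oo)%E.
Proof.
under eq_integral do rewrite /pref mulrA EFinM.
rewrite ge0_integralZl//; last 3 first.
- by apply/measurable_EFinP; exact: measurable_gamma_weight.
- by move=> t _; rewrite lee_fin gamma_weight_ge0.
- by rewrite lee_fin !mulr_ge0 ?powR_ge0// invr_ge0 ltW// gamma_integral_gt0.
by rewrite integral_gamma_weight// -EFinM ltry.
Qed.

(** Summing over k first leaves at most 4 times a Gamma integral with rate
    ln l, which converges as l > 1. *)
Lemma mix_weight_integrable : (@nat_line R).-integrable setT (EFin \o mix_weight).
Proof.
have mW : measurable_fun setT (EFin \o mix_weight) by apply/measurable_EFinP; exact: measurable_mix_weight.
apply/(@integrable21ltyP _ _ _ _ R (@natcount R) mu) => //.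
apply: le_lt_trans integral_pref_lty.
apply: ge0_le_integral => //.
- by move=> t _; exact: integral_ge0.
- apply: (@measurable_fun_fubini_tonelli_G _ _ _ _ R (@natcount R) (fun y => `|mix_weight y|%:E)) => //.
  by apply/measurable_EFinP; apply: measurableT_comp => //; exact: measurable_mix_weight.
- by apply/measurable_EFinP; exact: measurable_funM.
move=> t _.
have -> : (\int[@natcount R]_k `|(EFin \o mix_weight) (k, t)| = \sum_(k <oo) `|mix_weight (k, t)|%:E)%E.
  by apply: (@ge0_integral_count R (fun k => `|mix_weight (k, t)|%:E)) => k; rewrite lee_fin.
have [t0|t0] := leP t 0.
  rewrite pref0// mulr0 eseries0// => k _ _.
  by rewrite /mix_weight/= -/(pref t) pref0// mul0r normr0.
under eq_eseriesr do rewrite /mix_weight/= -/(pref t) normrM (ger0_norm (pref_ge0 t)) EFinM.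
rewrite nneseriesZl; last by move=> k _; rewrite lee_fin.
rewrite [in leRHS]mulrC [leRHS]EFinM; apply: lee_wpmul2l; first by rewrite lee_fin.
exact: bcoef_diff_series.
Qed.

(** For fixed t > 0, the sum over k is, by the binomial series, the difference
    A t - B t below; A is the integrand of the Gamma integral of
    ln (l + r)^(- beta), and B that of the subtracted integral. *)
Lemma mixture_symbol (r : R) : 0 <= r ->
  \int[@nat_line R]_y (mix_weight y * (l / (l + r)) `^ (mix_exponent y)) =
  r `^ gam / ln (l + r) `^ beta -
  (gamma_integral beta)^-1 * \int[mu]_(t in `[0, gam]) (t `^ (beta - 1) * r `^ (gam - t)).
Proof.
move=> r0; have lr0 : 0 < l + r by rewrite ltr_wpDr.
have lr1 : 1 < l + r by rewrite (lt_le_trans l1)// lerDl.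
have lnlr0 : 0 < ln (l + r) by exact: ln_gt0.
pose u := l / (l + r).
have u0 : 0 < u by rewrite divr_gt0.
have u1 : u <= 1 by rewrite ler_pdivrMr// mul1r lerDl.
have u01 : 0 <= u <= 1 by rewrite u1 ltW.
have Gn0 : gamma_integral beta != 0 by rewrite gt_eqF// gamma_integral_gt0.
have [g0 g1] := andP gam01.
pose f (y : Y) := mix_weight y * u `^ (mix_exponent y).
have mus : measurable_fun setT (fun y : Y => u `^ (mix_exponent y)).
  apply: (@measurableT_comp _ _ _ _ _ _ (fun s : R => u `^ s)) => //; first exact: measurable_powRr.
  exact: measurable_mix_exponent.
have if' : (@nat_line R).-integrable setT (EFin \o f).
  apply: le_integrable mix_weight_integrable => //.
    by apply/measurable_EFinP; apply: measurable_funM => //; exact: measurable_mix_weight.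
  move=> y _; rewrite lee_fin /f.
  have [->|Wy] := eqVneq (mix_weight y) 0; first by rewrite mul0r.
  rewrite normrM ler_piMr// ger0_norm ?powR_ge0//.
  rewrite -[leRHS](powRr0 u); apply: ger_powR; first by rewrite u0.
  by apply/ltW/mix_exponent_gt0.
pose A t : R := (gamma_integral beta)^-1 * r `^ gam * gamma_weight beta (ln (l + r)) t.
pose B0 t : R := if 0 < t <= gam then t `^ (beta - 1) * r `^ (gam - t) else 0.
pose B t : R := (gamma_integral beta)^-1 * B0 t.
have inner t : (\int[@natcount R]_k (f (k, t))%:E = (A t - B t)%:E)%E.
  have [t0|t0] := leP t 0.
    rewrite (eq_integral (fun=> 0%E)); last first.
      by move=> k _; rewrite /f /mix_weight/= -/(pref t) pref0// !mul0r.
    by rewrite integral0 /A /B /B0 /gamma_weight ltNge t0/= !mulr0 subrr.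
  have ib1 := integrable_bcoef _ _ gam01 u01.
  have ib2 : (@natcount R).-integrable setT
      (fun k => ((if t <= gam then bcoef k (gam - t) else 0) * u ^+ k)%:E).
    case: (leP t gam) => tg; first by apply: integrable_bcoef => //; exact: gsub.
    by under eq_fun do rewrite mul0r; exact: integrable0.
  have ib : (@natcount R).-integrable setT (fun k => (bcoef_diff k t * u ^+ k)%:E).
    have := integrableB measurableT ib1 ib2; apply: eq_integrable => // k _ /=.
    by rewrite -EFinB -mulrBl.
  have fE k : f (k, t) = pref t * u `^ (t - gam) * (bcoef_diff k t * u ^+ k).
    rewrite /f /mix_weight /mix_exponent/= -/(pref t) -addrA [in LHS]powRD; last by apply/implyP => _; rewrite gt_eqF.
    by rewrite powR_mulrn ?(ltW u0)//; ring.
  under eq_integral do rewrite fE EFinM.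
  rewrite (integralZl measurableT ib).
  rewrite EFin_Rintegral// -EFinM; congr EFin.
  have -> : \int[@natcount R]_k (bcoef_diff k t * u ^+ k) =
      (1 - u) `^ gam - (if t <= gam then (1 - u) `^ (gam - t) else 0).
    rewrite -(integral_bcoef _ _ gam01 u01).
    under eq_Rintegral do rewrite mulrBl.
    rewrite RintegralB//; congr (_ - _).
    case: (leP t gam) => tg; first by apply: integral_bcoef => //; exact: gsub.
    by under eq_Rintegral do rewrite mul0r; rewrite /Rintegral integral0.
  have E1 : 1 - u = r / (l + r) by rewrite /u; field; rewrite gt_eqF.
  have E2 a : (r / (l + r)) `^ a = r `^ a * expR (- (a * ln (l + r))).
    by rewrite powRM ?invr_ge0 ?(ltW lr0)// (powR_expR_ln a (l + r)^-1) ?invr_gt0// lnV ?posrE// mulrN.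
  have E3 : u `^ (t - gam) = expR ((t - gam) * ln l) * expR (- ((t - gam) * ln (l + r))).
    by rewrite powR_expR_ln// lnM ?posrE ?invr_gt0// lnV ?posrE// -expRD; congr expR; ring.
  rewrite E1 !E2 E3 /pref /A /B /B0 /gamma_weight t0 /= (powR_expR_ln gam l)//.
  rewrite (powR_expR_ln (beta - 1) t)//.
  pose Lr := ln (l + r); pose X := expR ((beta - 1) * ln t).
  have M : expR (gam * ln l) * expR ((beta - 1) * ln t - ln l * t) *
      (expR ((t - gam) * ln l) * expR (- ((t - gam) * Lr))) = X * expR ((gam - t) * Lr).
    by rewrite -!expRD; congr expR; ring.
  have M1 : expR ((gam - t) * Lr) * expR (- (gam * Lr)) = expR (- (Lr * t)).
    by rewrite -expRD; congr expR; ring.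
  have M2 : expR ((gam - t) * Lr) * expR (- ((gam - t) * Lr)) = 1.
    by rewrite -expRD addrN expR0.
  rewrite [in RHS]expRD -/X -/Lr -M1.
  transitivity ((gamma_integral beta)^-1 * (X * expR ((gam - t) * Lr)) * (r `^ gam * expR (- (gam * Lr)) -
      (if t <= gam then r `^ (gam - t) * expR (- ((gam - t) * Lr)) else 0))).
    by rewrite -M !mulrA.
  case: ifP => _; last by ring.
  transitivity ((gamma_integral beta)^-1 * X * r `^ gam * (expR ((gam - t) * Lr) * expR (- (gam * Lr))) -
     (gamma_integral beta)^-1 * X * r `^ (gam - t) * (expR ((gam - t) * Lr) * expR (- ((gam - t) * Lr)))).
    by ring.
  by rewrite M2; ring.
have iA : mu.-integrable setT (EFin \o A).
  apply/integrableP; split.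
    apply/measurable_EFinP; apply: measurable_funM => //; exact: measurable_gamma_weight.
  have A0 t : 0 <= A t.
    by rewrite /A mulr_ge0 ?gamma_weight_ge0// mulr_ge0 ?powR_ge0// invr_ge0 ltW// gamma_integral_gt0.
  under eq_integral do rewrite /= ger0_norm//.
  rewrite /A; under eq_integral do rewrite EFinM.
  rewrite ge0_integralZl//; last 3 first.
  - by apply/measurable_EFinP; exact: measurable_gamma_weight.
  - by move=> t _; rewrite lee_fin gamma_weight_ge0.
  - by rewrite lee_fin mulr_ge0 ?powR_ge0// invr_ge0 ltW// gamma_integral_gt0.
  by rewrite integral_gamma_weight// -EFinM ltry.
have mB : measurable_fun setT B0.
  apply: measurable_fun_ifT => //.
    by apply: measurable_and; [exact: measurable_fun_ltr|exact: measurable_fun_ler].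
  apply: measurable_funM => //.
  apply: (@measurableT_comp _ _ _ _ _ _ (fun s : R => r `^ s)) => //; first exact: measurable_powRr.
  exact: measurable_funB.
(* On ]0, gam] the factor r^(gam - t) is at most 1 + r, so that B0 is dominated
   by a Gamma weight; this includes r = 0, where r^0 = 1. *)
have iB0 : mu.-integrable setT (EFin \o B0).
  have ig1 : mu.-integrable setT (fun t => (gamma_weight beta 1 t)%:E).
    apply/integrableP; split; first by apply/measurable_EFinP; exact: measurable_gamma_weight.
    under eq_integral do rewrite /= ger0_norm ?gamma_weight_ge0//.
    exact: gamma_weight_integral_lty.
  apply: le_integrable (integrableZl measurableT (expR 1 * (1 + r)) ig1) => //.
    exact/measurable_EFinP.
  move=> t _; rewrite -EFinM lee_fin /B0 /gamma_weight; case: ifPn => [/andP[t0 tg]|_]; last first.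
    by rewrite normr0.
  rewrite t0 !ger0_norm; last 2 first.
  - by rewrite mulr_ge0 ?expR_ge0// mulr_ge0 ?expR_ge0// addr_ge0.
  - by rewrite mulr_ge0 ?powR_ge0.
  rewrite (powR_expR_ln (beta - 1) t)// mul1r expRD.
  have -> : expR 1 * (1 + r) * (expR ((beta - 1) * ln t) * expR (- t)) =
    expR ((beta - 1) * ln t) * ((expR 1 * expR (- t)) * (1 + r)) by ring.
  apply: ler_wpM2l; first exact: expR_ge0.
  rewrite -expRD -[leLHS]mul1r; apply: ler_pM; rewrite ?powR_ge0//.
    by rewrite -[leLHS]expR0 ler_expR subr_ge0 (le_trans tg).
  have g0' : 0 <= gam - t by rewrite subr_ge0.
  apply: (@le_trans _ _ ((1 + r) `^ (gam - t))).
    by apply: ge0_ler_powR; [|rewrite nnegrE|rewrite nnegrE addr_ge0|rewrite lerDr].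
  rewrite -[leRHS]powRr1 ?addr_ge0//; apply: ler_powR; first by rewrite lerDl.
  by have /andP[] := gsub _ t0 tg.
have iB : mu.-integrable setT (EFin \o B).
  exact: (integrableZl measurableT (gamma_integral beta)^-1 iB0).
have -> : \int[@nat_line R]_y f y = \int[mu]_t (A t - B t).
  rewrite /Rintegral -(integral21_prod_meas1 if'); congr fine.
  by apply: eq_integral => t _; rewrite -inner.
rewrite RintegralB//; congr (_ - _).
  rewrite /A {1}/Rintegral; under eq_integral do rewrite EFinM.
  rewrite ge0_integralZl//; last 3 first.
  - by apply/measurable_EFinP; exact: measurable_gamma_weight.
  - by move=> t _; rewrite lee_fin gamma_weight_ge0.
  - by rewrite lee_fin mulr_ge0 ?powR_ge0// invr_ge0 ltW// gamma_integral_gt0.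
  rewrite integral_gamma_weight// -EFinM /= powRN.
  by field; rewrite Gn0 gt_eqF// powR_gt0.
rewrite RintegralZl//; congr (_ * _).
have B0E : EFin \o B0 = (fun t => (t `^ (beta - 1) * r `^ (gam - t))%:E) \_ `]0%R, gam].
  apply/funext => t; rewrite patchE /B0 /=.
  have -> : (t \in `]0%R, gam]%classic) = (0 < t <= gam).
    by apply/idP/idP; rewrite inE/= in_itv/=.
  by case: ifP.
rewrite -Rintegral_itv_obnd_cbnd; last first.
  apply/(@integrable_mkcond _ _ _ mu `]0%R, gam]%classic (fun t => (t `^ (beta - 1) * r `^ (gam - t))%:E)).
    exact: measurable_itv.
  by rewrite -B0E.
by rewrite /Rintegral [in RHS]integral_mkcond -B0E.
Qed.

End symbol_mixture.

(** * Smoothness away from the origin *)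

Section truncated_laplace.
Context {R : realType}.
Let mu := @lebesgue_measure R.
Variable gam : R.
Hypothesis gam0 : 0 <= gam.

(** The integral of t^(b - 1) r^(- t) over [0, gam], as a function of y = ln r.
    Differentiation in y shifts b to b + 1, so that b ranges over all positive
    reals although only b = beta occurs in the symbol. *)
Definition truncated_laplace (b y : R) : R := \int[mu]_(t in `[0, gam]) (t `^ (b - 1) * expR (- (t * y))).

Let expR_bound y t : 0 <= t <= gam -> expR (- (t * y)) <= expR (gam * `|y|).
Proof.
move=> /andP[t0 tg]; rewrite ler_expR -mulrN.
apply: (@le_trans _ _ (t * `|y|)).
  by apply: ler_wpM2l => //; rewrite -normrN ler_norm.
by apply: ler_wpM2r.
Qed.

Let finI : (mu `[0%R, gam]%classic < +oo)%E.
Proof. by rewrite /mu lebesgue_measure_itv/=; case: ifP => _; rewrite -?EFinB ltry. Qed.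

Let icst (c : R) : mu.-integrable `[0, gam]%classic (fun=> c%:E).
Proof.
apply: (@measurable_bounded_integrable _ _ _ mu (cst c)) => //; exact: bounded_cst.
Qed.

Let mint b y : measurable_fun (`[0, gam]%classic : set R) (fun t : R => t `^ (b - 1) * expR (- (t * y))).
Proof.
apply: measurable_funTS; apply: measurable_funM => //.
by apply: measurableT_comp => //; apply: measurableT_comp => //; exact: measurable_funM.
Qed.

Lemma truncated_laplace_integrable b y : 0 < b ->
  mu.-integrable `[0, gam]%classic (fun t => (t `^ (b - 1) * expR (- (t * y)))%:E).
Proof.
move=> b0.
have ig1 : mu.-integrable setT (fun t => (gamma_weight b 1 t)%:E).
  apply/integrableP; split; first by apply/measurable_EFinP; exact: measurable_gamma_weight.
  under eq_integral do rewrite /= ger0_norm ?gamma_weight_ge0//.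
  exact: gamma_weight_integral_lty.
have ig : mu.-integrable `[0, gam]%classic (fun t => (gamma_weight b 1 t)%:E).
  exact: integrableS ig1.
have mi : measurable (`[0, gam]%classic : set (measurableTypeR R)) by exact: measurable_itv.
have is' := integrableD mi ig (icst 1).
apply: le_integrable (integrableZl mi (expR gam * expR (gam * `|y|)) is') => //.
  by apply/measurable_EFinP; exact: mint.
move=> t /=; rewrite in_itv/= => t0g; have /andP[t0 tg] := t0g.
rewrite lee_fin [leLHS]ger0_norm ?mulr_ge0 ?powR_ge0 ?expR_ge0//.
rewrite [leRHS]ger0_norm; last by rewrite !mulr_ge0 ?expR_ge0// addr_ge0// gamma_weight_ge0.
rewrite -[leRHS]mulrA [leRHS]mulrCA [leRHS]mulrC.
apply: ler_pM; rewrite ?powR_ge0 ?expR_ge0//; last exact: expR_bound.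
have e1 : 1 <= expR gam by rewrite -[leLHS]expR0 ler_expR.
have [->|tn0] := eqVneq t 0.
  rewrite /gamma_weight ltxx add0r mulr1 (le_trans _ e1)//.
  by rewrite /powR eqxx; case: (_ == _); rewrite ?ler01.
have tp : 0 < t by rewrite lt_neqAle eq_sym tn0.
rewrite mulrDr mulr1 ler_wpDr ?expR_ge0// /gamma_weight tp mul1r expRD -powR_expR_ln//.
rewrite mulrCA ler_peMr ?powR_ge0//.
by rewrite -expRD -[leLHS]expR0 ler_expR subr_ge0.
Qed.

Lemma is_derive_truncated_laplace b y : 0 < b -> is_derive y (1 : R) (truncated_laplace b) (- truncated_laplace (b + 1) y).
Proof.
move=> b0.
have -> : - truncated_laplace (b + 1) y = \int[mu]_(t in `[0, gam]) (- (t `^ b * expR (- (t * y)))).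
  rewrite -mulN1r -RintegralZl//; last by apply: truncated_laplace_integrable; rewrite addr_gt0.
  by apply: eq_Rintegral => t _; rewrite mulN1r addrK.
apply: (@is_derive_Rintegral _ _ _ mu `[0, gam]%classic (fun y t => t `^ (b - 1) * expR (- (t * y)))
   (fun y t => - (t `^ b * expR (- (t * y)))) (fun=> gam `^ b * expR (gam * (`|y| + 1))) y 1) => //.
- by move=> x _; exact: truncated_laplace_integrable.
- move=> x t _ /=; rewrite in_itv/= => /andP[t0 tg].
  have d : is_derive x (1 : R) (fun x : R => - (t * x)) (- t).
    have -> : (fun x : R => - (t * x)) = (- t) *: id by apply/funext => z; rewrite !fctE /GRing.scale/= mulNr.
    by apply: is_derive_eq; rewrite /GRing.scale/= mulr1.
  have d2 := @is_derive1_comp _ expR (fun x : R => - (t * x)) _ _ _ (is_derive_expR _) d.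
  have -> : (fun y : R => t `^ (b - 1) * expR (- (t * y))) = t `^ (b - 1) *: (expR \o (fun x : R => - (t * x))) by [].
  apply: is_derive_eq; rewrite /GRing.scale/= -(mulr_powRB1 t0 b0); ring.
- exact: icst.
- move=> x t xy /=; rewrite in_itv/= => t0g; have /andP[t0 tg] := t0g.
  rewrite normrN ger0_norm ?mulr_ge0 ?powR_ge0 ?expR_ge0//.
  apply: ler_pM; rewrite ?powR_ge0 ?expR_ge0//.
    by apply: ge0_ler_powR; rewrite ?nnegrE// ltW.
  apply: (le_trans (expR_bound x _ t0g)); rewrite ler_expR ler_wpM2l//.
  have := ler_normD (x - y) y; rewrite subrK => /le_trans; apply.
  by rewrite addrC lerD2l ltW.
Qed.

Lemma truncated_laplace_ln b r : 0 < r -> 0 < b ->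
  \int[mu]_(t in `[0, gam]) (t `^ (b - 1) * r `^ (gam - t)) = r `^ gam * truncated_laplace b (ln r).
Proof.
move=> r0 b0; rewrite /truncated_laplace -RintegralZl//; last exact: truncated_laplace_integrable.
apply: eq_Rintegral => t _; rewrite mulrCA; congr (_ * _).
by rewrite powRD; [rewrite [in X in _ * X]powR_expR_ln// mulNr|apply/implyP => _; rewrite gt_eqF].
Qed.

End truncated_laplace.

Section radial_symbols.
Context {R : realType}.
Variables (gam l : R).
Hypothesis gam0 : 0 <= gam.
Hypothesis l1 : 1 < l.

(** A syntactic class of profiles, large enough to contain the remainder symbol
    and closed under differentiation on the positive half-line. *)
Inductive radial_sym : (R -> R) -> Prop :=
| rs_cst c : radial_sym (fun=> c)
| rs_pow a : radial_sym (fun r => r `^ a)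
| rs_inv : radial_sym (fun r => (l + r)^-1)
| rs_lnpow a : radial_sym (fun r => ln (l + r) `^ a)
| rs_laplace b : 0 < b -> radial_sym (fun r => truncated_laplace gam b (ln r))
| rs_add f g : radial_sym f -> radial_sym g -> radial_sym (fun r => f r + g r)
| rs_mul f g : radial_sym f -> radial_sym g -> radial_sym (fun r => f r * g r).

Lemma radial_sym_derive f : radial_sym f ->
  exists2 g, radial_sym g & forall r : R, 0 < r -> is_derive r (1 : R) f (g r).
Proof.
elim=> [c|a||a|b b0|f1 g1 _ [f1' sf1 df1] _ [g1' sg1 dg1]|f1 g1 sf [f1' sf1 df1] sg [g1' sg1 dg1]].
- exists (fun=> 0) => [|r r0]; [exact: rs_cst|exact: is_derive_cst].
- exists (fun r => a * r `^ (a - 1)) => [|r r0].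
    by apply: rs_mul; [exact: rs_cst|exact: rs_pow].
  exact: is_derive1_powR.
- exists (fun r => - 1 * ((l + r)^-1 * (l + r)^-1)) => [|r r0].
    by apply: rs_mul; [exact: rs_cst|apply: rs_mul; exact: rs_inv].
  have lr : l + r != 0 by rewrite gt_eqF// addr_gt0// (lt_trans _ l1).
  have d : is_derive r (1 : R) (fun r => l + r) 1.
    have -> : (fun r : R => l + r) = cst l + id by [].
    by apply: is_derive_eq; rewrite add0r.
  have -> : - 1 * ((l + r)^-1 * (l + r)^-1) = - (l + r) ^- 2 *: (1 : R).
    by rewrite /GRing.scale/= expr2 invfM; ring.
  exact: is_deriveV.
- exists (fun r => a * ln (l + r) `^ (a - 1) * (l + r)^-1) => [|r r0].
    by apply: rs_mul; [apply: rs_mul; [exact: rs_cst|exact: rs_lnpow]|exact: rs_inv].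
  have lr : 1 < l + r by rewrite (lt_trans l1)// ltrDl.
  have d : is_derive r (1 : R) (fun r => l + r) 1.
    have -> : (fun r : R => l + r) = cst l + id by [].
    by apply: is_derive_eq; rewrite add0r.
  have d2 := @is_derive1_comp _ (@ln R) (fun r => l + r) r _ _ (is_derive1_ln (lt_trans ltr01 lr)) d.
  have d3 := @is_derive1_comp _ (fun y => y `^ a) (@ln R \o (fun r => l + r)) r _ _ (is_derive1_powR a (ln_gt0 lr)) d2.
  rewrite mulr1 in d3; exact: d3.
- exists (fun r => - 1 * (truncated_laplace gam (b + 1) (ln r) * r `^ (-1))) => [|r r0].
    apply: rs_mul; first exact: rs_cst.
    by apply: rs_mul; [apply: rs_laplace; rewrite addr_gt0|exact: rs_pow].
  have d := @is_derive1_comp _ (truncated_laplace gam b) (@ln R) r _ _ (is_derive_truncated_laplace gam gam0 b _ b0) (is_derive1_ln r0).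
  have -> : - 1 * (truncated_laplace gam (b + 1) (ln r) * r `^ (-1)) = - truncated_laplace gam (b + 1) (ln r) * r^-1.
    by rewrite powR_inv1 ?(ltW r0)//; ring.
  exact: d.
- exists (fun r => f1' r + g1' r) => [|r r0]; first exact: rs_add.
  by apply: is_deriveD; [exact: df1|exact: dg1].
- exists (fun r => f1 r * g1' r + g1 r * f1' r) => [|r r0].
    by apply: rs_add; exact: rs_mul.
  have := @is_deriveM _ _ f1 g1 r (1 : R) _ _ (df1 _ r0) (dg1 _ r0).
  by [].
Qed.

Variable n : nat.

(** The coordinates have to be added to the radial profiles, since the i-th
    partial derivative of f(|x|) is f'(|x|) x_i / |x|. *)
Inductive smooth_sym : ('rV[R]_n -> R) -> Prop :=
| ss_coord i : smooth_sym (fun x => x 0 i)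
| ss_rad f : radial_sym f -> smooth_sym (fun x => f (enorm x))
| ss_add f g : smooth_sym f -> smooth_sym g -> smooth_sym (fun x => f x + g x)
| ss_mul f g : smooth_sym f -> smooth_sym g -> smooth_sym (fun x => f x * g x).

Lemma enorm_gt0 (x : 'rV[R]_n) : x != 0 -> 0 < enorm x.
Proof.
move=> x0; rewrite /enorm sqrtr_gt0 lt_neqAle dotvv_ge0 andbT eq_sym.
apply: contra x0; rewrite /dotv psumr_eq0; last by move=> i _; rewrite -expr2 sqr_ge0.
move=> /allP h; apply/eqP/rowP => i; rewrite mxE; apply/eqP.
by have := h i (mem_index_enum i); rewrite mulf_eq0 orbb.
Qed.

(** A directional derivative is an ordinary derivative along a line, to which
    the chain rule for functions of one variable applies. *)
Lemma is_derive_line (h : 'rV[R]_n -> R) x v d :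
  is_derive x v h d <-> is_derive (0 : R) (1 : R) (fun t => h (t *: v + x)) d.
Proof.
have E : 'D_v h x = 'D_1 (fun t : R => h (t *: v + x)) 0.
  rewrite /derive; congr (lim _).
  have -> // : (fun t : R => t^-1 *: ((h \o shift x) (t *: v) - h x)) =
     (fun t : R => t^-1 *: (((fun t0 => h (t0 *: v + x)) \o shift 0) (t *: 1) - h (0 *: v + x))).
  by apply/funext => t /=; rewrite scale0r !add0r addr0 [t *: 1]mulr1.
split=> -[dh dE]; apply: DeriveDef.
- exact/(derivable1P _ _ _).1.
- by rewrite -E.
- exact/(derivable1P _ _ _).2.
- by rewrite E.
Qed.

Lemma is_derive_coord (x v : 'rV[R]_n) i : is_derive x v (fun y : 'rV[R]_n => y 0 i) (v 0 i).
Proof.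
apply/is_derive_line.
have -> : (fun t : R => (t *: v + x) 0 i) = (v 0 i) *: id + cst (x 0 i).
  by apply/funext => t; rewrite !mxE !fctE /GRing.scale/= mulrC.
by apply: is_derive_eq; rewrite addr0 /GRing.scale/= mulr1.
Qed.

Lemma is_derive0_quadratic (a b c : R) :
  is_derive (0 : R) (1 : R) (fun t => a + b * t + c * (t * t)) b.
Proof.
have -> : (fun t : R => a + b * t + c * (t * t)) = cst a + b *: id + c *: (id * id) by [].
have di := @is_derive_id _ _ (0 : R) (1 : R).
have := is_deriveD (is_deriveD (is_derive_cst a (0 : R) (1 : R)) (is_deriveZ b di))
  (is_deriveZ c (is_deriveM di di)).
rewrite scale0r addr0 scaler0 addr0 add0r.
rewrite /GRing.scale/= mulr1; exact.
Qed.

(** Along a coordinate line, |x|^2 is a quadratic polynomial. *)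
Lemma is_derive_enorm (x : 'rV[R]_n) i : x != 0 ->
  is_derive x (delta_mx 0 i) (@enorm R n) (x 0 i * (enorm x) `^ (-1)).
Proof.
move=> x0; have ex := enorm_gt0 _ x0; have dx : 0 < dotv x x.
  by rewrite -sqr_enorm exprn_gt0.
apply/is_derive_line.
pose e : 'rV[R]_n := delta_mx 0 i.
have d : is_derive (0 : R) (1 : R) (fun t : R => dotv (t *: e + x) (t *: e + x)) (2 * x 0 i).
  have -> : (fun t : R => dotv (t *: e + x) (t *: e + x)) =
     (fun t : R => dotv x x + (2 * x 0 i) * t + dotv e e * (t * t)).
    apply/funext => t.
    have -> : 2 * x 0 i * t = 2 * t * dotv e x.
      have -> : dotv e x = x 0 i.
        rewrite /dotv (bigD1 i)//= mxE !eqxx mul1r big1 ?addr0// => j ji.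
        by rewrite mxE (negbTE ji) andbF mul0r.
      by ring.
    rewrite /dotv !mulr_sumr ?mulr_suml -!big_split /=; apply: eq_bigr => j _.
    by rewrite !mxE; ring.
  exact: is_derive0_quadratic.
have dx' : 0 < dotv (0 *: e + x) (0 *: e + x) by rewrite scale0r add0r.
have := @is_derive1_comp _ Num.sqrt (fun t : R => dotv (t *: e + x) (t *: e + x)) 0 _ _
  (is_derive1_sqrt dx') d.
rewrite scale0r add0r -/(enorm x).
have -> // : (2 * enorm x)^-1 * (2 * x 0 i) = x 0 i * enorm x `^ (-1).
by rewrite powR_inv1 ?(ltW ex)//; field; rewrite gt_eqF.
Qed.

Lemma continuous_enorm : continuous (@enorm R n).
Proof.
move=> x; rewrite /enorm.
apply: (@continuous_comp _ _ _ (fun x : 'rV[R]_n => dotv x x) Num.sqrt); last exact: sqrt_continuous.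
rewrite /dotv; elim: (index_enum 'I_n) => [|i s ih].
  have -> : (fun x : 'rV[R]_n => \sum_(i <- [::]) x 0 i * x 0 i) = cst 0.
    by apply/funext => y; rewrite big_nil.
  exact: cst_continuous.
have -> : (fun x : 'rV[R]_n => \sum_(i <- i :: s) x 0 i * x 0 i) =
  (fun x => x 0 i * x 0 i + \sum_(i <- s) x 0 i * x 0 i).
  by apply/funext => y; rewrite big_cons.
have ci := @coord_continuous R 1 n 0 i x.
have c1 : (fun y : 'rV[R]_n => y 0 i * y 0 i) @ x --> x 0 i * x 0 i by apply: (cvgM ci ci).
exact: (cvgD c1 ih).
Qed.

Lemma smooth_sym_step h : smooth_sym h ->
  (forall x, x != 0 -> {for x, continuous h}) /\
  forall i, exists2 h', smooth_sym h' & forall x, x != 0 -> is_derive x (delta_mx 0 i) h (h' x).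
Proof.
elim=> [j|f sf|f g sf [cf df] sg [cg dg]|f g sf [cf df] sg [cg dg]].
- split; first by move=> x _; exact: coord_continuous.
  move=> i; exists (fun=> (delta_mx 0 i : 'rV[R]_n) 0 j); first exact: (ss_rad _ (rs_cst _)).
  by move=> x _; exact: is_derive_coord.
- have [g sg dg] := radial_sym_derive _ sf; split.
    move=> x x0; apply: continuous_comp; first exact: continuous_enorm.
    apply: differentiable_continuous; apply/derivable1_diffP.
    by case: (dg _ (enorm_gt0 _ x0)).
  move=> i; exists (fun x => g (enorm x) * (x 0 i * enorm x `^ (-1))).
    apply: ss_mul; first exact: ss_rad.
    by apply: ss_mul; [exact: ss_coord|exact: (ss_rad _ (rs_pow _))].
  move=> x x0; apply/is_derive_line.
  have /is_derive_line d := is_derive_enorm x i x0.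
  have dg' : is_derive ((fun t : R => enorm (t *: (delta_mx 0 i : 'rV[R]_n) + x)) 0) (1 : R) f (g (enorm x)).
    by rewrite scale0r add0r; apply: dg; exact: enorm_gt0.
  exact: (@is_derive1_comp _ f (fun t : R => enorm (t *: delta_mx 0 i + x)) 0 _ _ dg' d).
- split; first by move=> x x0; exact: (cvgD (cf _ x0) (cg _ x0)).
  move=> i; have [f' sf' df'] := df i; have [g' sg' dg'] := dg i.
  exists (fun x => f' x + g' x); first exact: ss_add.
  by move=> x x0; apply: is_deriveD; [exact: df'|exact: dg'].
- split; first by move=> x x0; exact: (cvgM (cf _ x0) (cg _ x0)).
  move=> i; have [f' sf' df'] := df i; have [g' sg' dg'] := dg i.
  exists (fun x => f x * g' x + g x * f' x).
    by apply: ss_add; exact: ss_mul.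
  by move=> x x0; exact: (@is_deriveM _ _ f g x _ _ _ (df' _ x0) (dg' _ x0)).
Qed.

Lemma nonzero_near (x : 'rV[R]_n) : x != 0 -> \near x, x != 0.
Proof.
move=> x0; have := continuous_enorm x => /cvgr_gt /(_ 0 (enorm_gt0 _ x0)).
apply: filterS => y; apply: contraTneq => ->.
by rewrite /enorm /dotv big1 ?sqrtr0 ?ltxx// => i _; rewrite mxE mul0r.
Qed.

(** Away from the origin, every iterated partial derivative agrees with a
    member of the class, which is continuous and derivable there. *)
Lemma smooth_sym_on (P h : 'rV[R]_n -> R) : smooth_sym h ->
  (forall x, x != 0 -> P x = h x) -> smooth_on [set x : 'rV[R]_n | x != 0] P.
Proof.
move=> sh Ph s.
have [g sg Eg] : exists2 g, smooth_sym g & forall x, x != 0 -> foldr (@partial R n) P s x = g x.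
  elim: s => [|i s [g sg Eg]]; first by exists h.
  have [_ /(_ i) [g' sg' dg']] := smooth_sym_step _ sg; exists g' => // x x0 /=.
  rewrite /partial (@near_eq_derive _ _ _ _ g); first by case: (dg' _ x0).
  by apply: filterS (nonzero_near _ x0) => y; exact: Eg.
move=> x x0; have [cg dg] := smooth_sym_step _ sg.
have nE : \near x, g x = foldr (@partial R n) P s x.
  by apply: filterS (nonzero_near _ x0) => y y0; rewrite Eg.
split.
  suff : foldr (@partial R n) P s @ x --> foldr (@partial R n) P s x by [].
  rewrite (Eg _ x0); apply: cvg_trans (cg _ x0).
  exact: (near_eq_cvg nE).
move=> i; have [g' _ dg'] := dg i.
by apply: (near_eq_derivable nE); case: (dg' _ x0).
Qed.

End radial_symbols.

(** * Convolution with a real integrable kernel *)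

Section real_convolution.
Context {R : realType} {n : nat}.
Let L := lebesgue_rV R n.
Variable k : 'rV[R]_n -> R.
Hypothesis ik : L.-integrable setT (EFin \o k).

Let mk : measurable_fun setT k.
Proof. by apply/measurable_EFinP; exact: (measurable_int L ik). Qed.

Let A : R := \int[L]_x `|k x|.

Lemma measurable_sub_rV :
  measurable_fun setT (fun z : 'rV[R]_n * 'rV[R]_n => z.2 - z.1).
Proof.
apply: measurable_fun_rVP => i.
have m2 : measurable_fun setT (fun z : 'rV[R]_n * 'rV[R]_n => (z.2 0 i : R)).
  apply: (@measurableT_comp _ _ _ _ _ _ (fun v : 'rV[R]_n => v 0 i : measurableTypeR R)).
    exact: measurable_coord_rV.
  exact: measurable_snd.
have m1 : measurable_fun setT (fun z : 'rV[R]_n * 'rV[R]_n => (z.1 0 i : R)).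
  apply: (@measurableT_comp _ _ _ _ _ _ (fun v : 'rV[R]_n => v 0 i : measurableTypeR R)).
    exact: measurable_coord_rV.
  exact: measurable_fst.
have m : measurable_fun setT (fun z : 'rV[R]_n * 'rV[R]_n => z.2 0 i - z.1 0 i : R).
  exact: measurable_funB.
by under eq_fun do rewrite !mxE.
Qed.

Let kk (z : 'rV[R]_n * 'rV[R]_n) : R := k (z.2 - z.1).

Lemma measurable_kk : measurable_fun setT (fun z : 'rV[R]_n * 'rV[R]_n => k (z.2 - z.1)).
Proof. exact: (measurableT_comp mk measurable_sub_rV). Qed.

Lemma kernel_norm_fin : (\int[L]_x `|k x|%:E = A%:E)%E.
Proof. by rewrite EFin_Rintegral//; exact: integrable_norm ik. Qed.

Lemma kernel_norm_ge0 : 0 <= A.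
Proof. exact: Rintegral_ge0. Qed.

Let mnk : measurable_fun setT (fun x => `|k x|%:E).
Proof. by apply/measurable_EFinP; apply: measurableT_comp. Qed.

Lemma kernel_norm_left y : (\int[L]_x `|k (x - y)|%:E = A%:E)%E.
Proof.
rewrite -kernel_norm_fin -(@integral_rV_isometry _ n 1 (- y) (fun x => `|k x|%:E)) ?normr1//.
by apply: eq_integral => x _; rewrite scale1r.
Qed.

Lemma kernel_norm_right x : (\int[L]_y `|k (x - y)|%:E = A%:E)%E.
Proof.
rewrite -kernel_norm_fin -(@integral_rV_isometry _ n (-1) x (fun x => `|k x|%:E)) ?normrN1//.
by apply: eq_integral => y _; rewrite scaleN1r addrC.
Qed.

(** Real convolution is a mixture of translates of k with weight f; it inherits
    integrability and the formula for test functions from [mixture]. *)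
Definition rconv (f : 'rV[R]_n -> R) (x : 'rV[R]_n) : R := \int[L]_y (k (x - y) * f y).

Lemma rconvE f x : rconv f x = mixture L f kk x.
Proof. by apply: eq_Rintegral => y _; rewrite mulrC. Qed.

Lemma measurable_rconv f : measurable_fun setT f -> measurable_fun setT (rconv f).
Proof.
move=> mf.
have mh : measurable_fun setT (fun z : 'rV[R]_n * 'rV[R]_n => k (z.2 - z.1) * f z.1).
  apply: measurable_funM; first exact: measurable_kk.
  exact: (measurableT_comp mf measurable_fst).
exact: (measurable_fun_Rintegral2 L _ mh).
Qed.

Lemma rconv_integrable f : L.-integrable setT (EFin \o f) ->
  L.-integrable setT (EFin \o rconv f).
Proof.
move=> if'; rewrite (_ : rconv f = mixture L f kk); last exact/funext/rconvE.
apply: (mixture_integrable L L f kk A kernel_norm_ge0 if' measurable_kk) => y _.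
by rewrite kernel_norm_left.
Qed.

Section transform.
Hypothesis keven : forall x, k (- x) = k x.

Let ikc xi := integrable_mul_le1 L k _ ik (measurable_cos_dotv n xi) (fun x => cos_max _).
Let iks xi := integrable_mul_le1 L k _ ik (measurable_sin_dotv n xi) (fun x => sin_max _).

Let shift y (e : 'rV[R]_n -> R) : measurable_fun setT e ->
  \int[L]_x (k (x - y) * e x) = \int[L]_x (k x * e (x + y)).
Proof.
move=> me; rewrite -(@Rintegral_rV_isometry _ n 1 (- y) (fun x => k x * e (x + y))) ?normr1//.
  by apply: eq_Rintegral => x _; rewrite scale1r subrK.
apply: measurable_funM => //; apply: (measurableT_comp me).
have := @measurable_affine_rV R n 1 y.
by under eq_fun do rewrite scale1r.
Qed.

(* Translation by y, the addition formula, and the vanishing of the sine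
   integral of the even function k. *)
Let shift_cos xi y : \int[L]_x (kk (y, x) * cos (dotv xi x)) =
  \int[L]_x (k x * cos (dotv xi x)) * cos (dotv xi y).
Proof.
rewrite /kk/= (shift y (fun x => cos (dotv xi x))); last exact: measurable_cos_dotv.
under eq_Rintegral.
  move=> x _; rewrite dotvDr cosD mulrBr !mulrA; over.
rewrite RintegralB//; last 2 first.
- exact: (integrableZr measurableT (cos (dotv xi y)) (ikc xi)).
- exact: (integrableZr measurableT (sin (dotv xi y)) (iks xi)).
rewrite !RintegralZr// ?(even_integral_sin n k xi ik keven) ?mul0r ?subr0//.
Qed.

Let shift_sin xi y : \int[L]_x (kk (y, x) * sin (dotv xi x)) =
  \int[L]_x (k x * cos (dotv xi x)) * sin (dotv xi y).
Proof.
rewrite /kk/= (shift y (fun x => sin (dotv xi x))); last exact: measurable_sin_dotv.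
under eq_Rintegral.
  move=> x _; rewrite dotvDr sinD mulrDr !mulrA; over.
rewrite RintegralD//; last 2 first.
- exact: (integrableZr measurableT (cos (dotv xi y)) (iks xi)).
- exact: (integrableZr measurableT (sin (dotv xi y)) (ikc xi)).
rewrite !RintegralZr// ?(even_integral_sin n k xi ik keven) ?mul0r ?add0r//.
Qed.

Lemma rconv_cos f xi : L.-integrable setT (EFin \o f) ->
  \int[L]_x (rconv f x * cos (dotv xi x)) =
  \int[L]_x (k x * cos (dotv xi x)) * \int[L]_x (f x * cos (dotv xi x)).
Proof.
move=> if'; under eq_Rintegral do rewrite rconvE.
rewrite (mixture_test L L f kk A kernel_norm_ge0 if' measurable_kk) //; last 3 first.
- by move=> y _; rewrite kernel_norm_left.
- exact: measurable_cos_dotv.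
- by move=> x; exact: cos_max.
under eq_Rintegral do rewrite shift_cos mulrCA.
rewrite RintegralZl//; apply: integrable_mul_le1 => //; [exact: measurable_cos_dotv|].
by move=> x; exact: cos_max.
Qed.

Lemma rconv_sin f xi : L.-integrable setT (EFin \o f) ->
  \int[L]_x (rconv f x * sin (dotv xi x)) =
  \int[L]_x (k x * cos (dotv xi x)) * \int[L]_x (f x * sin (dotv xi x)).
Proof.
move=> if'; under eq_Rintegral do rewrite rconvE.
rewrite (mixture_test L L f kk A kernel_norm_ge0 if' measurable_kk) //; last 3 first.
- by move=> y _; rewrite kernel_norm_left.
- exact: measurable_sin_dotv.
- by move=> x; exact: sin_max.
under eq_Rintegral do rewrite shift_sin mulrCA.
rewrite RintegralZl//; apply: integrable_mul_le1 => //; [exact: measurable_sin_dotv|].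
by move=> x; exact: sin_max.
Qed.

End transform.

Section young.
Variable v : 'rV[R]_n -> R.
Hypothesis mv : measurable_fun setT v.
Hypothesis v0 : forall x, 0 <= v x.

(** The convolution of |k| with v; extended-real values avoid deciding at which
    points it converges. *)
Definition abs_conv (x : 'rV[R]_n) : \bar R := (\int[L]_y (`|k (x - y)| * v y)%:E)%E.

(** The convolution of |k| with v^r; by Tonelli its integral is the product of
    the integrals of |k| and v^r. *)
Definition powR_conv (r : R) (x : 'rV[R]_n) : \bar R := (\int[L]_y (`|k (x - y)| * v y `^ r)%:E)%E.

Let mky (x : 'rV[R]_n) : measurable_fun setT (fun y : 'rV[R]_n => `|k (x - y)|).
Proof. by apply: measurableT_comp => //; exact: (measurable_pair_slice2 _ x measurable_kk). Qed.

Let mvr r : measurable_fun setT (fun y => v y `^ r).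
Proof. by apply: (@measurableT_comp _ _ _ _ _ _ (fun s : R => s `^ r)). Qed.

Let mpc r (x : 'rV[R]_n) : measurable_fun setT (fun y : 'rV[R]_n => (`|k (x - y)| * v y `^ r)%:E).
Proof. by apply/measurable_EFinP; exact: measurable_funM. Qed.

Lemma powR_conv_ge0 r x : (0 <= powR_conv r x)%E.
Proof. by apply: integral_ge0 => y _; rewrite lee_fin mulr_ge0 ?powR_ge0. Qed.

(** If t > th then t = t^r t^(1 - r) and t^(1 - r) <= th^(1 - r), the exponent
    being nonpositive. *)
Lemma le_split_powR (r th t : R) : 1 <= r -> 0 < th -> 0 <= t -> t <= th + t `^ r * th `^ (1 - r).
Proof.
move=> r1 th0 t0; have [tth|tht] := leP t th.
  by rewrite (le_trans tth)// lerDl mulr_ge0 ?powR_ge0.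
have tp : 0 < t by exact: lt_trans tht.
apply: (@le_trans _ _ (t `^ r * th `^ (1 - r))); last by rewrite lerDr ltW.
have {1}-> : t = t `^ r * t `^ (1 - r).
  by rewrite -powRD ?subrKC ?powRr1//; apply/implyP => _; rewrite gt_eqF.
rewrite ler_wpM2l ?powR_ge0//.
rewrite -(opprB r 1) (powRN t (r - 1)) (powRN th (r - 1)) lef_pV2 ?posrE ?powR_gt0//.
by apply: ge0_ler_powR; rewrite ?nnegrE ?subr_ge0// ltW.
Qed.

Lemma abs_conv_le_split r th x : 1 <= r -> 0 < th ->
  (abs_conv x <= (A * th)%:E + (th `^ (1 - r))%:E * powR_conv r x)%E.
Proof.
move=> r1 th0.
apply: (@le_trans _ _ (\int[L]_y ((th * `|k (x - y)|)%:E + (th `^ (1 - r) * (`|k (x - y)| * v y `^ r))%:E))%E).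
  apply: ge0_le_integral => //.
  - by move=> y _; rewrite lee_fin mulr_ge0.
  - by apply/measurable_EFinP; exact: measurable_funM.
  - apply: emeasurable_funD; apply/measurable_EFinP; first exact: measurable_funM.
    by apply: measurable_funM => //; exact: measurable_funM.
  move=> y _; rewrite -EFinD lee_fin.
  rewrite [leRHS](_ : _ = `|k (x - y)| * (th + v y `^ r * th `^ (1 - r))); last by ring.
  by rewrite ler_wpM2l// le_split_powR.
rewrite ge0_integralD//; last 4 first.
- by move=> y _; rewrite lee_fin mulr_ge0// ltW.
- by apply/measurable_EFinP; exact: measurable_funM.
- by move=> y _; rewrite lee_fin !mulr_ge0 ?powR_ge0.
- by apply/measurable_EFinP; apply: measurable_funM => //; exact: measurable_funM.
apply: leeD.
  under eq_integral do rewrite EFinM.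
  rewrite ge0_integralZl//; last 2 first.
  - by apply/measurable_EFinP.
  - by rewrite lee_fin ltW.
  by rewrite kernel_norm_right -EFinM mulrC.
under eq_integral do rewrite EFinM.
rewrite ge0_integralZl//; first by move=> y _; rewrite lee_fin mulr_ge0 ?powR_ge0.
by rewrite lee_fin powR_ge0.
Qed.

Lemma abs_conv_lty r x : 1 <= r -> (powR_conv r x < +oo)%E -> (abs_conv x < +oo)%E.
Proof.
move=> r1 px; apply: le_lt_trans (abs_conv_le_split _ 1 x r1 ltr01) _.
by rewrite lte_add_pinfty ?ltry// lte_mul_pinfty// lee_fin powR_ge0.
Qed.

(** A pointwise substitute for Jensen's inequality, free of any normalization
    of |k|: integrating [le_split_powR] against |k (x - y)| gives
    (|k| * v)(x) <= A th + th^(1 - r) (|k| * v^r)(x) for each th > 0, and the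
    choice th = ((|k| * v^r)(x))^(1 / r) makes the right-hand side
    (A + 1) th. *)
Lemma abs_conv_powR_le r x : 1 <= r -> (powR_conv r x < +oo)%E ->
  (((fine (abs_conv x)) `^ r)%:E <= ((A + 1) `^ r)%:E * powR_conv r x)%E.
Proof.
move=> r1 px; have rn0 : r != 0 by rewrite gt_eqF// (lt_le_trans ltr01).
have r0 : 0 <= r by rewrite (le_trans ler01).
have A0 := kernel_norm_ge0.
have nx := abs_conv_lty _ _ r1 px.
have n0 : (0 <= abs_conv x)%E by apply: integral_ge0 => y _; rewrite lee_fin mulr_ge0.
have nfin : abs_conv x \is a fin_num by rewrite ge0_fin_numE.
have pfin : powR_conv r x \is a fin_num by rewrite ge0_fin_numE// powR_conv_ge0.
have split_ th : 0 < th -> fine (abs_conv x) <= A * th + th `^ (1 - r) * fine (powR_conv r x).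
  move=> th0; rewrite -lee_fin EFinD (EFinM (th `^ (1 - r))) !fineK//.
  exact: abs_conv_le_split.
have p0 : 0 <= fine (powR_conv r x) by rewrite fine_ge0// powR_conv_ge0.
have N0 : 0 <= fine (abs_conv x) by rewrite fine_ge0.
rewrite -[in leRHS](fineK pfin) -EFinM lee_fin.
move: (fine (abs_conv x)) (fine (powR_conv r x)) N0 p0 split_ => N p N0 p0 split_.
have [pz|pn0] := eqVneq p 0.
  have -> : N = 0.
    apply/eqP; rewrite eq_le N0 andbT leNgt; apply/negP => Np.
    have A10 : 0 < A + 1 by rewrite ltr_wpDl.
    (* If (|k| * v^r)(x) = 0, only the term A th remains, for th arbitrarily small. *)
    have th0 : 0 < N / 2 / (A + 1) by rewrite !divr_gt0.
    have := split_ _ th0; rewrite pz mulr0 addr0 => h.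
    have : A * (N / 2 / (A + 1)) <= N / 2.
      rewrite mulrA ler_pdivrMr// mulrC ler_wpM2l ?lerDl// ltW// divr_gt0//.
    by move=> h2; have := le_trans h h2; rewrite ler_pdivlMr// ger_pMr// lern1.
  by rewrite pz mulr0 powR0.
have pp : 0 < p by rewrite lt_neqAle eq_sym pn0.
have th0 : 0 < p `^ r^-1 by rewrite powR_gt0.
have := split_ _ th0.
have -> : (p `^ r^-1) `^ (1 - r) * p = p `^ r^-1.
  rewrite -powRrM -[X in _ * X](powRr1 p0) -powRD; last by apply/implyP => _; rewrite gt_eqF.
  by congr (_ `^ _); field.
rewrite -[X in _ + X]mul1r -mulrDl => h.
apply: (@le_trans _ _ (((A + 1) * p `^ r^-1) `^ r)).
  by apply: ge0_ler_powR; rewrite ?nnegrE ?mulr_ge0 ?addr_ge0 ?powR_ge0.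
by rewrite powRM ?addr_ge0 ?powR_ge0// -powRrM mulVf// powRr1.
Qed.

Lemma integral_powR_conv r : (\int[L]_x powR_conv r x = A%:E * \int[L]_y (v y `^ r)%:E)%E.
Proof.
have mk2 : measurable_fun setT (fun z : 'rV[R]_n * 'rV[R]_n => (`|k (z.2 - z.1)| * v z.1 `^ r)%:E).
  apply/measurable_EFinP; apply: measurable_funM.
    by apply: measurableT_comp => //; exact: measurable_kk.
  exact: (measurableT_comp (mvr r) measurable_fst).
rewrite /powR_conv -(@fubini_tonelli _ _ _ _ _ L L (fun z => (`|k (z.2 - z.1)| * v z.1 `^ r)%:E))//=; last first.
  by move=> z; rewrite lee_fin mulr_ge0 ?powR_ge0.
rewrite -ge0_integralZl//; last 3 first.
- exact/measurable_EFinP.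
- by move=> y _; rewrite lee_fin powR_ge0.
- by rewrite lee_fin kernel_norm_ge0.
apply: eq_integral => y _; under eq_integral do rewrite mulrC EFinM.
rewrite ge0_integralZl//; last 2 first.
- apply/measurable_EFinP; apply: measurableT_comp => //.
  exact: (measurable_pair_slice _ y measurable_kk).
- by rewrite lee_fin powR_ge0.
by rewrite kernel_norm_left muleC.
Qed.

Lemma measurable_powR_conv r : measurable_fun setT (powR_conv r).
Proof.
have mh : measurable_fun setT (fun z : 'rV[R]_n * 'rV[R]_n => (`|k (z.2 - z.1)| * v z.1 `^ r)%:E).
  apply/measurable_EFinP; apply: measurable_funM.
    by apply: measurableT_comp => //; exact: measurable_kk.
  exact: (measurableT_comp (mvr r) measurable_fst).
apply: (measurable_fun_fubini_tonelli_G (m1 := L) _ mh).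
by move=> z; rewrite lee_fin mulr_ge0 ?powR_ge0.
Qed.

Lemma abs_conv_le_sup (B : R) x : 0 <= B -> {ae L, forall y, v y <= B} ->
  (abs_conv x <= (A * B)%:E)%E.
Proof.
move=> B0 vB.
apply: (@le_trans _ _ (\int[L]_y (B%:E * `|k (x - y)|%:E))%E).
  apply: ae_ge0_le_integral => //.
  - by move=> y _; rewrite lee_fin mulr_ge0.
  - by apply/measurable_EFinP; exact: measurable_funM.
  - by move=> y _; rewrite -EFinM lee_fin mulr_ge0.
  - by apply/measurable_EFinP; exact: measurable_funM.
  by apply: filterS vB => y vy _; rewrite -EFinM lee_fin mulrC ler_wpM2r.
rewrite ge0_integralZl//; last by apply/measurable_EFinP.
by rewrite kernel_norm_right -EFinM mulrC.
Qed.

Lemma rconv_le_abs_conv (f : 'rV[R]_n -> R) (x : 'rV[R]_n) : measurable_fun setT f -> (forall y, `|f y| <= v y) ->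
  (`|rconv f x|%:E <= abs_conv x)%E /\
  ((abs_conv x < +oo)%E -> L.-integrable setT (fun y => (k (x - y) * f y)%:E)).
Proof.
move=> mf fv.
have mkf : measurable_fun setT (fun y : 'rV[R]_n => k (x - y) * f y).
  by apply: measurable_funM => //; exact: (measurable_pair_slice2 _ x measurable_kk).
have le : (\int[L]_y `|(k (x - y) * f y)%:E| <= abs_conv x)%E.
  apply: ge0_le_integral => //.
  - by apply: measurableT_comp => //; exact/measurable_EFinP.
  - by apply/measurable_EFinP; exact: measurable_funM.
  by move=> y _; rewrite lee_fin normrM ler_wpM2l.
split.
  apply: le_trans le; rewrite /rconv /Rintegral.
  apply: (@le_trans _ _ (`|\int[L]_y (k (x - y) * f y)%:E|)%E).
    by case: (integral L _ _) => [r| |]; rewrite ?lexx//; exact: leey.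
  by apply: le_abse_integral => //; exact/measurable_EFinP.
move=> nx; apply/integrableP; split; first exact/measurable_EFinP.
exact: le_lt_trans le nx.
Qed.

End young.
End real_convolution.

(** * Complex-valued functions and their Fourier transforms *)

Section complex_functions.
Context {R : realType} {n : nat}.
Let L := lebesgue_rV R n.
Local Notation normc := ComplexField.Normc.normc.

Lemma Re_mulr_real (a : R) (z : R[i])  : complex.Re (a%:C%C * z) = a * complex.Re z.
Proof. by case: z => b c /=; rewrite mul0r subr0. Qed.

Lemma Im_mulr_real (a : R) (z : R[i]) : complex.Im (a%:C%C * z) = a * complex.Im z.
Proof. by case: z => b c /=; rewrite mul0r addr0. Qed.

Lemma normc_ge0 (z : R[i]) : 0 <= normc z.
Proof. by case: z => a b /=; exact: sqrtr_ge0. Qed.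

Lemma Re_le_normc (z : R[i]) : `|complex.Re z| <= normc z.
Proof. by case: z => a b /=; rewrite -sqrtr_sqr ler_sqrt ?lerDl ?addr_ge0 ?sqr_ge0. Qed.

Lemma Im_le_normc (z : R[i]) : `|complex.Im z| <= normc z.
Proof. by case: z => a b /=; rewrite -sqrtr_sqr ler_sqrt ?lerDr ?addr_ge0 ?sqr_ge0. Qed.

Lemma normc_le_ReIm (z : R[i]) : normc z <= `|complex.Re z| + `|complex.Im z|.
Proof.
case: z => a b /=; rewrite -[leRHS]ger0_norm ?addr_ge0// -sqrtr_sqr ler_sqrt ?sqr_ge0//.
by rewrite sqrrD !real_normK ?num_real// -addrA [X in _ <= _ + X]addrC addrA lerDl mulrn_wge0 ?mulr_ge0.
Qed.

Variable f : 'rV[R]_n -> R[i].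
Hypothesis mRe : measurable_fun setT (fun x => complex.Re (f x)).
Hypothesis mIm : measurable_fun setT (fun x => complex.Im (f x)).

Lemma measurable_normc : measurable_fun setT (fun x => normc (f x)).
Proof.
rewrite (_ : (fun x => _) = (fun x => Num.sqrt (complex.Re (f x) ^+ 2 + complex.Im (f x) ^+ 2))); last first.
  by apply/funext => x; case: (f x).
apply: (@measurableT_comp _ _ _ _ _ _ (fun s : R => Num.sqrt s)).
  by apply: continuous_measurable_fun; exact: sqrt_continuous.
by apply: measurable_funD; exact: measurable_funX.
Qed.

End complex_functions.

Section lebesgue_one.
Context {R : realType} {n : nat}.
Let L := lebesgue_rV R n.
Local Notation normc := ComplexField.Normc.normc.

Lemma cLnorm1E (f : 'rV[R]_n -> R[i]) :
  cLnorm 1%:E f = (\int[L]_x (normc (f x))%:E)%E.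
Proof.
rewrite /cLnorm Lnorm1; apply: eq_integral => x _.
by rewrite gee0_abs// lee_fin normc_ge0.
Qed.

Lemma in_L1P (f : 'rV[R]_n -> R[i]) : in_Lp 1%:E f <-> cintegrable f.
Proof.
rewrite /in_Lp /cintegrable cLnorm1E; split => [[mRe mIm fL]|[iRe iIm]].
  have inf : L.-integrable setT (fun x => (normc (f x))%:E).
    apply/integrableP; split; first by apply/measurable_EFinP; exact: measurable_normc.
    by apply: le_lt_trans fL; under eq_integral do rewrite gee0_abs ?lee_fin ?normc_ge0//.
  split; apply: le_integrable inf => //; try exact/measurable_EFinP.
  - by move=> x _; rewrite /= lee_fin (ger0_norm (normc_ge0 _)) Re_le_normc.
  - by move=> x _; rewrite /= lee_fin (ger0_norm (normc_ge0 _)) Im_le_normc.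
have mRe : measurable_fun setT (fun x => complex.Re (f x)).
  by apply/measurable_EFinP; exact: (measurable_int L iRe).
have mIm : measurable_fun setT (fun x => complex.Im (f x)).
  by apply/measurable_EFinP; exact: (measurable_int L iIm).
split => //.
have iS := integrableD measurableT (integrable_norm iRe) (integrable_norm iIm).
apply: le_lt_trans (integrable_lty measurableT iS).
apply: ge0_le_integral => //.
- by move=> x _; rewrite lee_fin normc_ge0.
- by apply/measurable_EFinP; exact: measurable_normc.
- exact: (measurable_int L iS).
by move=> x _; rewrite lee_fin normc_le_ReIm.
Qed.

Lemma fourierE (g : 'rV[R]_n -> R[i]) xi : cintegrable g ->
  fourier g xi =
  ((\int[L]_x (complex.Re (g x) * cos (dotv xi x)) +
    \int[L]_x (complex.Im (g x) * sin (dotv xi x))) +i*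
   (\int[L]_x (complex.Im (g x) * cos (dotv xi x)) -
    \int[L]_x (complex.Re (g x) * sin (dotv xi x))))%C.
Proof.
move=> [iRe iIm].
have mc := measurable_cos_dotv n xi; have ms := measurable_sin_dotv n xi.
have c1 (x : 'rV[R]_n) : `|cos (dotv xi x)| <= 1 by exact: cos_max.
have s1 (x : 'rV[R]_n) : `|sin (dotv xi x)| <= 1 by exact: sin_max.
rewrite /fourier /cintegral; congr (_ +i* _)%C.
  rewrite -RintegralD//; [|exact: (integrable_mul_le1 L _ _ iRe)|exact: (integrable_mul_le1 L _ _ iIm)].
  apply: eq_Rintegral => x _; rewrite /expi cosN sinN.
  by case: (g x) => a b /=; rewrite mulrN opprK.
rewrite -RintegralB//; [|exact: (integrable_mul_le1 L _ _ iIm)|exact: (integrable_mul_le1 L _ _ iRe)].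
apply: eq_Rintegral => x _; rewrite /expi cosN sinN.
by case: (g x) => a b /=; rewrite mulrN addrC.
Qed.

End lebesgue_one.

Section complex_convolution.
Context {R : realType} {n : nat}.
Let L := lebesgue_rV R n.
Local Notation normc := ComplexField.Normc.normc.
Variable k : 'rV[R]_n -> R.
Hypothesis ik : L.-integrable setT (EFin \o k).
Let K : 'rV[R]_n -> R[i] := fun x => (k x)%:C%C.

Lemma convolution_rconv f x : convolution K f x =
  (rconv k (fun y => complex.Re (f y)) x +i* rconv k (fun y => complex.Im (f y)) x)%C.
Proof.
rewrite /convolution /cintegral /rconv; congr (_ +i* _)%C.
  by apply: eq_Rintegral => y _; rewrite Re_mulr_real.
by apply: eq_Rintegral => y _; rewrite Im_mulr_real.
Qed.

Lemma in_L1_real_kernel : in_Lp 1%:E K.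
Proof.
apply/in_L1P; split => //=.
have -> : (fun x : 'rV[R]_n => (0 : R)%:E) = cst 0%E by [].
exact: integrable0.
Qed.

Lemma in_L1_convolution f : in_Lp 1%:E f -> in_Lp 1%:E (convolution K f).
Proof.
move=> /in_L1P[iRe iIm]; apply/in_L1P; split.
  by under eq_fun do rewrite convolution_rconv/=; exact: (rconv_integrable k ik _ iRe).
by under eq_fun do rewrite convolution_rconv/=; exact: (rconv_integrable k ik _ iIm).
Qed.

Section even.
Hypothesis keven : forall x, k (- x) = k x.
Variable m : 'rV[R]_n -> R.
Hypothesis km : forall xi, \int[L]_x (k x * cos (dotv xi x)) = m xi.

Lemma fourier_even_kernel xi : fourier K xi = (m xi)%:C%C.
Proof.
rewrite fourierE; last exact/in_L1P/in_L1_real_kernel.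
rewrite /K/= km (even_integral_sin n k xi ik keven) subr0.
have z e : \int[L]_x (0 * e x) = 0 :> R.
  under eq_Rintegral do rewrite mul0r.
  by rewrite /Rintegral integral0.
by rewrite !z addr0 ?subr0 ?oppr0.
Qed.

Lemma even_kernel_multiplier :
  is_fourier_multiplier (fun xi => (m xi)%:C%C) (convolution K).
Proof.
move=> f f1; split; first exact: in_L1_convolution.
move=> xi; have [iRe iIm] := (in_L1P f).1 f1.
rewrite !fourierE//; last exact/in_L1P/in_L1_convolution.
rewrite (_ : convolution K f = fun x => (rconv k (fun y => complex.Re (f y)) x +i*
    rconv k (fun y => complex.Im (f y)) x)%C) /=; last exact/funext/convolution_rconv.
rewrite (rconv_cos k ik keven _ xi iRe) (rconv_sin k ik keven _ xi iRe).
rewrite (rconv_cos k ik keven _ xi iIm) (rconv_sin k ik keven _ xi iIm) km.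
apply/eqP; rewrite eq_complex/= !mul0r subr0 addr0.
by rewrite mulrDr mulrBr !eqxx.
Qed.

End even.

End complex_convolution.

(** * Bounds on Lebesgue spaces *)

Section convolution_Lp.
Context {R : realType} {n : nat}.
Let L := lebesgue_rV R n.
Local Notation normc := ComplexField.Normc.normc.
Variable k : 'rV[R]_n -> R.
Hypothesis ik : L.-integrable setT (EFin \o k).
Let K : 'rV[R]_n -> R[i] := fun x => (k x)%:C%C.
Let A : R := \int[L]_x `|k x|.

(** A null space would carry no Gaussian mass. *)
Lemma lebesgue_rV_gt0 : (0 < L setT)%E.
Proof.
rewrite lt_neqAle measure_ge0 andbT eq_sym; apply/eqP => L0.
have := integral_gaussn n 1 (@ltr01 R).
have mg : measurable_fun setT (EFin \o gaussn n (1 : R)) by apply/measurable_EFinP; exact: measurable_gaussn2.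
have -> : (\int[lebesgue_rV R n]_v (gaussn n 1 v)%:E = 0)%E by exact: (null_set_integral measurableT mg L0).
by move=> /eqP; rewrite eqe eq_sym oner_eq0.
Qed.

Section one_function.
Variable f : 'rV[R]_n -> R[i].
Hypothesis mRe : measurable_fun setT (fun x => complex.Re (f x)).
Hypothesis mIm : measurable_fun setT (fun x => complex.Im (f x)).
Let v x := normc (f x).

Let mv : measurable_fun setT v.
Proof. exact: measurable_normc. Qed.

Let v0 x : 0 <= v x.
Proof. exact: normc_ge0. Qed.

Lemma convolution_cintegrable x : (abs_conv k v x < +oo)%E ->
  cintegrable (fun y => K (x - y) * f y).
Proof.
move=> nx; split.
  have [_ /(_ nx)] := rconv_le_abs_conv k ik v mv (fun y => complex.Re (f y)) x mRe (fun y => Re_le_normc _).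
  by under eq_fun do rewrite -Re_mulr_real.
have [_ /(_ nx)] := rconv_le_abs_conv k ik v mv (fun y => complex.Im (f y)) x mIm (fun y => Im_le_normc _).
by under eq_fun do rewrite -Im_mulr_real.
Qed.

Lemma normc_convolution_le x :
  ((normc (convolution K f x))%:E <= 2%:E * abs_conv k v x)%E.
Proof.
apply: (@le_trans _ _ (`|rconv k (fun y => complex.Re (f y)) x|%:E + `|rconv k (fun y => complex.Im (f y)) x|%:E)%E).
  by rewrite -EFinD lee_fin convolution_rconv; exact: normc_le_ReIm.
rewrite (_ : 2%:E * abs_conv k v x = abs_conv k v x + abs_conv k v x)%E; last by rewrite mule_natl mule2n.
apply: leeD.
  by have [] := rconv_le_abs_conv k ik v mv (fun y => complex.Re (f y)) x mRe (fun y => Re_le_normc _).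
by have [] := rconv_le_abs_conv k ik v mv (fun y => complex.Im (f y)) x mIm (fun y => Im_le_normc _).
Qed.

Lemma measurable_Re_convolution :
  measurable_fun setT (fun x => complex.Re (convolution K f x)).
Proof. by under eq_fun do rewrite convolution_rconv/=; exact: measurable_rconv. Qed.

Lemma measurable_Im_convolution :
  measurable_fun setT (fun x => complex.Im (convolution K f x)).
Proof. by under eq_fun do rewrite convolution_rconv/=; exact: measurable_rconv. Qed.

Let A0 : 0 <= A. Proof. exact: kernel_norm_ge0. Qed.

(** Valid at every x: where the right-hand side is infinite there is nothing to
    prove. *)
Lemma normc_convolution_powR r x : 1 <= r ->
  ((normc (convolution K f x) `^ r)%:E <= ((2 * (A + 1)) `^ r)%:E * powR_conv k v r x)%E.
Proof.
move=> r1.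
have c0 : 0 < (2 * (A + 1)) `^ r.
  by rewrite powR_gt0// mulr_gt0// ltr_wpDl.
have [px|] := boolP (powR_conv k v r x < +oo)%E; last first.
  by rewrite -leNgt leye_eq => /eqP ->; rewrite gt0_muley ?lte_fin// leey.
have nx := abs_conv_lty k ik v mv v0 r x r1 px.
have n0 : (0 <= abs_conv k v x)%E by apply: integral_ge0 => y _; rewrite lee_fin mulr_ge0.
have := normc_convolution_le x.
rewrite -(fineK (x := abs_conv k v x)) ?ge0_fin_numE// -EFinM lee_fin => h.
apply: (@le_trans _ _ ((2 `^ r)%:E * ((fine (abs_conv k v x)) `^ r)%:E)%E).
  rewrite -EFinM lee_fin -powRM ?fine_ge0//.
  apply: ge0_ler_powR => //; rewrite ?nnegrE ?normc_ge0 ?mulr_ge0 ?fine_ge0//.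
  by rewrite (le_trans ler01).
rewrite powRM ?addr_ge0// EFinM -muleA.
by apply: lee_wpmul2l; [rewrite lee_fin powR_ge0|exact: abs_conv_powR_le].
Qed.

(** Young's inequality for an L^1 kernel, with a constant that is not optimal.
    The integral defining the convolution converges at each point where
    |k| * |f|^r is finite, hence almost everywhere. *)
Lemma convolution_Lr r : 1 <= r -> in_Lp r%:E f ->
  {ae L, forall x, cintegrable (fun y => K (x - y) * f y)} /\
  in_Lp r%:E (convolution K f) /\
  (cLnorm r%:E (convolution K f) <= (2 * (A + 1) * A `^ r^-1)%:E * cLnorm r%:E f)%E.
Proof.
move=> r1 [_ _ fr].
have r0 : 0 < r by exact: lt_le_trans r1.
have rn0 : r != 0 by rewrite gt_eqF.
have LrE (g : 'rV[R]_n -> R[i]) :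
    cLnorm r%:E g = ((\int[L]_x (normc (g x) `^ r)%:E) `^ r^-1)%E.
  rewrite /cLnorm unlock.
  under eq_integral do rewrite gee0_abs ?lee_fin ?normc_ge0// poweR_EFin.
  by [].
have I0 : (0 <= \int[L]_x (normc (f x) `^ r)%:E)%E.
  by apply: integral_ge0 => x _; rewrite lee_fin powR_ge0.
have Ilt : (\int[L]_x (normc (f x) `^ r)%:E < +oo)%E.
  by apply: (@lty_poweRy _ _ r^-1); rewrite ?invr_eq0// -LrE.
have ip : (\int[L]_x powR_conv k v r x < +oo)%E.
  by rewrite (integral_powR_conv k ik v mv) lte_mul_pinfty// lee_fin.
have mc := measurable_normc _ measurable_Re_convolution measurable_Im_convolution.
have mpr := measurable_powR_conv k ik v mv r.
have le : (cLnorm r%:E (convolution K f) <= (2 * (A + 1) * A `^ r^-1)%:E * cLnorm r%:E f)%E.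
  rewrite !LrE.
  have -> : ((2 * (A + 1) * A `^ r^-1)%:E =
      (((2 * (A + 1)) `^ r)%:E * A%:E) `^ r^-1)%E.
    rewrite -EFinM poweR_EFin (@powRM _ ((2 * (A + 1)) `^ r) A r^-1) ?powR_ge0// -powRrM divff// powRr1//.
    by rewrite mulr_ge0 ?addr_ge0.
  rewrite -poweRM ?mule_ge0 ?lee_fin ?powR_ge0//.
  apply: gt0_ler_poweR; rewrite ?invr_ge0 ?(ltW r0)// ?in_itv/= ?leey ?andbT.
  - by apply: integral_ge0 => x _; rewrite lee_fin powR_ge0.
  - by rewrite !mule_ge0 ?lee_fin ?powR_ge0.
  rewrite -muleA -(integral_powR_conv k ik v mv) -ge0_integralZl//; last 2 first.
  - by move=> x _; exact: powR_conv_ge0.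
  - by rewrite lee_fin powR_ge0.
  apply: ge0_le_integral => //.
  - apply/measurable_EFinP; apply: (@measurableT_comp _ _ _ _ _ _ (fun s : R => s `^ r)) => //.
  - by apply: emeasurable_funM.
  by move=> x _; exact: normc_convolution_powR.
split; last split => //.
- have iP : L.-integrable setT (powR_conv k v r).
    apply/integrableP; split => //.
    by under eq_integral do rewrite gee0_abs ?powR_conv_ge0//.
  apply: filterS (integrable_ae measurableT iP) => x /(_ I) px.
  apply: convolution_cintegrable; apply: (abs_conv_lty k ik v mv v0 r) => //.
  by rewrite ltey_eq px.
split; [exact: measurable_Re_convolution|exact: measurable_Im_convolution|].
apply: le_lt_trans le _; apply: lte_mul_pinfty => //.
by rewrite lee_fin !mulr_ge0 ?addr_ge0 ?powR_ge0.
Qed.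

Lemma convolution_Loo : in_Lp +oo%E f ->
  {ae L, forall x, cintegrable (fun y => K (x - y) * f y)} /\
  in_Lp +oo%E (convolution K f) /\
  (cLnorm +oo%E (convolution K f) <= (2 * A)%:E * cLnorm +oo%E f)%E.
Proof.
move=> [_ _ fr].
have LE (g : 'rV[R]_n -> R[i]) :
    cLnorm +oo%E g = ess_sup L (abse \o (fun x => (normc (g x))%:E)).
  by rewrite /cLnorm unlock lebesgue_rV_gt0.
have B0 : (0 <= cLnorm +oo%E f)%E by exact: Lnorm_ge0.
have fB : {ae L, forall x, v x <= fine (cLnorm +oo%E f)}.
  have := @ess_sup_ge _ _ _ L (abse \o (fun x => (normc (f x))%:E)).
  apply: filterS => x; rewrite -LE -lee_fin fineK ?ge0_fin_numE//=.
  by rewrite ger0_norm ?normc_ge0.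
have nle x := abs_conv_le_sup k ik v mv v0 (fine (cLnorm +oo%E f)) x (fine_ge0 B0) fB.
have le : (cLnorm +oo%E (convolution K f) <= (2 * A)%:E * cLnorm +oo%E f)%E.
  rewrite [leLHS]LE; apply/ess_supP; apply: nearW => x /=.
  rewrite ger0_norm ?normc_ge0//; apply: le_trans (normc_convolution_le x) _.
  rewrite EFinM -muleA; apply: lee_wpmul2l => //; apply: le_trans (nle x) _.
  by rewrite EFinM (@fineK _ (cLnorm +oo f)%E) ?ge0_fin_numE.
split; last split => //.
- by apply: nearW => x; apply: convolution_cintegrable; exact: le_lt_trans (nle x) (ltry _).
split; [exact: measurable_Re_convolution|exact: measurable_Im_convolution|].
by apply: le_lt_trans le _; apply: lte_mul_pinfty => //; rewrite lee_fin mulr_ge0.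
Qed.

End one_function.

Lemma convolution_Lp (p : \bar R) : (1 <= p)%E ->
  exists M : R, forall f : 'rV[R]_n -> R[i], in_Lp p f ->
    {ae L, forall x, cintegrable (fun y => K (x - y) * f y)} /\
    in_Lp p (convolution K f) /\
    (cLnorm p (convolution K f) <= M%:E * cLnorm p f)%E.
Proof.
case: p => [r r1| _|//].
  by exists (2 * (A + 1) * A `^ r^-1) => f fr; have [mRe mIm _] := fr; exact: convolution_Lr.
by exists (2 * A) => f fr; have [mRe mIm _] := fr; exact: convolution_Loo.
Qed.

End convolution_Lp.

(** * The decomposition *)

Theorem lemma2p1 (R : realType) (beta : R) (hbeta : 0 < beta) :
  exists C : R, 0 < C /\
  forall (d : nat) (gamma lambda : R),
    (1 <= d)%N -> 0 <= gamma -> gamma <= 1 -> 1 < lambda ->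
  exists (P : 'rV[R]_d -> R) (K : 'rV[R]_d -> R[i]) (Const : R),
  (forall xi : 'rV[R]_d,
     enorm xi `^ gamma / ln (lambda + enorm xi) `^ beta =
     C * \int[@lebesgue_measure R]_(tau in `[0, gamma])
           (tau `^ (beta - 1) * enorm xi `^ (gamma - tau))
     + P xi) /\
  smooth_on [set xi : 'rV[R]_d | xi != 0] P /\
  in_Lp 1%:E K /\
  (cLnorm 1%:E K <= Const%:E)%E /\
  (forall xi : 'rV[R]_d, fourier K xi = (P xi)%:C%C) /\
  is_fourier_multiplier (fun xi => (P xi)%:C%C) (convolution K) /\
  (forall p : \bar R, (1 <= p)%E ->
     exists M : R, forall f : 'rV[R]_d -> R[i], in_Lp p f ->
       {ae lebesgue_rV R d, forall x, cintegrable (fun y => K (x - y) * f y)} /\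
       in_Lp p (convolution K f) /\
       (cLnorm p (convolution K f) <= M%:E * cLnorm p f)%E).
Proof.
exists (gamma_integral beta)^-1; split; first by rewrite invr_gt0 gamma_integral_gt0.
move=> d gam l _ gam0 gam1 l1.
have l0 : 0 < l := lt_trans ltr01 l1.
have gam01 : 0 <= gam <= 1 by rewrite gam0.
pose P (xi : 'rV[R]_d) := enorm xi `^ gam / ln (l + enorm xi) `^ beta -
  (gamma_integral beta)^-1 * \int[@lebesgue_measure R]_(tau in `[0, gam])
                     (tau `^ (beta - 1) * enorm xi `^ (gam - tau)).
(* The family of densities with transform u^s, pulled back along the exponent
   s = k + t - gam. *)
have fam := density_family_comp _ [set y : nat * measurableTypeR R | 0 < mix_exponent gam y]
  _ _ _ (@bessel_family R d l l0) (measurable_mix_exponent gam) (fun y => id).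
have iW := mix_weight_integrable beta gam l hbeta gam01 l1.
have WS := mix_exponent_gt0 beta gam l gam01.
pose k := mixture (@nat_line R) (mix_weight beta gam l)
  (fun p : (nat * measurableTypeR R) * 'rV[R]_d => bessel l (mix_exponent gam p.1, p.2)).
have ik : (lebesgue_rV R d).-integrable setT (EFin \o k).
  exact: (family_mixture_integrable (@nat_line R) _ _ _ fam _ iW WS).
have keven x : k (- x) = k x.
  exact: (family_mixture_even (@nat_line R) _ _ _ fam _ WS).
have kP xi : \int[lebesgue_rV R d]_x (k x * cos (dotv xi x)) = P xi.
  rewrite (family_mixture_cos (@nat_line R) _ _ _ fam _ iW WS).
  exact: (mixture_symbol beta gam l hbeta gam01 l1 _ (enorm_ge0 xi)).
pose K (x : 'rV[R]_d) : R[i] := (k x)%:C%C.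
have K1 : in_Lp 1%:E K := in_L1_real_kernel k ik.
exists P, K, (fine (cLnorm 1%:E K)); split; first by move=> xi; rewrite /P subrKC.
split.
  pose h (r : R) := r `^ gam * ln (l + r) `^ (- beta) +
    - (gamma_integral beta)^-1 * (r `^ gam * truncated_laplace gam beta (ln r)).
  have hs : radial_sym gam l h.
    apply: rs_add; first by apply: rs_mul; [exact: rs_pow|exact: rs_lnpow].
    apply: rs_mul; first exact: rs_cst.
    by apply: rs_mul; [exact: rs_pow|exact: rs_laplace].
  apply: (smooth_sym_on _ _ gam0 l1 _ _ _ (ss_rad _ _ _ _ hs)) => x x0.
  by rewrite /P /h (truncated_laplace_ln gam gam0 beta _ (enorm_gt0 _ _ x0) hbeta) powRN mulNr.
split; first exact: K1.
split.
  by have [_ _ K1oo] := K1; rewrite fineK// ge0_fin_numE// Lnorm_ge0.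
split; first exact: (fourier_even_kernel k ik keven P kP).
split; first exact: (even_kernel_multiplier k ik keven P kP).
exact: (convolution_Lp k ik).
Qed.
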